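(* Let $a,b,c,d,e$ be complex numbers with $\Re(c)<1$, and assume that all the expressions below are well-defined (i.e. no denominator vanishes: $a,c,d,e\notin\mathbb{Z}$, and in addition $d\neq e$ in part (ii)). (i) If $a+b=1$ and $d+e=2c+1$, then $$\sum_{0\leq n\leq m}\frac{(a,b)_n(c)_{n+1}}{n!\,(d,e)_{n+1}}\,\frac{m!\,(d,e)_m}{(a,b,c)_{m+1}}=\frac{2c}{\sin\pi c}\sum_{0\leq n}\frac{(-1)^n(2n+1)\cos\frac{\pi(d-n)}2\cos\frac{\pi(e-n)}2}{(n+a)(n+b)(n+d)(n+1-d)(n+e)(n+1-e)}.$$ (ii) If $a+b=1$ and $d+e=2c$, then $$\begin{aligned} &\sum_{0\leq n\leq m}\frac{(n+m+2c)\,(a,b,c)_n}{n!\,(d,e)_{n+1}}\,\frac{m!\,(d,e)_m}{(a,b,c)_{m+1}}\\ &=\frac 1{d-e}\sum_{0\leq n}\frac{2n+1}{(n+a)(n+b)}\left(\frac 1{(n+e)(n+1-e)}-\frac 1{(n+d)(n+1-d)}\right)\\ &\qquad+\frac{\sin\frac{\pi(d-e)}2}{(d-e)\sin\pi c}\sum_{0\leq n}\frac{(-1)^n(2n+1)}{(n+a)(n+b)}\left(\frac 1{(n+e)(n+1-e)}+\frac 1{(n+d)(n+1-d)}\right). \end{aligned}$$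
   Context: For complex numbers $a,a_1,\dots,a_r$ and a nonnegative integer $n$, the shifted factorials are $(a)_0=1$, $(a)_n=a(a+1)\cdots(a+n-1)$ for $n>0$, and $(a_1,\dots,a_r)_n=(a_1)_n\cdots(a_r)_n$. The sum over $0\leq n\leq m$ runs over all pairs $(n,m)$ of integers with $0\le n\le m$; the sum over $0\leq n$ runs over all nonnegative integers $n$. $\Re$ denotes the real part. *)

(* Defs.v *)
From Stdlib Require Export Reals Factorial List Lia.
From Coquelicot Require Export Coquelicot.
Export ListNotations.

Open Scope R_scope.
Open Scope C_scope.

Definition is_integer (z : C) : Prop := exists k : Z, z = RtoC (IZR k).

Fixpoint poch (a : C) (n : nat) : C :=
  match n with
  | O => 1
  | S k => poch a k * (a + INR k)
  end.

(* [pochs [a1; ...; ar] n] is (a1, ..., ar)_n. *)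
Definition pochs (l : list C) (n : nat) : C :=
  fold_right (fun a p => poch a n * p) (RtoC 1) l.

Definition cfact (n : nat) : C := RtoC (INR (fact n)).

Definition Cexp (z : C) : C :=
  RtoC (exp (Re z)) * (RtoC (cos (Im z)) + Ci * RtoC (sin (Im z))).

Definition Ccos (z : C) : C := (Cexp (Ci * z) + Cexp (- (Ci * z))) / 2.

Definition Csin (z : C) : C := (Cexp (Ci * z) - Cexp (- (Ci * z))) / (2 * Ci).

(* Finite subsets of [D] are represented by duplicate-free lists. *)
Definition finite_subset (D : nat * nat -> Prop) (F : list (nat * nat)) : Prop :=
  NoDup F /\ (forall p, In p F -> D p).

Definition finite_sum (f : nat * nat -> C) (F : list (nat * nat)) : C :=
  fold_right (fun p s => f p + s) (RtoC 0) F.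

(* The filter of sections of the finite subsets of [D], directed by inclusion. *)
Definition finite_subsets (D : nat * nat -> Prop)
    (P : list (nat * nat) -> Prop) : Prop :=
  exists F0, finite_subset D F0 /\
    forall F, finite_subset D F -> incl F0 F -> P F.

Global Instance finite_subsets_filter (D : nat * nat -> Prop) :
  ProperFilter (finite_subsets D).
Proof.
split.
- intros P [F0 [H0 H]]; exists F0; apply H; [exact H0 | apply incl_refl].
- split.
  + exists nil; repeat split; [constructor | intros p []].
  + intros P Q [F1 [[N1 D1] H1]] [F2 [[N2 D2] H2]].
    assert (dec : forall x y : nat * nat, {x = y} + {x <> y})
      by (decide equality; apply Nat.eq_dec).
    exists (nodup dec (F1 ++ F2)); split.
    * split; [apply NoDup_nodup|].
      intros p Hp; apply nodup_In, in_app_or in Hp.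
      destruct Hp; [now apply D1 | now apply D2].
    * intros F HF Hi; split; [apply H1 | apply H2]; trivial;
        intros p Hp; apply Hi, nodup_In, in_or_app; tauto.
  + intros P Q HPQ [F0 [H0 H]]; exists F0; split; auto.
Qed.

(* Unconditional convergence of the family [f] over the index set [D] to [s];
   in the complex numbers this is the same as absolute convergence. *)
Definition is_sum_over (D : nat * nat -> Prop) (f : nat * nat -> C) (s : C) : Prop :=
  filterlim (finite_sum f) (finite_subsets D) (locally s).

Definition is_sum_0_le_n_le_m (f : nat -> nat -> C) (s : C) : Prop :=
  is_sum_over (fun p => (fst p <= snd p)%nat) (fun p => f (fst p) (snd p)) s.

(* [is_series] for complex terms, with the scalars pinned down. *)
Definition is_Cseries (f : nat -> C) (s : C) : Prop :=
  @is_series C_AbsRing C_NormedModule f s.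

(* Main.v *)
Require Import Defs.
From Stdlib Require Import Lra Permutation.

(** Since a + b = 1, (j + a)(j + b) = j(j + 1) + ab, so for n <= m the quotient
    (a,b)_n / (a,b)_(m+1) is a product of simple poles in the variable ab.  Its
    partial fraction expansion [partial_fractions] has coefficients that factor, for
    each pole k, into a function of n times a function of m.  Inserting it in a double
    sum of (a,b)_n al(n) be(m) / (a,b)_(m+1) and exchanging the summations gives
    [tri_sum_spectral]: a single sum over k of
      (-1)^k (2k + 1) / ((k + a)(k + b)) * L_k * R_k,
    where L_k is a finite sum over n <= k and R_k a sum over m >= k.

    In both identities L_k and R_k belong to one family.  With d + e = 2c, take
      [alpha] n = (c)_n / (n! (d)_n (e)_(n+1)),   [beta] m = m! (d)_(m+1) (e)_m / (c)_(m+1).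
    Then L_k is a terminating 3F2(1) of Whipple's type and R_k a 3F2(1) of Watson's
    type.  Each satisfies a first-order recurrence in k that exchanges d and e; the
    recurrences are proved by telescoping with an explicit rational certificate
    ([whipple_telescopes], [watson_telescopes]), the second with a boundary term that
    vanishes because Re c < 1.  The initial value R_0 is a Gauss sum.  Iterating the
    relation between contiguous Gauss sums turns it into a limit of quotients of shifted
    factorials ([gauss_sum]), that is into a quotient of two sine products
    ([sin_product]); this is where sin(pi c) comes from.  The result is
      (-1)^k L_k R_k = (1 + (-1)^k V) / ((k + e)(k + 1 - e)),
      V = sin(pi (d - c)) / sin(pi c)     ([whipple_watson_value]).

    Identity (ii) follows from
      (n + m + 2c)(d - e) = (n + d)(m + d) - (n + e)(m + e),
    which writes its left side as 1/(d - e) times the difference of the basic double sum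
    for (d, e) and the one for (e, d).  In identity (i), where d + e = 2c + 1, the summand
    is a constant times [alpha] at (d + 1, e, c + 1) times [beta] at (d - 1, e, c); the two
    closed forms are matched by [whipple_value_shift], and the cosines in the statement
    are unfolded by [cos_cos_term].

    Two analytic points remain.  Unconditional convergence amounts to a bound for the
    triangular sums of absolute values ([pair_term_abs]).  The passage to the limit under
    the sum over k, where R_k is truncated at m < M, needs a bound of L_k times the
    truncated R_k that is uniform in M: the truncated sums are dominated by a positive sum
    with the same telescoping property ([watson_majorant_step]), and the product with L_k
    then decreases fast enough ([whipple_watson_bound]).  All growth estimates come from
    one comparison principle for sequences with rational ratios ([lin_dominated]). *)

(** * Finite sums, limits and dominated convergence in the complex plane *)

Fixpoint csum (f : nat -> C) (n : nat) : C :=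
  match n with
  | O => 0
  | S m => csum f m + f m
  end.

Fixpoint rsum (f : nat -> R) (n : nat) : R :=
  match n with
  | O => 0%R
  | S m => (rsum f m + f m)%R
  end.

(** Convergence in C as convergence of the modulus of the error, so that the real
    squeeze theorems apply. *)
Definition Clim (u : nat -> C) (l : C) : Prop :=
  is_lim_seq (fun n => Cmod (u n - l)) 0.

Lemma RtoC_INR_S n : RtoC (INR (S n)) = INR n + 1.
Proof. now rewrite S_INR, RtoC_plus. Qed.

Lemma csum_ext f g n : (forall i, (i < n)%nat -> f i = g i) -> csum f n = csum g n.
Proof.
induction n as [|n IH]; simpl; intros H; trivial.
rewrite IH, H; auto with arith.
Qed.

Lemma csum_0 (f : nat -> C) n : (forall i, (i < n)%nat -> f i = 0) -> csum f n = 0.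
Proof.
induction n as [|n IH]; simpl; intros H; trivial.
rewrite IH, H; auto with arith. ring.
Qed.

Lemma csum_plus f g n : csum (fun i => f i + g i) n = csum f n + csum g n.
Proof. induction n as [|n IH]; simpl; [ring | rewrite IH; ring]. Qed.

Lemma csum_scal a f n : csum (fun i => a * f i) n = a * csum f n.
Proof. induction n as [|n IH]; simpl; [ring | rewrite IH; ring]. Qed.

Lemma csum_swap (f : nat -> nat -> C) n m :
  csum (fun i => csum (f i) m) n = csum (fun j => csum (fun i => f i j) n) m.
Proof.
induction n as [|n IH]; simpl.
- symmetry; now apply csum_0.
- now rewrite IH, csum_plus.
Qed.

Lemma csum_telescope f G n :
  (forall i, (i < n)%nat -> f i = G (S i) - G i) -> csum f n = G n - G O.
Proof.
induction n as [|n IH]; simpl; intros H; [ring|].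
rewrite IH, H; auto with arith. ring.
Qed.

Lemma csum_shift f n : csum f (S n) = f O + csum (fun i => f (S i)) n.
Proof. induction n as [|n IH]; simpl in *; [ring | rewrite IH; ring]. Qed.

Lemma csum_stable (f : nat -> C) n N :
  (n <= N)%nat -> (forall i, (n <= i)%nat -> f i = 0) -> csum f N = csum f n.
Proof.
intros H Hf; induction H as [|N H IH]; trivial.
simpl; rewrite IH, Hf by trivial; ring.
Qed.

Lemma rsum_ext f g n : (forall i, (i < n)%nat -> f i = g i) -> rsum f n = rsum g n.
Proof.
induction n as [|n IH]; simpl; intros H; trivial.
rewrite IH, H; auto with arith.
Qed.

Lemma rsum_le f g n :
  (forall i, (i < n)%nat -> (f i <= g i)%R) -> (rsum f n <= rsum g n)%R.
Proof.
induction n as [|n IH]; simpl; intros H; [lra|].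
apply Rplus_le_compat; [apply IH; auto with arith | apply H; auto with arith].
Qed.

Lemma rsum_ge0 f n : (forall i, (i < n)%nat -> (0 <= f i)%R) -> (0 <= rsum f n)%R.
Proof.
induction n as [|n IH]; simpl; intros H; [lra|].
assert (0 <= f n)%R by auto with arith.
assert (0 <= rsum f n)%R by auto with arith. lra.
Qed.

Lemma rsum_scal a f n : rsum (fun i => (a * f i)%R) n = (a * rsum f n)%R.
Proof. induction n as [|n IH]; simpl; [ring | rewrite IH; ring]. Qed.

Lemma rsum_plus f g n : rsum (fun i => (f i + g i)%R) n = (rsum f n + rsum g n)%R.
Proof. induction n as [|n IH]; simpl; [ring | rewrite IH; ring]. Qed.

Lemma rsum_mono f n m :
  (forall i, (0 <= f i)%R) -> (n <= m)%nat -> (rsum f n <= rsum f m)%R.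
Proof.
intros H Hn; induction Hn as [|m Hn IH]; [lra|].
simpl; specialize (H m); lra.
Qed.

Lemma Cmod_csum f n : (Cmod (csum f n) <= rsum (fun i => Cmod (f i)) n)%R.
Proof.
induction n as [|n IH]; simpl; [rewrite Cmod_0; lra|].
eapply Rle_trans; [apply Cmod_triangle|]; lra.
Qed.

Lemma sum_n_csum (f : nat -> C) n :
  @sum_n (AbsRing.AbelianMonoid C_AbsRing) f n = csum f (S n).
Proof.
induction n as [|n IH].
- rewrite sum_O; simpl; ring.
- rewrite sum_Sn, IH; reflexivity.
Qed.

Lemma Clim_eps u l :
  Clim u l <-> forall eps : R, (0 < eps)%R ->
    exists N, forall n, (N <= n)%nat -> (Cmod (u n - l) < eps)%R.
Proof.
unfold Clim; split.
- intros H eps He; apply is_lim_seq_spec in H.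
  destruct (H (mkposreal eps He)) as [N HN]; exists N; intros n Hn.
  specialize (HN n Hn); simpl in HN; rewrite Rminus_0_r, Rabs_pos_eq in HN;
    [trivial | apply Cmod_ge_0].
- intros H; apply is_lim_seq_spec; intros [eps He].
  destruct (H eps He) as [N HN]; exists N; intros n Hn; simpl.
  rewrite Rminus_0_r, Rabs_pos_eq; [now apply HN | apply Cmod_ge_0].
Qed.

Lemma Clim_ext u v l : (forall n, u n = v n) -> Clim u l -> Clim v l.
Proof. intros H; apply is_lim_seq_ext; intros n; now rewrite H. Qed.

Lemma Clim_ext_loc u v l N :
  (forall n, (N <= n)%nat -> u n = v n) -> Clim u l -> Clim v l.
Proof.
intros H; apply is_lim_seq_ext_loc; exists N; intros n Hn; now rewrite H.
Qed.

Lemma Clim_eq u l m : Clim u l -> l = m -> Clim u m.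
Proof. now intros H <-. Qed.

Lemma Clim_const l : Clim (fun _ => l) l.
Proof.
apply is_lim_seq_ext with (fun _ => 0%R); [|apply is_lim_seq_const].
intros n; replace (l - l) with (RtoC 0) by ring; now rewrite Cmod_0.
Qed.

Lemma Clim_squeeze u l v :
  (forall n, (Cmod (u n - l) <= v n)%R) -> is_lim_seq v 0 -> Clim u l.
Proof.
intros H Hv; apply is_lim_seq_le_le with (fun _ => 0%R) v; trivial.
- intros n; split; [apply Cmod_ge_0 | apply H].
- apply is_lim_seq_const.
Qed.

Lemma Clim_plus u v l m : Clim u l -> Clim v m -> Clim (fun n => u n + v n) (l + m).
Proof.
intros Hu Hv.
apply Clim_squeeze with (fun n => (Cmod (u n - l) + Cmod (v n - m))%R).
- intros n; replace (u n + v n - (l + m)) with ((u n - l) + (v n - m)) by ring.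
  apply Cmod_triangle.
- replace (Finite 0) with (Rbar_plus (Finite 0) (Finite 0)) by (simpl; f_equal; ring).
  now apply is_lim_seq_plus'.
Qed.

Lemma Clim_scal a u l : Clim u l -> Clim (fun n => a * u n) (a * l).
Proof.
intros Hu.
apply Clim_squeeze with (fun n => (Cmod a * Cmod (u n - l))%R).
- intros n; replace (a * u n - a * l) with (a * (u n - l)) by ring.
  rewrite Cmod_mult; apply Rle_refl.
- replace (Finite 0) with (Rbar_mult (Cmod a) 0) by (simpl; f_equal; ring).
  now apply is_lim_seq_scal_l.
Qed.

Lemma Clim_minus u v l m : Clim u l -> Clim v m -> Clim (fun n => u n - v n) (l - m).
Proof.
intros Hu Hv; apply (Clim_scal (-(1))) in Hv.
apply Clim_ext with (fun n => u n + (-(1)) * v n); [intros; ring|].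
replace (l - m) with (l + (-(1)) * m) by ring; now apply Clim_plus.
Qed.

Lemma Clim_mult u v l m : Clim u l -> Clim v m -> Clim (fun n => u n * v n) (l * m).
Proof.
intros Hu Hv.
assert (H : Clim (fun n => (u n - l) * (v n - m)) 0).
{ apply is_lim_seq_ext with (fun n => (Cmod (u n - l) * Cmod (v n - m))%R).
  - intros n; rewrite <- Cmod_mult; f_equal; ring.
  - replace (Finite 0) with (Finite (0 * 0)%R) by (f_equal; ring).
    now apply is_lim_seq_mult'. }
apply Clim_ext with (fun n => (u n - l) * (v n - m) + (l * v n + (m * u n - l * m)));
  [intros; ring|].
apply Clim_eq with (0 + (l * m + (m * l - l * m))); [|ring].
apply Clim_plus; trivial.
apply Clim_plus; [now apply Clim_scal|].
apply Clim_minus; [now apply Clim_scal | apply Clim_const].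
Qed.

Lemma Clim_unique u l m : Clim u l -> Clim u m -> l = m.
Proof.
intros Hl Hm.
assert (H : Clim (fun _ : nat => RtoC 0) (l - m)).
{ apply Clim_ext with (fun n => u n - u n); [intros; ring|].
  now apply Clim_minus. }
unfold Clim in H.
apply is_lim_seq_unique in H; rewrite Lim_seq_const in H.
injection H; intros H'; apply Cmod_eq_0 in H'.
replace l with (m - (0 - (l - m))) by ring; rewrite H'; ring.
Qed.

Lemma Clim_S u l : Clim u l <-> Clim (fun n => u (S n)) l.
Proof. apply (is_lim_seq_incr_1 (fun n => Cmod (u n - l))). Qed.

Lemma Cmod_minus_sym x y : Cmod (x - y) = Cmod (y - x).
Proof. replace (x - y) with (- (y - x)) by ring; apply Cmod_opp. Qed.

Lemma Cmod_triangle_rev x y : (Cmod x - Cmod y <= Cmod (x - y))%R.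
Proof.
assert (H := Cmod_triangle (x - y) y).
replace (x - y + y) with x in H by ring; lra.
Qed.

Lemma Clim_inv (u : nat -> C) (l : C) : l <> 0 -> Clim u l -> Clim (fun n => / u n) (/ l).
Proof.
intros Hl Hu.
assert (Hpos : (0 < Cmod l)%R) by (apply -> Cmod_gt_0; exact Hl).
assert (Hu' := proj1 (Clim_eps u l) Hu (Cmod l / 2)%R ltac:(lra)).
destruct Hu' as [N HN].
assert (Hu2 : is_lim_seq (fun n => (2 / (Cmod l * Cmod l) * Cmod (u n - l))%R) 0).
{ replace (Finite 0) with (Rbar_mult (2 / (Cmod l * Cmod l))%R 0)
    by (simpl; f_equal; ring).
  now apply is_lim_seq_scal_l. }
apply is_lim_seq_le_le_loc with (2 := is_lim_seq_const 0) (3 := Hu2).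
exists N; intros n Hn; split; [apply Cmod_ge_0|].
specialize (HN n Hn).
assert (Hun : (Cmod l / 2 < Cmod (u n))%R).
{ assert (H := Cmod_triangle_rev l (u n)); rewrite Cmod_minus_sym in H; lra. }
assert (u n <> 0) by (apply Cmod_gt_0; lra).
replace (/ u n - / l) with ((l - u n) * / (u n * l)) by (field; split; trivial).
rewrite Cmod_mult, Cmod_inv, Cmod_mult, Cmod_minus_sym by now apply Cmult_neq_0.
assert (H0 := Cmod_ge_0 (u n - l)).
rewrite Rmult_comm; apply Rmult_le_compat_r; trivial.
replace (2 / (Cmod l * Cmod l))%R with (/ (Cmod l / 2 * Cmod l))%R by (field; lra).
apply Rinv_le_contravar; [apply Rmult_lt_0_compat; lra|].
apply Rmult_le_compat_r; lra.
Qed.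

Lemma is_Cseries_csum f l : is_Cseries f l <-> Clim (csum f) l.
Proof.
rewrite Clim_S.
unfold is_Cseries, is_series.
split; intros H.
- apply Clim_eps; intros eps He.
  assert (HN := proj1 (@filterlim_locally_ball_norm C_AbsRing nat C_NormedModule
    eventually (filter_filter) (sum_n f) l) H (mkposreal eps He)).
  destruct HN as [N HN].
  exists N; intros n Hn; specialize (HN n Hn).
  unfold ball_norm in HN; simpl in HN.
  change (norm (minus (sum_n f n) l)) with (Cmod (sum_n f n - l)) in HN.
  now rewrite <- sum_n_csum.
- apply (proj2 (@filterlim_locally_ball_norm C_AbsRing nat C_NormedModule
    eventually (filter_filter) (sum_n f) l)).
  intros [eps He].
  destruct (proj1 (Clim_eps _ _) H eps He) as [N HN].
  exists N; intros n Hn; specialize (HN n Hn); simpl in HN.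
  unfold ball_norm; simpl.
  change (norm (minus (sum_n f n) l)) with (Cmod (sum_n f n - l)).
  now rewrite sum_n_csum.
Qed.

Lemma sum_n_rsum (f : nat -> R) n :
  @sum_n (AbsRing.AbelianMonoid R_AbsRing) f n = rsum f (S n).
Proof.
induction n as [|n IH].
- rewrite sum_O; simpl; ring.
- rewrite sum_Sn, IH; reflexivity.
Qed.

Lemma rsum_bounded_cvg f B :
  (forall n, (0 <= f n)%R) -> (forall n, (rsum f n <= B)%R) ->
  exists l : R, is_lim_seq (rsum f) l.
Proof.
intros H0 HB.
assert (Hx : ex_finite_lim_seq (rsum f)).
{ apply ex_finite_lim_seq_incr with B; trivial.
  intros n; simpl; specialize (H0 n); lra. }
exact Hx.
Qed.

Lemma Clim_csum_abs f B :
  (forall n, (rsum (fun i => Cmod (f i)) n <= B)%R) ->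
  exists l, Clim (csum f) l.
Proof.
intros HB.
destruct (rsum_bounded_cvg (fun i => Cmod (f i)) B) as [L HL]; trivial.
{ intros; apply Cmod_ge_0. }
assert (Hex : @ex_series C_AbsRing C_CompleteNormedModule f).
{ apply (@ex_series_le C_AbsRing C_CompleteNormedModule f (fun i => Cmod (f i))).
  - intros n; apply Rle_refl.
  - exists L; unfold is_series.
    apply is_lim_seq_incr_1 in HL.
    apply (is_lim_seq_ext _ (sum_n (fun i => Cmod (f i))) L) in HL; [exact HL|].
    intros n; now rewrite <- sum_n_rsum. }
destruct Hex as [l Hl]; exists l.
now apply is_Cseries_csum.
Qed.

Lemma Clim_Cmod_le u l B : Clim u l -> (forall n, (Cmod (u n) <= B)%R) -> (Cmod l <= B)%R.
Proof.
intros H HB; apply Rnot_lt_le; intros Hl.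
destruct (proj1 (Clim_eps _ _) H (Cmod l - B)%R ltac:(lra)) as [N HN].
specialize (HN N (le_n N)); specialize (HB N).
assert (Ht := Cmod_triangle_rev l (u N)); rewrite Cmod_minus_sym in Ht; lra.
Qed.

Lemma Clim_csum_tail f B K eps :
  (forall n, (0 <= f n)%R) -> (forall n, (rsum f n <= B)%R) -> (0 < eps)%R ->
  exists N, (K <= N)%nat /\ forall n, (N <= n)%nat -> (rsum f n - rsum f N < eps)%R.
Proof.
intros H0 HB He.
destruct (rsum_bounded_cvg f B H0 HB) as [L HL].
apply is_lim_seq_spec in HL.
assert (He2 : (0 < eps / 2)%R) by lra.
destruct (HL (mkposreal _ He2)) as [N HN]; simpl in HN.
exists (max K N); split; [lia|]; intros n Hn.
assert (A := HN n ltac:(lia)); assert (A' := HN (max K N) ltac:(lia)).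
apply Rabs_def2 in A; apply Rabs_def2 in A'; lra.
Qed.

Lemma Clim_csum_finite (F : nat -> nat -> C) f N :
  (forall k, Clim (fun M => F M k) (f k)) ->
  Clim (fun M => csum (F M) N) (csum f N).
Proof.
intros H; induction N as [|N IH]; simpl; [apply Clim_const|].
now apply Clim_plus.
Qed.

Lemma csum_minus_bound f g n m :
  (n <= m)%nat -> (forall k, (n <= k)%nat -> (Cmod (f k) <= g k)%R) ->
  (Cmod (csum f m - csum f n) <= rsum g m - rsum g n)%R.
Proof.
intros Hn H; induction Hn as [|m Hn IH].
- replace (csum f n - csum f n) with (RtoC 0) by ring; rewrite Cmod_0; lra.
- simpl; replace (csum f m + f m - csum f n) with ((csum f m - csum f n) + f m) by ring.
  eapply Rle_trans; [apply Cmod_triangle|]; specialize (H m Hn); lra.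
Qed.

(** Dominated convergence for series.  The domination is only required for k >= K:
    the finitely many remaining columns converge by hypothesis. *)
Lemma tannery (F : nat -> nat -> C) f g B K :
  (forall k, Clim (fun M => F M k) (f k)) ->
  (forall M k, (K <= k)%nat -> (Cmod (F M k) <= g k)%R) ->
  (forall k, (0 <= g k)%R) -> (forall n, (rsum g n <= B)%R) ->
  exists S, Clim (csum f) S /\ Clim (fun M => csum (F M) M) S.
Proof.
intros HF Hg Hg0 HB.
assert (Hf : forall k, (K <= k)%nat -> (Cmod (f k) <= g k)%R).
{ intros k Hk; apply Clim_Cmod_le with (fun M => F M k); auto. }
assert (HS : exists S, Clim (csum f) S).
{ apply Clim_csum_abs with (rsum (fun i => Cmod (f i)) K + B)%R.
  intros n.
  apply Rle_trans with (rsum (fun i => Cmod (f i)) K + rsum g n)%R;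
    [|specialize (HB n); lra].
  destruct (Nat.le_gt_cases K n) as [Hn|Hn].
  - induction Hn as [|n Hn IH]; [assert (H := rsum_ge0 g K ltac:(auto)); lra|].
    simpl; specialize (Hf n Hn); lra.
  - assert (H := rsum_ge0 g n ltac:(auto)).
    assert (H' := rsum_mono (fun i => Cmod (f i)) n K ltac:(intros; apply Cmod_ge_0)
      ltac:(lia)); lra. }
destruct HS as [S HS]; exists S; split; trivial.
apply Clim_eps; intros eps He.
destruct (Clim_csum_tail g B K (eps / 4) Hg0 HB ltac:(lra)) as [N [HKN HN]].
destruct (proj1 (Clim_eps _ _) (Clim_csum_finite F f N HF) (eps / 4)%R ltac:(lra))
  as [N1 HN1].
destruct (proj1 (Clim_eps _ _) HS (eps / 4)%R ltac:(lra)) as [N2 HN2].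
exists (max N (max N1 N2)); intros M HM.
assert (A1 := HN1 M ltac:(lia)); assert (A2 := HN2 M ltac:(lia)).
assert (A3 := HN M ltac:(lia)).
assert (A4 := csum_minus_bound (F M) g N M ltac:(lia) ltac:(intros; apply Hg; lia)).
assert (A5 := csum_minus_bound f g N M ltac:(lia) ltac:(intros; apply Hf; lia)).
replace (csum (F M) M - S) with
  ((csum (F M) M - csum (F M) N) + ((csum (F M) N - csum f N)
     + ((csum f N - csum f M) + (csum f M - S)))) by ring.
rewrite Cmod_minus_sym in A5.
eapply Rle_lt_trans; [apply Cmod_triangle|].
eapply Rle_lt_trans; [apply Rplus_le_compat_l, Cmod_triangle|].
eapply Rle_lt_trans; [apply Rplus_le_compat_l, Rplus_le_compat_l, Cmod_triangle|].
lra.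
Qed.

Lemma Cmult_reg_l (a x y : C) : a <> 0 -> a * x = a * y -> x = y.
Proof.
intros Ha H; replace x with (/ a * (a * x)) by (field; trivial).
rewrite H; field; trivial.
Qed.

(** * Comparing sequences whose ratios are rational functions *)

(** [lin A n] is the value at n of the monic polynomial with roots -a, a in A; the
    hypergeometric sequences below have ratios [lin A n / lin B n]. *)
Definition lin (A : list C) (n : nat) : C :=
  fold_right (fun a p => (INR n + a) * p) (RtoC 1) A.

Definition re_sum (A : list C) : R :=
  fold_right (fun a s => (Re a + s)%R) 0%R A.

Lemma lin_app A B n : lin (A ++ B) n = lin A n * lin B n.
Proof. induction A as [|a A IH]; simpl; [ring | rewrite IH; ring]. Qed.

Lemma re_sum_app A B : re_sum (A ++ B) = (re_sum A + re_sum B)%R.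
Proof. induction A as [|a A IH]; simpl; [ring | rewrite IH; ring]. Qed.

Lemma is_lim_seq_inv_shift (x : R) : is_lim_seq (fun n => (/ (INR n + x))%R) 0.
Proof.
replace (Finite 0) with (Rbar_inv p_infty) by reflexivity.
apply is_lim_seq_inv; [|discriminate].
eapply is_lim_seq_plus; [apply is_lim_seq_INR | apply is_lim_seq_const | reflexivity].
Qed.

Lemma INR_eventually (x : R) : exists N, forall n, (N <= n)%nat -> (x < INR n)%R.
Proof.
destruct (INR_unbounded x) as [N HN]; exists N; intros n Hn.
apply le_INR in Hn; lra.
Qed.

Lemma Cmod_shift_asym (a : C) :
  is_lim_seq (fun n => (Cmod (INR n + a) - INR n)%R) (Re a).
Proof.
set (x := Re a); set (y := Im a).
destruct (INR_eventually (- x)) as [N HN].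
assert (Hs : forall n, Cmod (INR n + a) = sqrt ((INR n + x) ^ 2 + y ^ 2)%R).
{ intros n; unfold Cmod, x, y, Re, Im; destruct a as [a1 a2]; simpl; do 2 f_equal; ring. }
apply is_lim_seq_le_le_loc with (u := fun _ => x)
  (w := fun n => (x + y ^ 2 * / (INR n + x))%R).
- exists N; intros n Hn; specialize (HN n Hn); rewrite Hs; split.
  + assert (INR n + x <= sqrt ((INR n + x) ^ 2 + y ^ 2))%R; [|lra].
    rewrite <- (sqrt_pow2 (INR n + x)) at 1 by lra.
    apply sqrt_le_1_alt; nra.
  + set (t := (INR n + x)%R) in *.
    assert (Ht : (0 < t)%R) by (unfold t; lra).
    assert (sqrt (t ^ 2 + y ^ 2) <= t + y ^ 2 * / t)%R; [|unfold t in *; lra].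
    assert (Hq : (0 <= y ^ 2 * / t)%R).
    { apply Rmult_le_pos; [apply pow2_ge_0 | left; now apply Rinv_0_lt_compat]. }
    rewrite <- (sqrt_pow2 (t + y ^ 2 * / t)) by lra.
    apply sqrt_le_1_alt.
    replace ((t + y ^ 2 * / t) ^ 2)%R with (t ^ 2 + 2 * y ^ 2 + (y ^ 2 * / t) ^ 2)%R
      by (field; lra).
    assert (0 <= y ^ 2)%R by apply pow2_ge_0.
    assert (0 <= (y ^ 2 * / t) ^ 2)%R by apply pow2_ge_0. lra.
- apply is_lim_seq_const.
- replace (Finite x) with (Finite (x + y ^ 2 * 0)%R) by (f_equal; ring).
  apply is_lim_seq_plus'; [apply is_lim_seq_const|].
  replace (Finite (y ^ 2 * 0)%R) with (Rbar_mult (y ^ 2)%R 0) by reflexivity.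
  apply is_lim_seq_scal_l, is_lim_seq_inv_shift.
Qed.

Definition nlin (A : list C) (n : nat) : R := (Cmod (lin A n) / INR n ^ length A)%R.

(** [|lin A n| / n^(length A) = 1 + (re_sum A) / n + o(1/n)]: only the real parts of the
    roots matter to first order. *)
Lemma nlin_asym A : is_lim_seq (fun n => (INR n * (nlin A n - 1))%R) (re_sum A).
Proof.
induction A as [|a A IH].
- apply is_lim_seq_ext with (fun _ => 0%R); [|apply is_lim_seq_const].
  intros n; unfold nlin; simpl; rewrite Cmod_1; field.
- simpl re_sum.
  assert (H1 : is_lim_seq (fun n => nlin A n) 1).
  { apply is_lim_seq_ext_loc with
      (fun n => ((INR n * (nlin A n - 1)) * / (INR n + 0) + 1)%R).
    - exists 1%nat; intros n Hn; apply le_INR in Hn; simpl in Hn; field; lra.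
    - replace (Finite 1) with (Finite (re_sum A * 0 + 1)%R) by (f_equal; ring).
      apply is_lim_seq_plus'; [|apply is_lim_seq_const].
      apply is_lim_seq_mult'; [exact IH | apply is_lim_seq_inv_shift]. }
  apply is_lim_seq_ext_loc with
    (fun n => ((Cmod (INR n + a) - INR n) * nlin A n + INR n * (nlin A n - 1))%R).
  + exists 1%nat; intros n Hn; apply le_INR in Hn; simpl in Hn.
    unfold nlin; simpl; rewrite Cmod_mult; field; split; [|lra].
    apply pow_nonzero; lra.
  + replace (Finite (Re a + re_sum A)%R) with (Finite (Re a * 1 + re_sum A)%R)
      by (f_equal; ring).
    apply is_lim_seq_plus'; trivial.
    apply is_lim_seq_mult'; trivial; apply Cmod_shift_asym.
Qed.

(** Comparing the first-order terms of [nlin_asym]. *)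
Lemma lin_eventually_le A B :
  length A = length B -> (re_sum A < re_sum B)%R ->
  exists N, forall n, (N <= n)%nat -> (Cmod (lin A n) <= Cmod (lin B n))%R.
Proof.
intros Hl Hs.
assert (HA := nlin_asym A); assert (HB := nlin_asym B).
assert (HD := is_lim_seq_minus' _ _ _ _ HB HA).
apply is_lim_seq_spec in HD.
assert (Hp : (0 < re_sum B - re_sum A)%R) by lra.
destruct (HD (mkposreal _ Hp)) as [N HN]; simpl in HN.
exists (S N); intros n Hn.
specialize (HN n ltac:(lia)).
apply Rabs_def2 in HN; destruct HN as [_ HN].
assert (Hn1 : (0 < INR n)%R) by (apply lt_0_INR; lia).
assert (H : (0 < INR n * (nlin B n - nlin A n))%R) by lra.
assert (H' : (nlin A n < nlin B n)%R).
{ apply Rmult_lt_reg_l with (INR n); trivial; lra. }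
unfold nlin in H'; rewrite Hl in H'.
left; apply Rmult_lt_reg_r with (/ INR n ^ length B)%R; trivial.
apply Rinv_0_lt_compat, pow_lt; trivial.
Qed.

Lemma lin_eventually_neq0 A : exists N, forall n, (N <= n)%nat -> lin A n <> 0.
Proof.
induction A as [|a A [N HN]].
- exists O; intros n _; simpl; apply C1_nz.
- destruct (INR_eventually (- Re a)) as [M HM]; exists (max M N); intros n Hn.
  simpl; apply Cmult_neq_0; [|apply HN; lia].
  intros H; specialize (HM n ltac:(lia)).
  apply (f_equal Re) in H; destruct a as [a1 a2]; simpl in H; simpl in HM; lra.
Qed.

Lemma ratio_dominated (u : nat -> C) (v : nat -> R) (N : nat) :
  (forall n, (0 < v n)%R) ->
  (forall n, (N <= n)%nat -> (Cmod (u (S n)) * v n <= Cmod (u n) * v (S n))%R) ->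
  exists K, (0 < K)%R /\ forall n, (Cmod (u n) <= K * v n)%R.
Proof.
intros Hv H.
assert (Hfin : exists K, (0 < K)%R /\ forall n, (n <= N)%nat -> (Cmod (u n) <= K * v n)%R).
{ clear H; induction N as [|M [K [HK0 HK]]].
  - exists (Cmod (u O) / v O + 1)%R.
    assert (0 < v O)%R by apply Hv.
    assert (0 <= Cmod (u O) / v O)%R.
    { apply Rmult_le_pos; [apply Cmod_ge_0 | left; now apply Rinv_0_lt_compat]. }
    split; [lra|]; intros n Hn; replace n with O by lia.
    replace ((Cmod (u O) / v O + 1) * v O)%R with (Cmod (u O) + v O)%R by (field; lra).
    lra.
  - exists (K + Cmod (u (S M)) / v (S M))%R.
    assert (0 < v (S M))%R by apply Hv.
    assert (0 <= Cmod (u (S M)) / v (S M))%R.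
    { apply Rmult_le_pos; [apply Cmod_ge_0 | left; now apply Rinv_0_lt_compat]. }
    split; [lra|]; intros n Hn; destruct (Nat.eq_dec n (S M)) as [->|Hne].
    + replace ((K + Cmod (u (S M)) / v (S M)) * v (S M))%R
        with (K * v (S M) + Cmod (u (S M)))%R by (field; lra); nra.
    + specialize (HK n ltac:(lia)); assert (0 < v n)%R by apply Hv; nra. }
destruct Hfin as [K [HK0 HK]]; exists K; split; trivial.
intros n; destruct (Nat.le_gt_cases n N) as [Hn|Hn]; [now apply HK|].
assert (Hn' : (N <= n)%nat) by lia; clear Hn.
induction Hn' as [|n Hn IH]; [now apply HK|].
specialize (H n Hn); assert (H0 := Hv n); assert (H1 := Hv (S n)).
apply Rmult_le_reg_r with (v n); trivial.
nra.
Qed.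

(** If u has ratio [lin A / lin B] and v > 0 has ratio [lin A' / lin B'], then u
    has order at most n^(re_sum A - re_sum B) and v has order n^(re_sum A' - re_sum B'); the
    last hypothesis says that the first exponent is strictly smaller. *)
Lemma lin_dominated (u : nat -> C) (v : nat -> R) (A B A' B' : list C) (N : nat) :
  (forall n, (0 < v n)%R) ->
  (forall n, (N <= n)%nat -> u (S n) * lin B n = u n * lin A n) ->
  (forall n, (N <= n)%nat -> v (S n) * lin B' n = v n * lin A' n) ->
  length (A ++ B') = length (B ++ A') ->
  (re_sum (A ++ B') < re_sum (B ++ A'))%R ->
  exists K, (0 < K)%R /\ forall n, (Cmod (u n) <= K * v n)%R.
Proof.
intros Hv Hu Hv' Hl Hs.
destruct (lin_eventually_le _ _ Hl Hs) as [N1 H1].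
destruct (lin_eventually_neq0 (B ++ B')) as [N2 H2].
apply ratio_dominated with (max N (max N1 N2)); trivial.
intros n Hn.
specialize (H1 n ltac:(lia)); specialize (H2 n ltac:(lia)).
specialize (Hu n ltac:(lia)); specialize (Hv' n ltac:(lia)).
rewrite !lin_app, !Cmod_mult in H1; rewrite lin_app in H2.
apply (f_equal Cmod) in Hu; apply (f_equal Cmod) in Hv'.
apply Cmod_gt_0 in H2.
rewrite !Cmod_mult in Hu, Hv'; rewrite Cmod_mult in H2.
rewrite !Cmod_R, !Rabs_pos_eq in Hv' by (left; apply Hv).
apply Rmult_le_reg_r with (Cmod (lin B n) * Cmod (lin B' n))%R; trivial.
replace (Cmod (u (S n)) * v n * (Cmod (lin B n) * Cmod (lin B' n)))%R
  with ((Cmod (u (S n)) * Cmod (lin B n)) * Cmod (lin B' n) * v n)%R by ring.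
replace (Cmod (u n) * v (S n) * (Cmod (lin B n) * Cmod (lin B' n)))%R
  with ((v (S n) * Cmod (lin B' n)) * Cmod (lin B n) * Cmod (u n))%R by ring.
rewrite Hu, Hv'.
replace (Cmod (u n) * Cmod (lin A n) * Cmod (lin B' n) * v n)%R
  with ((v n * Cmod (u n)) * (Cmod (lin A n) * Cmod (lin B' n)))%R by ring.
replace (v n * Cmod (lin A' n) * Cmod (lin B n) * Cmod (u n))%R
  with ((v n * Cmod (u n)) * (Cmod (lin B n) * Cmod (lin A' n)))%R by ring.
apply Rmult_le_compat_l; trivial.
apply Rmult_le_pos; [left; apply Hv | apply Cmod_ge_0].
Qed.

(** [rise x n] = (1 + x)_n / n!, of order n^x: a power of n with a rational ratio, which
    makes it a comparison sequence for [lin_dominated]. *)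
Fixpoint rise (x : R) (n : nat) : R :=
  match n with
  | O => 1%R
  | S m => (rise x m * (INR m + 1 + x) / (INR m + 1))%R
  end.

Lemma rise_pos x n : (0 <= x)%R -> (0 < rise x n)%R.
Proof.
intros Hx; induction n as [|n IH]; simpl; [lra|].
assert (H := pos_INR n).
apply Rdiv_lt_0_compat; [apply Rmult_lt_0_compat|]; lra.
Qed.

Lemma rise_le x n m : (0 <= x)%R -> (n <= m)%nat -> (rise x n <= rise x m)%R.
Proof.
intros Hx Hn; induction Hn as [|m Hn IH]; [lra|].
eapply Rle_trans; [exact IH|]; simpl.
assert (H := pos_INR m); assert (H' := rise_pos x m Hx).
apply Rmult_le_reg_r with (INR m + 1)%R; [lra|].
replace (rise x m * (INR m + 1 + x) / (INR m + 1) * (INR m + 1))%R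
  with (rise x m * (INR m + 1 + x))%R by (field; lra); nra.
Qed.

Lemma rise_ratio x n :
  rise x (S n) * lin [RtoC 1] n = rise x n * lin [RtoC (1 + x)] n.
Proof.
simpl; assert (H := pos_INR n).
rewrite !Cmult_1_r, <- !RtoC_plus, <- !RtoC_mult; f_equal; field; lra.
Qed.

(** The difference 1 / rise eta n - 1 / rise eta (n + 1): of order n^(-1-eta), and
    summable by telescoping. *)
Definition rise_gap (eta : R) (n : nat) : R := (eta / (rise eta n * (INR n + 1 + eta)))%R.

Lemma rise_gap_pos eta n : (0 < eta)%R -> (0 < rise_gap eta n)%R.
Proof.
intros He; assert (H := pos_INR n); assert (H' := rise_pos eta n ltac:(lra)).
unfold rise_gap; apply Rdiv_lt_0_compat; [lra|]; apply Rmult_lt_0_compat; lra.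
Qed.

Lemma rise_gap_ratio eta n : (0 < eta)%R ->
  rise_gap eta (S n) * lin [RtoC (2 + eta)] n = rise_gap eta n * lin [RtoC 1] n.
Proof.
intros He; unfold rise_gap; simpl rise; simpl lin; assert (H := pos_INR n).
assert (H' := rise_pos eta n ltac:(lra)).
rewrite S_INR, !Cmult_1_r, <- !RtoC_plus, <- !RtoC_mult; f_equal; field.
repeat split; lra.
Qed.

Lemma rise_gap_sum eta n : (0 < eta)%R -> (rsum (rise_gap eta) n <= 1)%R.
Proof.
intros He.
assert (H : (rsum (rise_gap eta) n = 1 - / rise eta n)%R).
{ induction n as [|n IH]; simpl; [field|].
  rewrite IH; unfold rise_gap; assert (H := pos_INR n).
  assert (H' := rise_pos eta n ltac:(lra)); field; repeat split; lra. }
rewrite H; assert (H' := Rinv_0_lt_compat _ (rise_pos eta n ltac:(lra))); lra.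
Qed.

(** By Bernoulli's inequality (1 + x/(n+1))^p >= (n+2)/(n+1) as soon as p x >= 1, so
    the p-th power of [rise x n] is at least n + 1. *)
Lemma rise_unbounded x : (0 < x)%R -> is_lim_seq (rise x) p_infty.
Proof.
intros Hx.
(* an exponent p with p x >= 1 *)
destruct (INR_unbounded (/ x)) as [p Hp].
assert (Hix := Rinv_0_lt_compat _ Hx).
assert (Hpx : (1 <= INR p * x)%R).
{ apply Rmult_le_reg_r with (/ x)%R; trivial.
  replace (INR p * x * / x)%R with (INR p) by (field; lra); lra. }
assert (Hpow : forall n, (INR n + 1 <= rise x n ^ p)%R).
{ induction n as [|n IH]; [simpl; rewrite pow1; lra|].
  simpl rise; rewrite S_INR; assert (H := pos_INR n).
  replace (rise x n * (INR n + 1 + x) / (INR n + 1))%R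
    with (rise x n * (1 + x / (INR n + 1)))%R by (field; lra).
  rewrite Rpow_mult_distr.
  assert (Hq : (0 < x / (INR n + 1))%R) by (apply Rdiv_lt_0_compat; lra).
  assert (Hb := poly p _ Hq).
  apply Rle_trans with ((INR n + 1) * (1 + INR p * (x / (INR n + 1))))%R.
  - replace ((INR n + 1) * (1 + INR p * (x / (INR n + 1))))%R
      with (INR n + 1 + INR p * x)%R by (field; lra); lra.
  - apply Rmult_le_compat; try lra.
    assert (0 <= INR p * (x / (INR n + 1)))%R; [|lra].
    apply Rmult_le_pos; [apply pos_INR | lra]. }
apply is_lim_seq_spec; intros M.
destruct (INR_eventually ((Rmax M 1) ^ p)) as [N HN]; exists N; intros n Hn.
specialize (HN n Hn); specialize (Hpow n).
apply Rnot_le_lt; intros Hle.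
assert (rise x n ^ p <= Rmax M 1 ^ p)%R; [|lra].
apply pow_incr; split; [left; apply rise_pos; lra|].
eapply Rle_trans; [exact Hle | apply Rmax_l].
Qed.

(** Such a sequence has order n^(re_sum A - re_sum B). *)
Lemma lin_vanish (u : nat -> C) (A B : list C) (N : nat) :
  (forall n, (N <= n)%nat -> u (S n) * lin B n = u n * lin A n) ->
  length A = length B -> (re_sum A < re_sum B)%R -> Clim u 0.
Proof.
intros Hu Hl Hs.
(* half of the gap between the two orders, so that 1 / rise x still decays more slowly *)
set (x := ((re_sum B - re_sum A) / 2)%R).
assert (Hx : (0 < x)%R) by (unfold x; lra).
assert (Hr : forall n, (0 < rise x n)%R) by (intros; apply rise_pos; lra).
destruct (lin_dominated u (fun n => / rise x n)%R A B [RtoC 1] [RtoC (1 + x)] N)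
  as [K [HK0 HK]]; trivial.
- intros n; now apply Rinv_0_lt_compat.
- intros n _; assert (H := rise_ratio x n); assert (H0 := Hr n); assert (H1 := Hr (S n)).
  rewrite !RtoC_inv by lra.
  assert (RtoC (rise x n) <> 0) by (intros E; apply RtoC_inj in E; lra).
  assert (RtoC (rise x (S n)) <> 0) by (intros E; apply RtoC_inj in E; lra).
  apply Cmult_reg_l with (rise x n * rise x (S n)); [now apply Cmult_neq_0|].
  transitivity (rise x n * lin [RtoC (1 + x)] n); [field; trivial|].
  rewrite <- H; field; trivial.
- rewrite !length_app, Hl; reflexivity.
- rewrite !re_sum_app; simpl; unfold x; lra.
- apply Clim_squeeze with (fun n => (K * / rise x n)%R).
  + intros n; replace (u n - 0) with (u n) by ring; apply HK.
  + replace (Finite 0) with (Rbar_mult K 0) by (simpl; f_equal; ring).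
    apply is_lim_seq_scal_l.
    replace (Finite 0) with (Rbar_inv p_infty) by reflexivity.
    apply is_lim_seq_inv; [now apply rise_unbounded | discriminate].
Qed.

(** Comparison with [rise_gap], the exponent being below -1. *)
Lemma lin_summable (u : nat -> C) (A B : list C) (N : nat) :
  (forall n, (N <= n)%nat -> u (S n) * lin B n = u n * lin A n) ->
  length A = length B -> (re_sum A < re_sum B - 1)%R ->
  exists K, (0 < K)%R /\ forall n, (rsum (fun i => Cmod (u i)) n <= K)%R.
Proof.
intros Hu Hl Hs.
(* half of the margin by which the order of u lies below -1 *)
set (x := ((re_sum B - 1 - re_sum A) / 2)%R).
assert (Hx : (0 < x)%R) by (unfold x; lra).
destruct (lin_dominated u (rise_gap x) A B [RtoC 1] [RtoC (2 + x)] N)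
  as [K [HK0 HK]]; trivial.
- intros n; now apply rise_gap_pos.
- intros n _; now apply rise_gap_ratio.
- rewrite !length_app, Hl; reflexivity.
- rewrite !re_sum_app; simpl; unfold x; lra.
- exists K; split; trivial; intros n.
  apply Rle_trans with (rsum (fun i => (K * rise_gap x i)%R) n); [apply rsum_le; auto|].
  rewrite rsum_scal; assert (H := rise_gap_sum x n Hx); nra.
Qed.

(** * The product formula for the sine *)

Local Open Scope R_scope.

(** Real and imaginary parts of cos((p + iq) t), and their derivatives.  The moments of
    cos(2wt) against cos(t)^n over [0, pi/2] satisfy a two-step recurrence in n whose
    iteration produces the product formula for cos(pi w). *)
Definition ucos (p q t : R) : R := cos (p * t) * cosh (q * t).
Definition vcos (p q t : R) : R := - (sin (p * t) * sinh (q * t)).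
Definition ucos' (p q t : R) : R :=
  - p * sin (p * t) * cosh (q * t) + q * cos (p * t) * sinh (q * t).
Definition vcos' (p q t : R) : R :=
  - p * cos (p * t) * sinh (q * t) - q * sin (p * t) * cosh (q * t).

Lemma is_derive_ucos p q t : is_derive (ucos p q) t (ucos' p q t).
Proof. unfold ucos, ucos'; auto_derive; trivial; ring. Qed.

Lemma is_derive_vcos p q t : is_derive (vcos p q) t (vcos' p q t).
Proof. unfold vcos, vcos'; auto_derive; trivial; ring. Qed.

Lemma is_derive_ucos' p q t :
  is_derive (ucos' p q) t (- (p ^ 2 - q ^ 2) * ucos p q t + 2 * p * q * vcos p q t).
Proof. unfold ucos, ucos', vcos; auto_derive; trivial; ring. Qed.

Lemma is_derive_vcos' p q t :
  is_derive (vcos' p q) t (- (p ^ 2 - q ^ 2) * vcos p q t - 2 * p * q * ucos p q t).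
Proof. unfold ucos, vcos', vcos; auto_derive; trivial; ring. Qed.

Definition cont (f : R -> R) := forall t, continuous f t.

Lemma derive_cont f f' : (forall t, is_derive f t (f' t)) -> cont f.
Proof.
intros H t; apply (ex_derive_continuous (V := R_NormedModule)); exists (f' t); apply H.
Qed.

Lemma cont_mult f g : cont f -> cont g -> cont (fun t => f t * g t).
Proof. intros Hf Hg t; apply (continuous_mult (K := R_AbsRing)); auto. Qed.

Lemma cont_plus f g : cont f -> cont g -> cont (fun t => f t + g t).
Proof. intros Hf Hg t; apply (continuous_plus (V := R_NormedModule)); auto. Qed.

Lemma cont_scal a f : cont f -> cont (fun t => a * f t).
Proof. intros Hf; apply cont_mult; trivial; intros t; apply continuous_const. Qed.

Lemma cont_cos_pow n : cont (fun t => cos t ^ n).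
Proof.
apply derive_cont with (fun t => INR n * (- sin t) * cos t ^ pred n).
intros t; auto_derive; trivial; ring.
Qed.

Lemma cont_ucos p q : cont (ucos p q).
Proof. eapply derive_cont; apply is_derive_ucos. Qed.

Lemma cont_vcos p q : cont (vcos p q).
Proof. eapply derive_cont; apply is_derive_vcos. Qed.

Definition quarter_int (f : R -> R) : R := RInt f 0 (PI / 2).

Lemma ex_quarter_int f : cont f -> ex_RInt f 0 (PI / 2).
Proof. intros H; apply (ex_RInt_continuous (V := R_CompleteNormedModule)); auto. Qed.

Lemma quarter_int_ext f g : (forall t, f t = g t) -> quarter_int f = quarter_int g.
Proof. intros H; apply RInt_ext; auto. Qed.

Lemma quarter_int_plus f g : cont f -> cont g ->
  quarter_int (fun t => f t + g t) = quarter_int f + quarter_int g.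
Proof.
intros Hf Hg; apply (RInt_plus (V := R_CompleteNormedModule)); now apply ex_quarter_int.
Qed.

Lemma quarter_int_scal a f : cont f -> quarter_int (fun t => a * f t) = a * quarter_int f.
Proof. intros Hf; apply (RInt_scal (V := R_CompleteNormedModule)); now apply ex_quarter_int. Qed.

Lemma quarter_int_derive F f :
  (forall t, is_derive F t (f t)) -> cont f -> quarter_int f = F (PI / 2) - F 0.
Proof.
intros HF Hf; apply is_RInt_unique.
apply (is_RInt_derive (V := R_CompleteNormedModule)); auto.
Qed.

Lemma quarter_int_le_abs f g : cont f -> cont g ->
  (forall t, 0 < t < PI / 2 -> Rabs (f t) <= g t) -> Rabs (quarter_int f) <= quarter_int g.
Proof.
intros Hf Hg H; assert (HP := PI_RGT_0).
assert (Hmf : cont (fun t => -1 * f t)) by now apply cont_scal.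
apply Rabs_le; split.
- assert (H1 : quarter_int (fun t => -1 * f t) <= quarter_int g).
  { apply RInt_le; try (now apply ex_quarter_int); [lra|].
    intros t Ht; specialize (H t Ht); apply Rabs_le_between in H; lra. }
  rewrite quarter_int_scal in H1 by trivial; lra.
- apply RInt_le; try (now apply ex_quarter_int); [lra|].
  intros t Ht; specialize (H t Ht); apply Rabs_le_between in H; lra.
Qed.

Definition ucos_moment (p q : R) (n : nat) : R := quarter_int (fun t => ucos p q t * cos t ^ n).
Definition vcos_moment (p q : R) (n : nat) : R := quarter_int (fun t => vcos p q t * cos t ^ n).
Definition cos_moment (n : nat) : R := quarter_int (fun t => cos t ^ n).

(** Two integrations by parts: the integrand of the difference is the derivative of
    f' cos^(m+2) + (m+2) f cos^(m+1) sin, which vanishes at both ends.  The pair (f, g) is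
    the real and imaginary part of cos((p + iq) t), in either order. *)
Lemma cos_moment_reduction (f f' g : R -> R) (A B : R) (m : nat) :
  (forall t, is_derive f t (f' t)) ->
  (forall t, is_derive f' t (- A * f t + B * g t)) ->
  cont g -> f' 0 = 0 ->
  (INR (S (S m)) ^ 2 - A) * quarter_int (fun t => f t * cos t ^ S (S m))
    + B * quarter_int (fun t => g t * cos t ^ S (S m))
  = INR (S (S m)) * INR (S m) * quarter_int (fun t => f t * cos t ^ m).
Proof.
intros Hf Hf' Hg H0.
assert (Cf : cont f) by (eapply derive_cont; eauto).
set (n := INR (S (S m))).
(* the difference of the two sides, as one integrand *)
set (h := fun t => (n ^ 2 - A) * (f t * cos t ^ S (S m))
   + (B * (g t * cos t ^ S (S m)) + (- (n * INR (S m))) * (f t * cos t ^ m))).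
assert (C1 : cont (fun t => f t * cos t ^ S (S m)))
  by (apply cont_mult; trivial; apply cont_cos_pow).
assert (C2 : cont (fun t => g t * cos t ^ S (S m)))
  by (apply cont_mult; trivial; apply cont_cos_pow).
assert (C3 : cont (fun t => f t * cos t ^ m))
  by (apply cont_mult; trivial; apply cont_cos_pow).
assert (Ch : cont h).
{ unfold h; repeat apply cont_plus; now apply cont_scal. }
assert (HI : quarter_int h = 0).
{ rewrite quarter_int_derive with
    (F := fun t => f' t * cos t ^ S (S m) + n * (f t * cos t ^ S m * sin t)); trivial.
  - rewrite cos_PI2, H0, sin_0; simpl; ring.
  - intros t; unfold h.
    auto_derive.
    + repeat split; eexists; [apply Hf' | apply Hf].
    + replace (Derive (fun x => f' x) t) with (- A * f t + B * g t)
        by (symmetry; apply is_derive_unique, Hf').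
      replace (Derive (fun x => f x) t) with (f' t)
        by (symmetry; apply is_derive_unique, Hf).
      unfold n; rewrite !S_INR; simpl pred; simpl pow.
      assert (E : sin t * sin t = 1 - cos t * cos t)
        by (assert (X := sin2_cos2 t); unfold Rsqr in X; lra).
      set (s := sin t) in *; set (c := cos t) in *; set (x := c ^ m).
      change (match m with O => 1 | S _ => INR m + 1 end) with (INR (S m)).
      rewrite S_INR; set (k := INR m).
      assert (G : forall a b, a - b = 0 -> a = b) by (intros; lra); apply G.
      match goal with |- ?X = 0 =>
        replace X with ((s * s - (1 - c * c)) * (- (k + 2) * (k + 1) * f t * x)) by ring
      end.
      rewrite E; ring. }
unfold h in HI.
rewrite !quarter_int_plus, !quarter_int_scal in HI; trivial; try (now apply cont_scal);
  try (now apply cont_plus; apply cont_scal).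
lra.
Qed.

Lemma ucos0 p q : ucos p q 0 = 1.
Proof. unfold ucos; rewrite !Rmult_0_r, cos_0, cosh_0; ring. Qed.

Lemma vcos0 p q : vcos p q 0 = 0.
Proof. unfold vcos; rewrite !Rmult_0_r, sin_0; ring. Qed.

Lemma sinh0 : sinh 0 = 0.
Proof. unfold sinh; rewrite Ropp_0; field. Qed.

Lemma ucos'0 p q : ucos' p q 0 = 0.
Proof. unfold ucos'; rewrite !Rmult_0_r, sin_0, sinh0; ring. Qed.

Lemma vcos'0 p q : vcos' p q 0 = 0.
Proof. unfold vcos'; rewrite !Rmult_0_r, sin_0, sinh0; ring. Qed.

Lemma ucos_moment_rec p q m :
  (INR (S (S m)) ^ 2 - (p ^ 2 - q ^ 2)) * ucos_moment p q (S (S m))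
    + 2 * p * q * vcos_moment p q (S (S m)) = INR (S (S m)) * INR (S m) * ucos_moment p q m.
Proof.
apply cos_moment_reduction with (ucos' p q).
- apply is_derive_ucos.
- apply is_derive_ucos'.
- apply cont_vcos.
- apply ucos'0.
Qed.

Lemma vcos_moment_rec p q m :
  (INR (S (S m)) ^ 2 - (p ^ 2 - q ^ 2)) * vcos_moment p q (S (S m))
    + - (2 * p * q) * ucos_moment p q (S (S m)) = INR (S (S m)) * INR (S m) * vcos_moment p q m.
Proof.
apply cos_moment_reduction with (vcos' p q).
- apply is_derive_vcos.
- intros t; replace (- (p ^ 2 - q ^ 2) * vcos p q t + - (2 * p * q) * ucos p q t)
    with (- (p ^ 2 - q ^ 2) * vcos p q t - 2 * p * q * ucos p q t) by ring.
  apply is_derive_vcos'.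
- apply cont_ucos.
- apply vcos'0.
Qed.

(** cos(2wt) is 1 for w = 0, so the plain moments satisfy a special case of the recurrence. *)
Lemma cos_moment_ucos n : cos_moment n = ucos_moment 0 0 n.
Proof.
apply quarter_int_ext; intros t; unfold ucos; rewrite !Rmult_0_l, cos_0, cosh_0; ring.
Qed.

Lemma cos_moment_rec m : INR (S (S m)) * cos_moment (S (S m)) = INR (S m) * cos_moment m.
Proof.
assert (H := ucos_moment_rec 0 0 m); rewrite <- !cos_moment_ucos in H.
assert (H0 := pos_INR (S m)); assert (H1 := S_INR (S m)).
apply Rmult_eq_reg_l with (INR (S (S m))); lra.
Qed.

Lemma cos_moment_1 : cos_moment 1 = 1.
Proof.
unfold cos_moment; rewrite quarter_int_derive with (F := sin).
- rewrite sin_PI2, sin_0; ring.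
- intros t; auto_derive; trivial; simpl; ring.
- apply cont_cos_pow.
Qed.

Lemma cos_moment_pos j : 0 < cos_moment (2 * j + 1).
Proof.
induction j as [|j IH]; [simpl; rewrite cos_moment_1; lra|].
replace (2 * S j + 1)%nat with (S (S (2 * j + 1))) by lia.
assert (H := cos_moment_rec (2 * j + 1)).
assert (H0 := pos_INR (2 * j + 1)).
assert (H1 := S_INR (2 * j + 1)); assert (H2 := S_INR (S (2 * j + 1))).
apply Rmult_lt_reg_l with (INR (S (S (2 * j + 1)))); [lra|].
rewrite H, Rmult_0_r; apply Rmult_lt_0_compat; lra.
Qed.

Lemma ucos_moment_1 p q :
  (1 - (p ^ 2 - q ^ 2)) * ucos_moment p q 1 + 2 * p * q * vcos_moment p q 1 = ucos p q (PI / 2).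
Proof.
unfold ucos_moment, vcos_moment.
assert (C1 : cont (fun t => ucos p q t * cos t ^ 1))
  by (apply cont_mult; [apply cont_ucos | apply cont_cos_pow]).
assert (C2 : cont (fun t => vcos p q t * cos t ^ 1))
  by (apply cont_mult; [apply cont_vcos | apply cont_cos_pow]).
rewrite <- !quarter_int_scal, <- quarter_int_plus; trivial; try now apply cont_scal.
rewrite quarter_int_derive with (F := fun t => ucos' p q t * cos t + ucos p q t * sin t).
- rewrite cos_PI2, sin_PI2, ucos'0, sin_0; ring.
- intros t; unfold ucos, ucos', vcos; auto_derive; trivial; ring.
- apply cont_plus; now apply cont_scal.
Qed.

Lemma vcos_moment_1 p q :
  (1 - (p ^ 2 - q ^ 2)) * vcos_moment p q 1 + - (2 * p * q) * ucos_moment p q 1 = vcos p q (PI / 2).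
Proof.
unfold ucos_moment, vcos_moment.
assert (C1 : cont (fun t => ucos p q t * cos t ^ 1))
  by (apply cont_mult; [apply cont_ucos | apply cont_cos_pow]).
assert (C2 : cont (fun t => vcos p q t * cos t ^ 1))
  by (apply cont_mult; [apply cont_vcos | apply cont_cos_pow]).
rewrite <- !quarter_int_scal, <- quarter_int_plus; trivial; try now apply cont_scal.
rewrite quarter_int_derive with (F := fun t => vcos' p q t * cos t + vcos p q t * sin t).
- rewrite cos_PI2, sin_PI2, vcos'0, sin_0; ring.
- intros t; unfold ucos, vcos', vcos; auto_derive; trivial; ring.
- apply cont_plus; now apply cont_scal.
Qed.

(** The mean value theorem, twice. *)
Lemma quadratic_bound f f' f'' K :
  (forall t, is_derive f t (f' t)) -> (forall t, is_derive f' t (f'' t)) ->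
  f 0 = 0 -> f' 0 = 0 -> (forall t, 0 <= t <= PI / 2 -> Rabs (f'' t) <= K) ->
  forall t, 0 <= t <= PI / 2 -> Rabs (f t) <= K * t ^ 2.
Proof.
intros H1 H2 E0 E1 HK.
assert (D : forall g g', (forall t, is_derive g t (g' t)) -> forall t, 0 <= t ->
   exists c, 0 <= c <= t /\ g t - g 0 = g' c * t).
{ intros g g' Hg t Ht.
  destruct (MVT_gen g 0 t g') as [c [Hc Hc']].
  - intros; apply Hg.
  - intros x _; apply continuity_pt_filterlim, (derive_cont g g' Hg).
  - rewrite Rmin_left, Rmax_right in Hc by lra; exists c; split; trivial.
    rewrite Hc'; ring. }
assert (B1 : forall t, 0 <= t <= PI / 2 -> Rabs (f' t) <= K * t).
{ intros t Ht; destruct (D f' f'' H2 t (proj1 Ht)) as [c [Hc Hc']].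
  rewrite E1, Rminus_0_r in Hc'; rewrite Hc', Rabs_mult, (Rabs_pos_eq t) by lra.
  apply Rmult_le_compat_r; [lra|]; apply HK; lra. }
intros t Ht; destruct (D f f' H1 t (proj1 Ht)) as [c [Hc Hc']].
rewrite E0, Rminus_0_r in Hc'; rewrite Hc', Rabs_mult, (Rabs_pos_eq t) by lra.
replace (K * t ^ 2) with (K * t * t) by ring.
apply Rmult_le_compat_r; [lra|].
specialize (B1 c ltac:(lra)).
assert (0 <= K) by (eapply Rle_trans; [apply Rabs_pos | apply (HK 0); lra]).
nra.
Qed.

(** That is t <= tan t: the derivative of sin t - t cos t is t sin t. *)
Lemma t_cos_le_sin t : 0 <= t <= PI / 2 -> t * cos t <= sin t.
Proof.
intros Ht; assert (HP := PI_RGT_0).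
destruct (MVT_gen (fun t => sin t - t * cos t) 0 t (fun t => t * sin t)) as [c [Hc Hc']].
- intros x _; auto_derive; trivial; ring.
- intros x _; apply continuity_pt_filterlim.
  apply (derive_cont (fun t => sin t - t * cos t) (fun t => t * sin t)).
  intros y; auto_derive; trivial; ring.
- rewrite Rmin_left, Rmax_right in Hc by lra.
  rewrite sin_0 in Hc'.
  assert (0 <= sin c) by (apply sin_ge_0; lra).
  assert (0 <= c * sin c) by (apply Rmult_le_pos; lra).
  assert (0 <= c * sin c * t) by (apply Rmult_le_pos; lra).
  lra.
Qed.

Lemma cosh_bound q t : 0 <= t <= PI / 2 ->
  Rabs (cosh (q * t)) <= exp (2 * Rabs q) /\ Rabs (sinh (q * t)) <= exp (2 * Rabs q).
Proof.
intros Ht; assert (HP := PI_4).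
assert (H : forall x, Rabs x <= 2 * Rabs q -> 0 < exp x <= exp (2 * Rabs q)).
{ intros x Hx; split; [apply exp_pos|].
  destruct (Rle_lt_or_eq_dec x (2 * Rabs q)) as [L| ->]; [|left; now apply exp_increasing|lra].
  apply Rabs_le_between in Hx; lra. }
assert (Hq : Rabs (q * t) <= 2 * Rabs q).
{ rewrite Rabs_mult, (Rabs_pos_eq t) by lra.
  assert (X := Rabs_pos q); nra. }
assert (A := H _ Hq); assert (B := H (- (q * t)) ltac:(now rewrite Rabs_Ropp)).
unfold cosh, sinh; split; apply Rabs_le; lra.
Qed.

Lemma ucos_vcos_bound p q t : 0 <= t <= PI / 2 ->
  Rabs (ucos p q t) <= exp (2 * Rabs q) /\ Rabs (vcos p q t) <= exp (2 * Rabs q).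
Proof.
intros Ht; destruct (cosh_bound q t Ht) as [A B].
unfold ucos, vcos; rewrite Rabs_Ropp, !Rabs_mult.
assert (Rabs (cos (p * t)) <= 1) by (apply Rabs_le, COS_bound).
assert (Rabs (sin (p * t)) <= 1) by (apply Rabs_le, SIN_bound).
assert (X := Rabs_pos (cos (p * t))); assert (Y := Rabs_pos (sin (p * t))).
assert (X' := Rabs_pos (cosh (q * t))); assert (Y' := Rabs_pos (sinh (q * t))).
split; nra.
Qed.

(** Bound on [0, pi/2] for the second derivatives of [ucos] and [vcos]. *)
Definition curvature (p q : R) : R :=
  (Rabs (p ^ 2 - q ^ 2) + Rabs (2 * p * q)) * exp (2 * Rabs q).

Lemma comb_bound a b x y E :
  Rabs x <= E -> Rabs y <= E -> Rabs (a * x + b * y) <= (Rabs a + Rabs b) * E.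
Proof.
intros Hx Hy; eapply Rle_trans; [apply Rabs_triang|]; rewrite !Rabs_mult.
assert (A := Rabs_pos a); assert (B := Rabs_pos b); nra.
Qed.

Lemma ucos_near p q t : 0 <= t <= PI / 2 -> Rabs (ucos p q t - 1) <= curvature p q * t ^ 2.
Proof.
apply quadratic_bound with (f := fun t => ucos p q t - 1) (f' := ucos' p q)
  (f'' := fun t => - (p ^ 2 - q ^ 2) * ucos p q t + 2 * p * q * vcos p q t).
- intros x; unfold ucos, ucos'; auto_derive; trivial; ring.
- apply is_derive_ucos'.
- cbv beta; rewrite ucos0; apply Rminus_diag_eq; reflexivity.
- apply ucos'0.
- intros x Hx; destruct (ucos_vcos_bound p q x Hx).
  unfold curvature; rewrite <- (Rabs_Ropp (p ^ 2 - q ^ 2)); now apply comb_bound.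
Qed.

Lemma vcos_near p q t : 0 <= t <= PI / 2 -> Rabs (vcos p q t) <= curvature p q * t ^ 2.
Proof.
apply quadratic_bound with (f' := vcos' p q)
  (f'' := fun t => - (p ^ 2 - q ^ 2) * vcos p q t - 2 * p * q * ucos p q t).
- apply is_derive_vcos.
- apply is_derive_vcos'.
- apply vcos0.
- apply vcos'0.
- intros x Hx; destruct (ucos_vcos_bound p q x Hx).
  unfold curvature; rewrite <- (Rabs_Ropp (p ^ 2 - q ^ 2)), <- (Rabs_Ropp (2 * p * q)).
  replace (- (p ^ 2 - q ^ 2) * vcos p q x - 2 * p * q * ucos p q x)
    with (- (p ^ 2 - q ^ 2) * vcos p q x + - (2 * p * q) * ucos p q x) by ring.
  now apply comb_bound.
Qed.

Lemma curvature_pos p q : 0 <= curvature p q.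
Proof.
unfold curvature; apply Rmult_le_pos; [|left; apply exp_pos].
apply Rplus_le_le_0_compat; apply Rabs_pos.
Qed.

(** The weight cos^n concentrates at 0 as n grows: t^2 cos(t)^(m+2) <= sin(t)^2 cos(t)^m
    has integral the difference of two consecutive even-step moments, which by
    [cos_moment_rec] is the moment itself divided by m + 1. *)
Lemma cos_moment_concentrates f K m : cont f -> 0 <= K ->
  (forall t, 0 <= t <= PI / 2 -> Rabs (f t) <= K * t ^ 2) ->
  Rabs (quarter_int (fun t => f t * cos t ^ S (S m))) <= K * / INR (S m) * cos_moment (S (S m)).
Proof.
intros Hf HK H.
assert (H0 := pos_INR m); assert (H1 := S_INR m); assert (H2 := S_INR (S m)).
assert (C : cont (fun t => K * (cos t ^ m + -1 * cos t ^ S (S m)))).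
{ apply cont_scal, cont_plus; [|apply cont_scal]; apply cont_cos_pow. }
apply Rle_trans with (quarter_int (fun t => K * (cos t ^ m + -1 * cos t ^ S (S m)))).
- apply quarter_int_le_abs; trivial.
  + apply cont_mult; trivial; apply cont_cos_pow.
  + intros t Ht; specialize (H t ltac:(lra)).
    assert (Hc : 0 <= cos t) by (apply cos_ge_0; lra).
    assert (Hs := t_cos_le_sin t ltac:(lra)).
    assert (E : 1 - cos t * cos t = sin t * sin t)
      by (assert (X := sin2_cos2 t); unfold Rsqr in X; lra).
    assert (Hm : 0 <= cos t ^ m) by (now apply pow_le).
    rewrite Rabs_mult, (Rabs_pos_eq (cos t ^ _)) by (now apply pow_le).
    replace (cos t ^ m + -1 * cos t ^ S (S m)) with ((1 - cos t * cos t) * cos t ^ m)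
      by (simpl; ring).
    rewrite E.
    apply Rle_trans with (K * t ^ 2 * cos t ^ S (S m)).
    { apply Rmult_le_compat_r; trivial; now apply pow_le. }
    replace (K * t ^ 2 * cos t ^ S (S m)) with (K * ((t * cos t) * (t * cos t) * cos t ^ m))
      by (simpl; ring).
    apply Rmult_le_compat_l; trivial; apply Rmult_le_compat_r; trivial.
    assert (0 <= t * cos t) by (apply Rmult_le_pos; lra).
    apply Rmult_le_compat; lra.
- rewrite quarter_int_scal, quarter_int_plus, quarter_int_scal;
    try apply cont_scal; try apply cont_cos_pow.
  2: { apply cont_plus; [|apply cont_scal]; apply cont_cos_pow. }
  change (K * (cos_moment m + -1 * cos_moment (S (S m))) <= K * / INR (S m) * cos_moment (S (S m))).
  assert (E := cos_moment_rec m).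
  replace (cos_moment m) with (INR (S (S m)) * cos_moment (S (S m)) / INR (S m))
    by (rewrite E; field; lra).
  right; rewrite H2; field; lra.
Qed.

Local Open Scope C_scope.

Definition ccos_moment (w : C) (n : nat) : C :=
  (ucos_moment (2 * Re w) (2 * Im w) n, vcos_moment (2 * Re w) (2 * Im w) n).

Lemma ccos_moment_rec w m :
  (INR (S (S m)) * INR (S (S m)) - 4 * w * w) * ccos_moment w (S (S m))
  = INR (S (S m)) * INR (S m) * ccos_moment w m.
Proof.
assert (H1 := ucos_moment_rec (2 * Re w) (2 * Im w) m).
assert (H2 := vcos_moment_rec (2 * Re w) (2 * Im w) m).
unfold ccos_moment; set (J := ucos_moment _ _ (S (S m))) in *;
set (L := vcos_moment _ _ (S (S m))) in *.
set (J0 := ucos_moment _ _ m) in *; set (L0 := vcos_moment _ _ m) in *.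
set (n := INR (S (S m))) in *; set (n' := INR (S m)) in *.
clearbody J L J0 L0 n n'; destruct w as [x y]; simpl Re in *; simpl Im in *.
apply injective_projections; simpl; nra.
Qed.

Lemma Ccos_re_im w : Ccos (PI * w) =
  (ucos (2 * Re w) (2 * Im w) (PI / 2), vcos (2 * Re w) (2 * Im w) (PI / 2)).
Proof.
destruct w as [x y]; unfold Ccos, Cexp, ucos, vcos, cosh, sinh; simpl Re; simpl Im.
replace (2 * x * (PI / 2))%R with (PI * x)%R by field.
replace (2 * y * (PI / 2))%R with (PI * y)%R by field.
apply injective_projections; simpl;
replace (- (0 * (PI * x - 0 * y) - 1 * (PI * y + 0 * x)))%R with (PI * y)%R by ring;
replace (0 * (PI * x - 0 * y) - 1 * (PI * y + 0 * x))%R with (- (PI * y))%R by ring;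
replace (0 * (PI * y + 0 * x) + 1 * (PI * x - 0 * y))%R with (PI * x)%R by ring;
rewrite ?cos_neg, ?sin_neg; field.
Qed.

Lemma ccos_moment_1 w : (1 - 4 * w * w) * ccos_moment w 1 = Ccos (PI * w).
Proof.
rewrite Ccos_re_im.
rewrite <- (ucos_moment_1 (2 * Re w) (2 * Im w)), <- (vcos_moment_1 (2 * Re w) (2 * Im w)).
unfold ccos_moment; set (J := ucos_moment _ _ 1); set (L := vcos_moment _ _ 1); clearbody J L.
destruct w as [x y]; simpl Re; simpl Im.
apply injective_projections; simpl; ring.
Qed.

(** Normalised so that it tends to 1, by [cos_moment_concentrates]; the odd moments are the
    ones whose recurrence starts from cos(pi w). *)
Definition moment_ratio (w : C) (j : nat) : C := ccos_moment w (2 * j + 1) / cos_moment (2 * j + 1).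

Lemma moment_ratio_rec w j :
  ((INR j + 3 / 2) * (INR j + 3 / 2) - w * w) * moment_ratio w (S j)
  = (INR j + 3 / 2) * (INR j + 3 / 2) * moment_ratio w j.
Proof.
unfold moment_ratio.
assert (P0 := cos_moment_pos j); assert (P1 := cos_moment_pos (S j)).
assert (Z := cos_moment_rec (2 * j + 1)); assert (R := ccos_moment_rec w (2 * j + 1)).
replace (2 * S j + 1)%nat with (S (S (2 * j + 1))) in * by lia.
apply (f_equal RtoC) in Z; rewrite !RtoC_mult in Z.
assert (P0' : RtoC (cos_moment (2 * j + 1)) <> 0) by (intros E; apply RtoC_inj in E; lra).
assert (P1' : RtoC (cos_moment (S (S (2 * j + 1)))) <> 0) by (intros E; apply RtoC_inj in E; lra).
assert (En : RtoC (INR (S (S (2 * j + 1)))) = 2 * (INR j + 3 / 2)).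
{ rewrite !RtoC_INR_S, plus_INR, mult_INR, RtoC_plus, RtoC_mult.
  change (INR 2) with 2%R; change (INR 1) with 1%R; field. }
assert (Hj := pos_INR j).
assert (N0 : INR j + 3 / 2 <> 0).
{ rewrite <- RtoC_div by lra; rewrite <- RtoC_plus; intros E; apply RtoC_inj in E; lra. }
assert (H2 : RtoC 2 <> 0) by (intros E; apply RtoC_inj in E; lra).
assert (H4 : RtoC 4 <> 0) by (intros E; apply RtoC_inj in E; lra).
rewrite En in *.
set (I1 := ccos_moment w (S (S (2 * j + 1)))) in *; set (I0 := ccos_moment w (2 * j + 1)) in *.
set (Z1 := RtoC (cos_moment (S (S (2 * j + 1))))) in *;
set (Z0 := RtoC (cos_moment (2 * j + 1))) in *.
set (n' := RtoC (INR (S (2 * j + 1)))) in *; set (k := INR j + 3 / 2) in *.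
clearbody I1 I0 Z1 Z0 n' k.
apply Cmult_reg_l with (4 * Z1); [now apply Cmult_neq_0|].
transitivity ((2 * k * (2 * k) - 4 * w * w) * I1); [field; trivial|].
rewrite R.
transitivity (4 * k * k * Z1 * I0 / Z0); [|field; trivial].
transitivity (2 * k * (n' * Z0) * I0 / Z0); [field; trivial|].
rewrite <- Z; field; trivial.
Qed.

Lemma moment_ratio_cvg w : Clim (moment_ratio w) 1.
Proof.
set (p := (2 * Re w)%R); set (q := (2 * Im w)%R).
apply Clim_S.
apply Clim_squeeze with (fun j => (2 * curvature p q * / (INR j + 1))%R).
- intros j; unfold moment_ratio.
  assert (P := cos_moment_pos (S j)).
  replace (2 * S j + 1)%nat with (S (S (2 * j + 1))) in * by lia.
  set (m := (2 * j + 1)%nat) in *.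
  assert (A := cos_moment_concentrates (fun t => (ucos p q t + -1 * cos t ^ 0)%R) (curvature p q) m).
  assert (B := cos_moment_concentrates (vcos p q) (curvature p q) m).
  specialize (B (cont_vcos p q) (curvature_pos p q) (vcos_near p q)).
  assert (E : quarter_int (fun t => ((ucos p q t + -1 * cos t ^ 0) * cos t ^ S (S m))%R)
    = (ucos_moment p q (S (S m)) - cos_moment (S (S m)))%R).
  { unfold ucos_moment, cos_moment.
    rewrite quarter_int_ext with (g := fun t =>
      (ucos p q t * cos t ^ S (S m) + -1 * cos t ^ S (S m))%R) by (intros; simpl; ring).
    rewrite quarter_int_plus, quarter_int_scal; try ring; try apply cont_cos_pow.
    - apply cont_mult; [apply cont_ucos | apply cont_cos_pow].
    - apply cont_scal, cont_cos_pow. }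
  cbv beta in A; rewrite E in A; clear E.
  assert (A' : (Rabs (ucos_moment p q (S (S m)) - cos_moment (S (S m)))
    <= curvature p q * / INR (S m) * cos_moment (S (S m)))%R).
  { apply A; [|apply curvature_pos|].
    - apply cont_plus; [apply cont_ucos | apply cont_scal, cont_cos_pow].
    - intros t Ht; simpl; replace (ucos p q t + -1 * 1)%R with (ucos p q t - 1)%R by ring.
      now apply ucos_near. }
  clear A; fold (vcos_moment p q (S (S m))) in B.
  assert (Z0 : RtoC (cos_moment (S (S m))) <> 0) by (intros E; apply RtoC_inj in E; lra).
  replace (ccos_moment w (S (S m)) / cos_moment (S (S m)) - 1)
    with ((RtoC (ucos_moment p q (S (S m)) - cos_moment (S (S m)))%R
       + Ci * vcos_moment p q (S (S m)))
       / cos_moment (S (S m))).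
  2: { unfold ccos_moment; fold p q; rewrite RtoC_minus.
       replace ((ucos_moment p q (S (S m)), vcos_moment p q (S (S m))) : C)
         with (ucos_moment p q (S (S m)) + Ci * vcos_moment p q (S (S m)))
         by (apply injective_projections; simpl; ring).
       field; trivial. }
  rewrite Cmod_div, (Cmod_R (cos_moment _)), (Rabs_pos_eq (cos_moment _)) by (trivial; lra).
  apply Rmult_le_reg_r with (cos_moment (S (S m))); trivial.
  unfold Rdiv; rewrite Rmult_assoc, Rinv_l, Rmult_1_r by lra.
  eapply Rle_trans; [apply Cmod_triangle|].
  rewrite Cmod_mult, Cmod_Ci, !Cmod_R.
  assert (K0 := curvature_pos p q).
  assert (Hj := pos_INR j).
  assert (Hi : (/ INR (S m) <= / (INR j + 1))%R).
  { apply Rinv_le_contravar; [lra|]; unfold m; rewrite S_INR, plus_INR, mult_INR; simpl; lra. }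
  assert (curvature p q * / INR (S m) * cos_moment (S (S m))
    <= curvature p q * / (INR j + 1) * cos_moment (S (S m)))%R.
  { apply Rmult_le_compat_r; [lra|]; now apply Rmult_le_compat_l. }
  lra.
- replace (Finite 0) with (Rbar_mult (2 * curvature p q)%R 0) by (simpl; f_equal; ring).
  apply is_lim_seq_scal_l, is_lim_seq_inv_shift.
Qed.

Lemma half_int_neq0 n : INR n + 1 / 2 <> 0.
Proof.
assert (H := pos_INR n).
rewrite <- RtoC_div by lra; rewrite <- RtoC_plus; intros E; apply RtoC_inj in E; lra.
Qed.

Lemma poch_half_neq0 n : poch (1 / 2) n <> 0.
Proof.
induction n as [|n IH]; simpl; [apply C1_nz|].
apply Cmult_neq_0; trivial; rewrite Cplus_comm; apply half_int_neq0.
Qed.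

Lemma Ccos_minus_half z : Ccos (PI * (z - 1 / 2)) = Csin (PI * z).
Proof.
destruct z as [x y]; unfold Ccos, Csin, Cexp.
set (X := (PI * x)%R); set (Y := (PI * y)%R).
replace (Ci * (PI * ((x, y) - 1 / 2))) with ((- Y)%R, (X - PI / 2)%R)
  by (unfold X, Y; apply injective_projections; simpl; field).
replace (- (((- Y)%R, (X - PI / 2)%R) : C)) with ((Y, (PI / 2 - X)%R) : C)
  by (apply injective_projections; simpl; ring).
replace (Ci * (PI * (x, y))) with (((- Y)%R, X) : C)
  by (unfold X, Y; apply injective_projections; simpl; ring).
replace (- (((- Y)%R, X) : C)) with ((Y, (- X)%R) : C)
  by (apply injective_projections; simpl; ring).
simpl Re; simpl Im.
replace (X - PI / 2)%R with (- (PI / 2 - X))%R by ring.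
rewrite !cos_neg, !sin_neg, cos_shift, sin_shift.
apply injective_projections; simpl; field.
Qed.

(** Iterating [moment_ratio_rec] at w = z - 1/2, for which
    (j + 1/2)^2 - w^2 = (j + z)(j + 1 - z) and cos(pi w) = sin(pi z). *)
Lemma sin_product_exact z n :
  poch z (S n) * poch (1 - z) (S n) * moment_ratio (z - 1 / 2) n
  = Csin (PI * z) * (poch (1 / 2) (S n) * poch (1 / 2) (S n)).
Proof.
assert (H2 : RtoC 2 <> 0) by (intros E; apply RtoC_inj in E; lra).
induction n as [|n IH].
- simpl; rewrite <- Ccos_minus_half, <- ccos_moment_1; unfold moment_ratio.
  change (2 * 0 + 1)%nat with 1%nat; rewrite cos_moment_1; field; trivial.
- assert (R := moment_ratio_rec (z - 1 / 2) n).
  assert (H3 : INR n + 3 / 2 <> 0).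
  { assert (X := half_int_neq0 (S n)); rewrite RtoC_INR_S in X.
    replace (INR n + 3 / 2) with (INR n + 1 + 1 / 2) by (field; trivial); trivial. }
  change (poch ?a (S (S n))) with (poch a (S n) * (a + INR (S n))).
  rewrite RtoC_INR_S.
  transitivity (poch z (S n) * poch (1 - z) (S n) *
    (((INR n + 3 / 2) * (INR n + 3 / 2) - (z - 1 / 2) * (z - 1 / 2)) * moment_ratio (z - 1 / 2) (S n)));
    [field; trivial|].
  rewrite R.
  transitivity ((INR n + 3 / 2) * (INR n + 3 / 2) *
    (poch z (S n) * poch (1 - z) (S n) * moment_ratio (z - 1 / 2) n)); [ring|].
  rewrite IH; field; trivial.
Qed.

(** Euler's product, written with shifted factorials: the form in which it meets
    [gauss_sum]. *)
Lemma sin_product z :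
  Clim (fun n => poch z n * poch (1 - z) n / (poch (1 / 2) n * poch (1 / 2) n))
    (Csin (PI * z)).
Proof.
apply Clim_S.
assert (H := moment_ratio_cvg (z - 1 / 2)).
destruct (proj1 (Clim_eps _ _) H (1 / 2)%R ltac:(lra)) as [N HN].
apply Clim_inv in H; [|apply C1_nz].
apply (Clim_scal (Csin (PI * z))) in H.
apply Clim_eq with (Csin (PI * z) * / 1); [|field; apply C1_nz].
apply Clim_ext_loc with (2 := H) (N := N).
intros n Hn; specialize (HN n Hn).
assert (Hr : moment_ratio (z - 1 / 2) n <> 0).
{ intros E; rewrite E in HN; replace (0 - 1) with (- (1)) in HN by ring.
  rewrite Cmod_m1 in HN; lra. }
assert (E := sin_product_exact z n).
assert (P := poch_half_neq0 (S n)).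
set (P2 := poch (1 / 2) (S n)) in *; set (X := poch z (S n)) in *.
set (Y := poch (1 - z) (S n)) in *; set (r := moment_ratio (z - 1 / 2) n) in *.
clearbody P2 X Y r.
transitivity (Csin (PI * z) * (P2 * P2) / (r * (P2 * P2))); [field; auto|].
rewrite <- E; field; auto.
Qed.

(** * Gauss's summation of 2F1 at 1 *)

Lemma RtoC_neq (x y : R) : x <> y -> RtoC x <> RtoC y.
Proof. intros H E; apply RtoC_inj in E; auto. Qed.

Lemma INR_S_neq0 n : RtoC (INR (S n)) <> 0.
Proof. apply RtoC_neq, not_0_INR; lia. Qed.

Lemma INR_1_neq0 n : INR n + 1 <> 0.
Proof. rewrite <- RtoC_INR_S; apply INR_S_neq0. Qed.

Lemma cfact_S n : cfact (S n) = (INR n + 1) * cfact n.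
Proof.
unfold cfact; rewrite fact_simpl, mult_INR, RtoC_mult, RtoC_INR_S; ring.
Qed.

Lemma cfact_neq0 n : cfact n <> 0.
Proof. apply RtoC_neq, not_0_INR, fact_neq_0. Qed.

Lemma poch_neq0 a n : (forall k, (k < n)%nat -> a + INR k <> 0) -> poch a n <> 0.
Proof.
induction n as [|n IH]; simpl; intros H; [apply C1_nz|].
apply Cmult_neq_0; auto with arith.
Qed.

Lemma poch_shift a n : poch a (S n) = a * poch (a + 1) n.
Proof.
induction n as [|n IH]; [simpl; ring|].
change (poch a (S (S n))) with (poch a (S n) * (a + INR (S n))).
rewrite IH, RtoC_INR_S; simpl; ring.
Qed.

(** The terms of 2F1(al, be; ga; 1). *)
Definition gauss_term (al be ga : C) (m : nat) : C :=
  poch al m * poch be m / (poch ga m * cfact m).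

Lemma gauss_term_rec al be ga m : (forall k, ga + INR k <> 0) ->
  gauss_term al be ga (S m) * (ga + INR m) * (INR m + 1)
  = gauss_term al be ga m * (al + INR m) * (be + INR m).
Proof.
intros Hg; unfold gauss_term; rewrite cfact_S; simpl poch.
assert (X := INR_1_neq0 m); assert (Y := cfact_neq0 m); assert (Z := Hg m).
assert (T := poch_neq0 ga m ltac:(auto)).
field; auto.
Qed.

Lemma gauss_summable al be ga : (forall k, ga + INR k <> 0) ->
  (Re al + Re be < Re ga)%R ->
  exists K, (0 < K)%R /\
    forall n, (rsum (fun i => Cmod (gauss_term al be ga i)) n <= K)%R.
Proof.
intros Hg Hr.
apply lin_summable with (A := [al; be]) (B := [ga; RtoC 1]) (N := O).
- intros n _; assert (H := gauss_term_rec al be ga n Hg); simpl.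
  transitivity (gauss_term al be ga (S n) * (ga + INR n) * (INR n + 1)); [ring|].
  rewrite H; ring.
- reflexivity.
- simpl; lra.
Qed.

(** The combination of the m-th terms for ga and ga + 1 is the difference at m of
    -ga m times the m-th term for ga. *)
Lemma gauss_contiguous_partial al be ga M : (forall k, ga + INR k <> 0) ->
  ga * (ga - al - be) * csum (gauss_term al be ga) M
  - (ga - al) * (ga - be) * csum (gauss_term al be (ga + 1)) M
  = - ga * (INR M * gauss_term al be ga M).
Proof.
intros Hg.
transitivity (csum (fun m => ga * (ga - al - be) * gauss_term al be ga m
  + (- ((ga - al) * (ga - be))) * gauss_term al be (ga + 1) m) M).
{ rewrite csum_plus, !csum_scal; ring. }
rewrite csum_telescope with (G := fun m => - ga * (INR m * gauss_term al be ga m)).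
{ simpl; ring. }
intros m _; assert (H := gauss_term_rec al be ga m Hg).
assert (Z := Hg m); assert (X := INR_1_neq0 m).
assert (E : gauss_term al be (ga + 1) m * (ga + INR m) = ga * gauss_term al be ga m).
{ unfold gauss_term.
  assert (S1 := poch_shift ga m); simpl in S1.
  assert (P := poch_neq0 ga m ltac:(auto)); assert (Y := cfact_neq0 m).
  assert (P' : poch (ga + 1) m <> 0).
  { apply poch_neq0; intros k _; replace (ga + 1 + INR k) with (ga + INR (S k))
      by (rewrite RtoC_INR_S; ring); auto. }
  set (p := poch ga m) in *; set (p' := poch (ga + 1) m) in *; clearbody p p'.
  transitivity (poch al m * poch be m * (p * (ga + INR m)) / (p' * p * cfact m));
    [field; auto|].
  rewrite S1; field; auto. }
rewrite RtoC_INR_S.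
set (g := gauss_term al be ga m) in *; set (g1 := gauss_term al be (ga + 1) m) in *.
set (gS := gauss_term al be ga (S m)) in *; clearbody g g1 gS.
apply Cmult_reg_l with (ga + INR m); trivial.
transitivity (ga * (ga - al - be) * g * (ga + INR m)
  - (ga - al) * (ga - be) * (g1 * (ga + INR m))); [ring|].
rewrite E.
transitivity (- ga * (gS * (ga + INR m) * (INR m + 1)) + ga * INR m * g * (ga + INR m));
  [|ring].
rewrite H; ring.
Qed.

(** The boundary term m t_m has order m^(al + be - ga), which tends to 0. *)
Lemma gauss_contiguous al be ga F : (forall k, ga + INR k <> 0) ->
  (Re al + Re be < Re ga)%R -> Clim (csum (gauss_term al be ga)) F ->
  exists F1, Clim (csum (gauss_term al be (ga + 1))) F1 /\
    ga * (ga - al - be) * F = (ga - al) * (ga - be) * F1.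
Proof.
intros Hg Hr HF.
assert (Hg1 : forall k, ga + 1 + INR k <> 0).
{ intros k; replace (ga + 1 + INR k) with (ga + INR (S k))
    by (rewrite RtoC_INR_S; ring); auto. }
destruct (gauss_summable al be (ga + 1) Hg1) as [K [_ HK]]; [unfold Re in *; simpl; lra|].
destruct (Clim_csum_abs _ _ HK) as [F1 HF1]; exists F1; split; trivial.
assert (Hv : Clim (fun M => INR M * gauss_term al be ga M) 0).
{ apply lin_vanish with (A := [al; be]) (B := [ga; RtoC 0]) (N := O).
  - intros n _; assert (H := gauss_term_rec al be ga n Hg); simpl lin.
    rewrite RtoC_INR_S.
    transitivity (INR n * (gauss_term al be ga (S n) * (ga + INR n) * (INR n + 1)));
      [ring|].
    rewrite H; ring.
  - reflexivity.
  - simpl; lra. }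
assert (HL : Clim (fun M => ga * (ga - al - be) * csum (gauss_term al be ga) M
  - (ga - al) * (ga - be) * csum (gauss_term al be (ga + 1)) M)
  (ga * (ga - al - be) * F - (ga - al) * (ga - be) * F1)).
{ apply Clim_minus; now apply Clim_scal. }
assert (HL' : Clim (fun M => ga * (ga - al - be) * csum (gauss_term al be ga) M
  - (ga - al) * (ga - be) * csum (gauss_term al be (ga + 1)) M) (- ga * 0)).
{ apply Clim_ext with (fun M => - ga * (INR M * gauss_term al be ga M)).
  - intros M; symmetry; now apply gauss_contiguous_partial.
  - now apply Clim_scal. }
assert (E := Clim_unique _ _ _ HL HL').
apply Ceq_minus; rewrite E; ring.
Qed.

Lemma gauss_iterate al be N : forall ga F, (forall k, ga + INR k <> 0) ->
  (Re al + Re be < Re ga)%R -> Clim (csum (gauss_term al be ga)) F ->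
  exists FN, Clim (csum (gauss_term al be (ga + INR N))) FN /\
    poch ga N * poch (ga - al - be) N * F = poch (ga - al) N * poch (ga - be) N * FN.
Proof.
induction N as [|N IH]; intros ga F Hg Hr HF.
- exists F; split; [|simpl; ring].
  simpl; now replace (ga + 0) with ga by ring.
- destruct (gauss_contiguous al be ga F Hg Hr HF) as [F1 [HF1 E1]].
  destruct (IH (ga + 1) F1) as [FN [HFN EN]]; trivial.
  + intros k; replace (ga + 1 + INR k) with (ga + INR (S k))
      by (rewrite RtoC_INR_S; ring); auto.
  + unfold Re in *; simpl; lra.
  + exists FN; split.
    * replace (ga + INR (S N)) with (ga + 1 + INR N) by (rewrite RtoC_INR_S; ring); trivial.
    * rewrite !poch_shift.
      replace (ga - al - be + 1) with (ga + 1 - al - be) by ring.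
      replace (ga - al + 1) with (ga + 1 - al) by ring.
      replace (ga - be + 1) with (ga + 1 - be) by ring.
      transitivity (poch (ga + 1) N * poch (ga + 1 - al - be) N
        * (ga * (ga - al - be) * F)); [ring|].
      rewrite E1.
      transitivity ((ga - al) * (ga - be) *
        (poch (ga + 1) N * poch (ga + 1 - al - be) N * F1)); [ring|].
      rewrite EN; ring.
Qed.

Lemma Cmod_shift_mono (z : C) (n m : nat) :
  (0 <= Re z + INR n)%R -> (n <= m)%nat -> (Cmod (z + INR n) <= Cmod (z + INR m))%R.
Proof.
intros H Hn; apply le_INR in Hn; unfold Cmod; apply sqrt_le_1_alt.
destruct z as [x y]; simpl in *; nra.
Qed.

Lemma Cmod_shift_ge (z : C) (n : nat) : (Re z + INR n <= Cmod (z + INR n))%R.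
Proof.
eapply Rle_trans; [|apply re_le_Cmod].
destruct z as [x y]; simpl; apply Rle_abs.
Qed.

(** Once ga + N0 has nonnegative real part, every factor ga + N0 + j only grows in
    modulus when N0 is replaced by N; the factor j = 0 is kept apart since it provides
    the decay in [gauss_far]. *)
Lemma poch_grows (ga : C) (N0 N m : nat) :
  (0 <= Re ga + INR N0)%R -> (N0 <= N)%nat ->
  (Cmod (ga + INR N) * Cmod (poch (ga + INR N0) (S m))
   <= Cmod (ga + INR N0) * Cmod (poch (ga + INR N) (S m)))%R.
Proof.
intros H HN; induction m as [|m IH].
- simpl; rewrite !Cmod_mult, Cmod_1, !Cplus_0_r; right; ring.
- change (poch ?a (S (S m))) with (poch a (S m) * (a + INR (S m))).
  rewrite !Cmod_mult, <- !Rmult_assoc.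
  apply Rmult_le_compat; trivial; try apply Cmod_ge_0.
  + apply Rmult_le_pos; apply Cmod_ge_0.
  + rewrite <- !Cplus_assoc, <- !RtoC_plus, <- !plus_INR.
    apply Cmod_shift_mono; [|lia].
    rewrite plus_INR; assert (X := pos_INR (S m)); lra.
Qed.

(** 2F1(al, be; ga + N; 1) tends to 1 at rate 1/N: each term but the first gains the
    factor of [poch_grows]. *)
Lemma gauss_far al be ga N0 K : (forall k, ga + INR k <> 0) ->
  (0 < Re ga + INR N0)%R ->
  (forall n, (rsum (fun i => Cmod (gauss_term al be (ga + INR N0) i)) n <= K)%R) ->
  forall N F, (N0 <= N)%nat -> Clim (csum (gauss_term al be (ga + INR N))) F ->
    (Cmod (F - 1) <= Cmod (ga + INR N0) * K / Cmod (ga + INR N))%R.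
Proof.
intros Hg Hp HK N F HN HF.
assert (HN' := le_INR _ _ HN).
assert (Hpos : (0 < Cmod (ga + INR N))%R) by (apply -> Cmod_gt_0; apply Hg).
assert (Hgk : forall N k, ga + INR N + INR k <> 0).
{ intros M k; rewrite <- Cplus_assoc, <- RtoC_plus, <- plus_INR; auto. }
apply (Clim_Cmod_le (fun M => csum (gauss_term al be (ga + INR N)) (S M) - 1)).
{ apply Clim_minus; [now apply (proj1 (Clim_S _ _)) | apply Clim_const]. }
intros M; rewrite csum_shift.
replace (gauss_term al be (ga + INR N) 0) with (RtoC 1)
  by (unfold gauss_term, cfact; simpl; field; apply C1_nz).
match goal with |- (Cmod ?x <= _)%R =>
  replace x with (csum (fun i => gauss_term al be (ga + INR N) (S i)) M) by ring end.
eapply Rle_trans; [apply Cmod_csum|].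
apply Rle_trans with (rsum (fun i => (Cmod (ga + INR N0) / Cmod (ga + INR N)
   * Cmod (gauss_term al be (ga + INR N0) (S i)))%R) M).
- apply rsum_le; intros i _; unfold gauss_term.
  assert (P1 : poch (ga + INR N) (S i) <> 0) by (apply poch_neq0; auto).
  assert (P2 : poch (ga + INR N0) (S i) <> 0) by (apply poch_neq0; auto).
  assert (Y := cfact_neq0 (S i)).
  assert (G := poch_grows ga N0 N i ltac:(lra) HN).
  rewrite !Cmod_div by (now apply Cmult_neq_0).
  rewrite !Cmod_mult.
  apply Cmod_gt_0 in P1; apply Cmod_gt_0 in P2; apply Cmod_gt_0 in Y.
  set (p1 := Cmod (poch (ga + INR N) (S i))) in *.
  set (p2 := Cmod (poch (ga + INR N0) (S i))) in *.
  set (y := Cmod (cfact (S i))) in *.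
  set (t := (Cmod (poch al (S i)) * Cmod (poch be (S i)))%R).
  assert (0 <= t)%R by (apply Rmult_le_pos; apply Cmod_ge_0).
  set (s := Cmod (ga + INR N)) in *; set (s0 := Cmod (ga + INR N0)) in *.
  clearbody p1 p2 y t s s0.
  apply Rmult_le_reg_r with (p1 * y * p2 * s)%R; [repeat apply Rmult_lt_0_compat; trivial|].
  replace (t / (p1 * y) * (p1 * y * p2 * s))%R with (t * (s * p2))%R by (field; lra).
  replace (s0 / s * (t / (p2 * y)) * (p1 * y * p2 * s))%R with (t * (s0 * p1))%R
    by (field; lra).
  now apply Rmult_le_compat_l.
- rewrite rsum_scal.
  assert (HM : (rsum (fun i => Cmod (gauss_term al be (ga + INR N0) (S i))) M <= K)%R).
  { eapply Rle_trans; [|apply (HK (S M))].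
    clear; induction M as [|M IH]; simpl in *; [rewrite Rplus_0_l; apply Cmod_ge_0|lra]. }
  replace (Cmod (ga + INR N0) * K / Cmod (ga + INR N))%R
    with (Cmod (ga + INR N0) / Cmod (ga + INR N) * K)%R by (field; lra).
  apply Rmult_le_compat_l; trivial.
  apply Rmult_le_pos; [apply Cmod_ge_0 | left; now apply Rinv_0_lt_compat].
Qed.

(** Gauss's theorem in product form: iterate [gauss_contiguous] and let the parameter go
    to infinity. *)
Lemma gauss_sum al be ga F : (forall k, ga + INR k <> 0) ->
  (Re al + Re be < Re ga)%R -> Clim (csum (gauss_term al be ga)) F ->
  Clim (fun N => poch (ga - al) N * poch (ga - be) N
    / (poch ga N * poch (ga - al - be) N)) F.
Proof.
intros Hg Hr HF.
destruct (INR_eventually (- Re ga)) as [N0 HN0].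
assert (Hp : (0 < Re ga + INR N0)%R) by (specialize (HN0 N0 (le_n _)); lra).
assert (Hgk : forall N k, ga + INR N + INR k <> 0).
{ intros M k; rewrite <- Cplus_assoc, <- RtoC_plus, <- plus_INR; auto. }
destruct (gauss_summable al be (ga + INR N0) (Hgk N0)) as [K [HK0 HK]].
{ assert (X := pos_INR N0); unfold Re in *; simpl; lra. }
assert (Far := gauss_far al be ga N0 K Hg Hp HK).
set (c := (Cmod (ga + INR N0) * K)%R) in *.
assert (Hc : (0 <= c)%R) by (apply Rmult_le_pos; [apply Cmod_ge_0 | lra]).
destruct (INR_eventually (2 * c - Re ga)) as [N1 HN1].
assert (HQ : forall N, poch ga N * poch (ga - al - be) N <> 0).
{ intros N; apply Cmult_neq_0; apply poch_neq0; auto.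
  intros k _ E; apply (f_equal Re) in E; simpl in E.
  assert (X := pos_INR k); unfold Re in *; lra. }
assert (Hlim : is_lim_seq (fun N => (2 * Cmod F * c * / (INR N + Re ga))%R) 0).
{ replace (Finite 0) with (Rbar_mult (2 * Cmod F * c)%R 0) by (simpl; f_equal; ring).
  apply is_lim_seq_scal_l, is_lim_seq_inv_shift. }
apply is_lim_seq_le_le_loc with (2 := is_lim_seq_const 0) (3 := Hlim).
exists (max N0 N1); intros N HN; split; [apply Cmod_ge_0|].
destruct (gauss_iterate al be N ga F Hg Hr HF) as [FN [HFN EN]].
specialize (Far N FN ltac:(lia) HFN).
specialize (HN0 N ltac:(lia)); specialize (HN1 N ltac:(lia)); specialize (HQ N).
assert (Hge := Cmod_shift_ge ga N).
set (Q := poch ga N * poch (ga - al - be) N) in *.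
set (P := poch (ga - al) N * poch (ga - be) N) in *.
set (s := Cmod (ga + INR N)) in *.
assert (Far' : (Cmod (FN - 1) <= c / (INR N + Re ga))%R).
{ eapply Rle_trans; [exact Far|]; apply Rmult_le_compat_l; trivial.
  apply Rinv_le_contravar; lra. }
assert (Hhalf : (c / (INR N + Re ga) <= 1 / 2)%R).
{ apply Rmult_le_reg_r with (INR N + Re ga)%R; [lra|].
  unfold Rdiv; rewrite Rmult_assoc, Rinv_l by lra; lra. }
assert (HFN' : (1 / 2 <= Cmod FN)%R).
{ assert (X := Cmod_triangle_rev 1 FN); rewrite Cmod_minus_sym, Cmod_1 in X; lra. }
assert (EF : F = P / Q * FN).
{ apply Cmult_reg_l with Q; trivial; rewrite EN; field; trivial. }
rewrite EF at 1; replace (P / Q - P / Q * FN) with (P / Q * (1 - FN)) by (field; trivial).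
rewrite Cmod_mult, (Cmod_minus_sym 1).
assert (HPQ : (Cmod (P / Q) <= 2 * Cmod F)%R).
{ rewrite EF, Cmod_mult; assert (X := Cmod_ge_0 (P / Q)); nra. }
replace (2 * Cmod F * c * / (INR N + Re ga))%R with (2 * Cmod F * (c / (INR N + Re ga)))%R
  by (field; lra).
apply Rmult_le_compat; trivial; apply Cmod_ge_0.
Qed.

(** * Whipple's and Watson's sums for integer index *)

(** Non-integrality in the form in which it is consumed: z + k never vanishes. *)
Definition nonint (z : C) : Prop := forall k : Z, z + IZR k <> 0.

Lemma nonint_of z : ~ is_integer z -> nonint z.
Proof.
intros H k E; apply H; exists (- k)%Z; rewrite opp_IZR, RtoC_opp.
replace z with (z + IZR k - IZR k) by ring; rewrite E; ring.
Qed.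

Lemma nonint_shift z k : nonint z -> nonint (z + IZR k).
Proof.
intros H j; rewrite <- Cplus_assoc, <- RtoC_plus, <- plus_IZR; apply H.
Qed.

Lemma nonint_opp z : nonint z -> nonint (- z).
Proof.
intros H k E; apply (H (- k)%Z); rewrite opp_IZR, RtoC_opp.
replace (z + - IZR k) with (- (- z + IZR k)) by ring; rewrite E; ring.
Qed.

Lemma nonint_nat z n : nonint z -> z + INR n <> 0.
Proof. intros H; rewrite INR_IZR_INZ; apply H. Qed.

Lemma nonint_nat' z n : nonint z -> INR n + z <> 0.
Proof. intros H; rewrite Cplus_comm; now apply nonint_nat. Qed.

Lemma nonint_nat_1 z n : nonint z -> INR n + 1 + z <> 0.
Proof. rewrite <- RtoC_INR_S; apply nonint_nat'. Qed.

Lemma nonint_sub_0 z n : nonint z -> INR n - z <> 0.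
Proof. intros H; unfold Cminus; apply nonint_nat', nonint_opp; trivial. Qed.

Lemma nonint_sub_1 z n : nonint z -> INR n + 1 - z <> 0.
Proof. intros H; unfold Cminus; apply nonint_nat_1, nonint_opp; trivial. Qed.

Lemma nonint_sub_2 z n : nonint z -> INR n + 2 - z <> 0.
Proof.
intros H; replace (INR n + 2 - z) with (INR (S n) + 1 - z)
  by (rewrite RtoC_INR_S; ring); now apply nonint_sub_1.
Qed.

Lemma nonint_neq0 z : nonint z -> z <> 0.
Proof. intros H; specialize (H 0%Z); now replace z with (z + 0) by ring. Qed.

Lemma nonint_1sub z : nonint z -> 1 - z <> 0.
Proof.
intros H; replace (1 - z) with (INR 0 + 1 - z) by (simpl; ring); now apply nonint_sub_1.
Qed.

Lemma poch_nonint z n : nonint z -> poch z n <> 0.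
Proof. intros H; apply poch_neq0; intros; now apply nonint_nat. Qed.

(** 1 / (k - n)!, with the convention that it is 0 for n > k.  The convention makes the
    two recurrences below hold without side condition, so that sums can be taken over
    fixed ranges. *)
Definition inv_fact_sub (k n : nat) : C := if (n <=? k)%nat then / cfact (k - n) else 0.

Lemma inv_fact_sub_0 k n : (k < n)%nat -> inv_fact_sub k n = 0.
Proof.
intros H; unfold inv_fact_sub; apply Nat.leb_gt in H; now rewrite H.
Qed.

Lemma inv_fact_sub_diag k : inv_fact_sub k k = 1.
Proof.
unfold inv_fact_sub; rewrite Nat.leb_refl, Nat.sub_diag; unfold cfact; simpl.
field; apply C1_nz.
Qed.

Lemma inv_fact_sub_Sl k n : (INR k + 1 - INR n) * inv_fact_sub (S k) n = inv_fact_sub k n.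
Proof.
destruct (Nat.lt_trichotomy n (S k)) as [H|[->|H]].
- unfold inv_fact_sub; rewrite !(proj2 (Nat.leb_le _ _)) by lia.
  replace (S k - n)%nat with (S (k - n)) by lia.
  rewrite cfact_S, minus_INR, RtoC_minus by lia.
  assert (X := cfact_neq0 (k - n)); assert (Y := INR_1_neq0 (k - n)).
  rewrite minus_INR, RtoC_minus in Y by lia.
  field; split; trivial.
- rewrite RtoC_INR_S, (inv_fact_sub_0 k) by lia; ring.
- rewrite !inv_fact_sub_0 by lia; ring.
Qed.

Lemma inv_fact_sub_Sr k n : (INR k - INR n) * inv_fact_sub k n = inv_fact_sub k (S n).
Proof.
destruct (Nat.lt_trichotomy n k) as [H|[H|H]].
- assert (E := inv_fact_sub_Sl (k - 1) n); replace (S (k - 1)) with k in E by lia.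
  replace (INR k) with (INR (S (k - 1))) by (f_equal; lia).
  rewrite RtoC_INR_S, E.
  unfold inv_fact_sub; rewrite !(proj2 (Nat.leb_le _ _)) by lia; do 2 f_equal; lia.
- subst k; rewrite (inv_fact_sub_0 n (S n)) by lia; ring.
- rewrite !inv_fact_sub_0 by lia; ring.
Qed.

Lemma poch_S a n : poch a (S n) = poch a n * (a + INR n).
Proof. reflexivity. Qed.

(** The two factors of the basic double sum, without the shifted factorials of a and b. *)
Definition alpha (d e c : C) (n : nat) : C := poch c n / (cfact n * poch d n * poch e (S n)).
Definition beta (d e c : C) (m : nat) : C := cfact m * poch d (S m) * poch e m / poch c (S m).

(** The factors of the partial fraction coefficient at the pole k that depend on n and on m,
    times the corresponding factor of the summand. *)
Definition left_term (al : nat -> C) (k n : nat) : C :=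
  (-1) ^ n * cfact (n + k) * inv_fact_sub k n * al n.
Definition right_term (be : nat -> C) (k m : nat) : C :=
  be m * inv_fact_sub m k / cfact (S (m + k)).
Definition whipple_term (d e c : C) : nat -> nat -> C := left_term (alpha d e c).
Definition watson_term (d e c : C) : nat -> nat -> C := right_term (beta d e c).

Lemma half_sum (c d e : C) : d + e = 2 * c -> c = (d + e) / 2.
Proof. intros ->; field; apply RtoC_neq; lra. Qed.

Lemma two_neq0 : RtoC 2 <> 0.
Proof. apply RtoC_neq; lra. Qed.

(** The summand is G (n+1) - G n for the rational multiple G of the term given below, and G
    vanishes at both ends of the range.  The relation d + e = 2c is what makes a
    first-order recurrence possible, at the price of exchanging d and e. *)
Lemma whipple_telescopes d e c k : nonint d -> nonint e -> d + e = 2 * c ->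
  csum (fun n => (INR k + 1 + e) * whipple_term d e c (S k) n
     + (INR k + 1 - d) * whipple_term e d c k n) (S (S k)) = 0.
Proof.
intros Hd He Hc.
set (G := fun n => - (2 * INR n) * (d + INR n) * (e + INR n) *
  ((-1) ^ n * cfact (n + k) * inv_fact_sub (S k) n / cfact n
   * (poch c n / (poch d (S n) * poch e (S n))))).
rewrite csum_telescope with (G := G).
{ unfold G; rewrite inv_fact_sub_0 by lia; simpl INR.
  unfold Cdiv; ring. }
intros n _; unfold G, whipple_term, left_term, alpha.
replace (n + S k)%nat with (S (n + k)) by lia.
change (S n + k)%nat with (S (n + k)).
rewrite <- (inv_fact_sub_Sl k n), <- (inv_fact_sub_Sr (S k) n), !cfact_S, ?RtoC_INR_S.
rewrite !poch_S; simpl Cpow; rewrite plus_INR, RtoC_plus, ?RtoC_INR_S.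
rewrite (half_sum c d e Hc).
assert (P1 := poch_nonint d n Hd); assert (P2 := poch_nonint e n He).
assert (Q1 := nonint_nat d n Hd); assert (Q2 := nonint_nat e n He).
assert (Q3 := nonint_nat d (S n) Hd); assert (Q4 := nonint_nat e (S n) He).
rewrite RtoC_INR_S in Q3, Q4.
assert (X := cfact_neq0 n); assert (Y := INR_1_neq0 n); assert (T := two_neq0).
field; repeat split; trivial.
Qed.

(** As in [whipple_telescopes], but the range is infinite: the boundary term at M stays and
    has to vanish in the limit. *)
Lemma watson_telescopes d e c k M : nonint c -> d + e = 2 * c ->
  csum (fun m => (INR k + 2 - e) * watson_term d e c (S k) m
    - (INR k + d) * watson_term e d c k m) M
  = -2 * (cfact M * poch d M * poch e M * ((INR M - INR k) * inv_fact_sub M k)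
      / (cfact (S (M + k)) * poch c M)).
Proof.
intros Hc Hs.
rewrite csum_telescope with (G := fun M =>
  -2 * (cfact M * poch d M * poch e M * ((INR M - INR k) * inv_fact_sub M k)
      / (cfact (S (M + k)) * poch c M))).
{ destruct k; [simpl INR | rewrite (inv_fact_sub_0 0 (S k)) by lia]; unfold Cdiv; ring. }
intros m _; unfold watson_term, right_term, beta.
replace (m + S k)%nat with (S (m + k)) by lia.
change (S m + k)%nat with (S (m + k)).
rewrite (RtoC_INR_S m), <- (inv_fact_sub_Sr m k), (inv_fact_sub_Sl m k), !cfact_S, ?RtoC_INR_S.
simpl poch; rewrite plus_INR, RtoC_plus.
assert (P1 := poch_nonint c m Hc); assert (Q1 := nonint_nat c m Hc).
assert (X := cfact_neq0 (m + k)); assert (Y := INR_1_neq0 (m + k)).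
assert (Y' := INR_1_neq0 (S (m + k))); rewrite RtoC_INR_S in Y'.
rewrite plus_INR, RtoC_plus in Y, Y'.
assert (Ed : d = 2 * c - e) by (rewrite <- Hs; ring); rewrite Ed.
field; repeat split; trivial.
Qed.

(** Closed form of the terminating sum.  A recursion rather than a product, because d and e
    are exchanged at each step. *)
Fixpoint whipple_value (d e : C) (k : nat) : C :=
  match k with
  | O => / e
  | S j => - (INR j + 1 - d) / (INR j + 1 + e) * whipple_value e d j
  end.

(** Closed form of the infinite sum.  V = sin(pi (d - c)) / sin(pi c) changes sign when d and
    e are exchanged. *)
Fixpoint watson_value (d e V : C) (k : nat) : C :=
  match k with
  | O => (1 + V) / (1 - e)
  | S j => (INR j + d) / (INR j + 2 - e) * watson_value e d (- V) j
  end.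

Lemma whipple k : forall d e c, nonint d -> nonint e -> d + e = 2 * c ->
  csum (whipple_term d e c k) (S k) = whipple_value d e k.
Proof.
induction k as [|k IH]; intros d e c Hd He Hc.
- simpl; unfold whipple_term, left_term, alpha; rewrite inv_fact_sub_diag; simpl; unfold cfact; simpl.
  assert (X := nonint_neq0 e He).
  replace (e + 0) with e by ring; field; auto using C1_nz.
- assert (H := whipple_telescopes d e c k Hd He Hc).
  rewrite csum_plus, !csum_scal in H.
  rewrite (csum_stable (whipple_term e d c k) (S k) (S (S k))) in H; [|lia|].
  2: { intros i Hi; unfold whipple_term, left_term; rewrite inv_fact_sub_0 by lia; ring. }
  rewrite (IH e d c He Hd) in H by (rewrite Cplus_comm; trivial).
  assert (X := nonint_nat_1 e k He).
  apply Cmult_reg_l with (INR k + 1 + e); trivial.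
  simpl whipple_value; transitivity (- ((INR k + 1 - d) * whipple_value e d k)); [|field; trivial].
  apply Ceq_minus; rewrite <- H; ring.
Qed.

(** The boundary term of [watson_telescopes] has order M^(c - 1), so Re c < 1 is exactly
    what is needed. *)
Lemma watson_step d e c k L : nonint c -> nonint e -> d + e = 2 * c -> (Re c < 1)%R ->
  Clim (csum (watson_term e d c k)) L ->
  Clim (csum (watson_term d e c (S k))) ((INR k + d) / (INR k + 2 - e) * L).
Proof.
intros Hc He Hs Hr HL.
assert (HR : (Re d + Re e = 2 * Re c)%R).
{ apply (f_equal Re) in Hs; unfold Re in *; simpl in Hs; lra. }
assert (Hv : Clim (fun M => cfact M * poch d M * poch e M * ((INR M - INR k) * inv_fact_sub M k)
      / (cfact (S (M + k)) * poch c M)) 0).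
{ apply lin_vanish with (A := [RtoC 1; d; e])
    (B := [RtoC (INR k + 2); c; RtoC (- INR k)]) (N := O).
  - intros m _; simpl lin; rewrite (RtoC_INR_S m), (inv_fact_sub_Sl m k).
    change (S m + k)%nat with (S (m + k)).
    rewrite !cfact_S, ?RtoC_INR_S, plus_INR, !RtoC_plus, RtoC_opp; simpl poch.
    assert (P1 := poch_nonint c m Hc); assert (Q1 := nonint_nat c m Hc).
    assert (X := cfact_neq0 (m + k)); assert (Y := INR_1_neq0 (m + k)).
    assert (Y' := INR_1_neq0 (S (m + k))); rewrite RtoC_INR_S in Y'.
    rewrite plus_INR, RtoC_plus in Y, Y'.
    field; repeat split; trivial.
  - reflexivity.
  - simpl; lra. }
apply (Clim_scal (-2)) in Hv.
assert (Hx := nonint_sub_2 e k He).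
apply Clim_ext with (fun M => / (INR k + 2 - e) *
   (-2 * (cfact M * poch d M * poch e M * ((INR M - INR k) * inv_fact_sub M k)
      / (cfact (S (M + k)) * poch c M)) + (INR k + d) * csum (watson_term e d c k) M)).
- intros M; rewrite <- watson_telescopes by trivial.
  rewrite (csum_ext _ (fun m => (INR k + 2 - e) * watson_term d e c (S k) m
    + (- (INR k + d)) * watson_term e d c k m)) by (intros; ring).
  rewrite csum_plus, !csum_scal; field; trivial.
- apply Clim_eq with (/ (INR k + 2 - e) * (-2 * 0 + (INR k + d) * L));
    [|field; trivial].
  apply Clim_scal, Clim_plus; trivial; now apply Clim_scal.
Qed.

(** sin(pi (x + iy)) has real and imaginary parts sin(pi x) cosh(pi y) and
    cos(pi x) sinh(pi y); as cosh has no zero, both vanish only for y = 0 and integer x. *)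
Lemma sin_pi_neq0 z : nonint z -> Csin (PI * z) <> 0.
Proof.
intros Hz E.
destruct z as [x y].
assert (E1 : (sin (PI * x) * cosh (PI * y) = 0)%R /\ (cos (PI * x) * sinh (PI * y) = 0)%R).
{ assert (E' : Csin (PI * (x, y)) =
    ((sin (PI * x) * cosh (PI * y))%R, (cos (PI * x) * sinh (PI * y))%R)).
  { unfold Csin, Cexp, cosh, sinh; simpl Re; simpl Im.
    replace (0 * (PI * x - 0 * y) - 1 * (PI * y + 0 * x))%R with (- (PI * y))%R by ring.
    replace (0 * (PI * y + 0 * x) + 1 * (PI * x - 0 * y))%R with (PI * x)%R by ring.
    rewrite Ropp_involutive, cos_neg, sin_neg.
    apply injective_projections; simpl; field. }
  rewrite E' in E; injection E; auto. }
destruct E1 as [E1 E2].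
assert (Hch : (0 < cosh (PI * y))%R).
{ unfold cosh; assert (X := exp_pos (PI * y)); assert (Y := exp_pos (- (PI * y))); lra. }
assert (Hs : sin (PI * x) = 0%R).
{ apply Rmult_integral in E1; destruct E1; trivial; lra. }
assert (Hcs : cos (PI * x) <> 0%R).
{ intros X; assert (Y := sin2_cos2 (PI * x)); unfold Rsqr in Y.
  rewrite Hs, X in Y; lra. }
assert (Hsh : sinh (PI * y) = 0%R).
{ apply Rmult_integral in E2; destruct E2; trivial; contradiction. }
assert (HP := PI_RGT_0).
assert (Hy : y = 0%R).
{ unfold sinh in Hsh.
  assert (X : exp (PI * y) = exp (- (PI * y))) by lra.
  apply exp_inv in X; apply Rmult_eq_reg_l with PI; lra. }
apply sin_eq_0_0 in Hs; destruct Hs as [k Hk].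
assert (Hx : x = IZR k) by (apply Rmult_eq_reg_l with PI; lra).
apply (Hz (- k)%Z); rewrite opp_IZR, RtoC_opp; subst.
apply injective_projections; simpl; ring.
Qed.

Lemma Csin_opp z : Csin (- z) = - Csin z.
Proof.
unfold Csin; replace (Ci * - z) with (- (Ci * z)) by ring.
replace (- - (Ci * z)) with (Ci * z) by ring.
unfold Cdiv; ring.
Qed.

(** For k = 0 the two factors m! cancel and the sum is, up to its missing first term and
    the factor e - 1, the Gauss sum 2F1(d, e - 1; c; 1).  Since d + e = 2c its value is
    the limit of (c-d)_N (1-(c-d))_N / ((c)_N (1-c)_N), a quotient of two sine products. *)
Lemma watson_0 d e c : nonint c -> nonint e -> d + e = 2 * c -> (Re c < 1)%R ->
  Clim (csum (watson_term d e c 0)) ((1 + Csin (PI * (d - c)) / Csin (PI * c)) / (1 - e)).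
Proof.
intros Hc He Hs Hr.
assert (HR : (Re d + Re e = 2 * Re c)%R).
{ apply (f_equal Re) in Hs; unfold Re in *; simpl in Hs; lra. }
assert (Hg : forall k, c + INR k <> 0) by (intros; now apply nonint_nat).
assert (Hre : (Re d + Re (e - 1) < Re c)%R) by (unfold Re in *; simpl; lra).
destruct (gauss_summable d (e - 1) c Hg Hre) as [K [_ HK]].
destruct (Clim_csum_abs _ _ HK) as [F HF].
assert (HG := gauss_sum d (e - 1) c F Hg Hre HF).
assert (Sc := sin_pi_neq0 c Hc).
assert (Hlim : Clim (fun N => poch (c - d) N * poch (c - (e - 1)) N
    / (poch c N * poch (c - d - (e - 1)) N)) (Csin (PI * (c - d)) * / Csin (PI * c))).
{ apply Clim_ext with (fun N => poch (c - d) N * poch (1 - (c - d)) N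
      / (poch (1 / 2) N * poch (1 / 2) N)
    * / (poch c N * poch (1 - c) N / (poch (1 / 2) N * poch (1 / 2) N))).
  - intros N.
    replace (1 - (c - d)) with (c - (e - 1))
      by (replace (c - (e - 1)) with (2 * c - c - e + 1) by ring; rewrite <- Hs; ring).
    replace (c - d - (e - 1)) with (1 - c)
      by (replace (1 - c) with (c + 1 - 2 * c) by ring; rewrite <- Hs; ring).
    assert (P := poch_half_neq0 N); assert (P1 := poch_nonint c N Hc).
    assert (P2 : poch (1 - c) N <> 0).
    { apply poch_nonint; replace (1 - c) with (- c + IZR 1) by (unfold Cminus; ring).
      now apply nonint_shift, nonint_opp. }
    field; auto.
  - apply Clim_mult; [apply sin_product|]; apply Clim_inv; trivial; apply sin_product. }
assert (EF := Clim_unique _ _ _ HG Hlim); clear HG Hlim.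
apply Clim_ext with (fun M => / (e - 1) * (csum (gauss_term d (e - 1) c) (S M) - 1)).
- intros M; rewrite csum_shift.
  replace (gauss_term d (e - 1) c 0) with (RtoC 1)
    by (unfold gauss_term, cfact; simpl; field; apply C1_nz).
  assert (He1 : e - 1 <> 0).
  { intros X; apply (nonint_1sub e He); replace (1 - e) with (- (e - 1)) by ring.
    rewrite X; ring. }
  transitivity (csum (fun m => / (e - 1) * gauss_term d (e - 1) c (S m)) M);
    [rewrite csum_scal; ring|].
  apply csum_ext; intros m _; unfold gauss_term, watson_term, right_term, beta.
  rewrite (poch_shift (e - 1)); replace (e - 1 + 1) with e by ring.
  rewrite Nat.add_0_r; unfold inv_fact_sub; simpl Nat.leb; rewrite Nat.sub_0_r.
  assert (P1 := poch_nonint c (S m) Hc).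
  assert (X := cfact_neq0 m); assert (Y := cfact_neq0 (S m)).
  field; repeat split; trivial.
- apply Clim_eq with (/ (e - 1) * (F - 1)).
  + apply Clim_scal, Clim_minus; [|apply Clim_const].
    now apply (proj1 (Clim_S _ _)).
  + rewrite EF; replace (PI * (c - d)) with (- (PI * (d - c))) by ring.
    rewrite Csin_opp; assert (X := nonint_1sub e He).
    field; repeat split; trivial.
    intros Y; apply X; replace (1 - e) with (- (e - 1)) by ring; rewrite Y; ring.
Qed.

Lemma watson k : forall d e c, nonint c -> nonint d -> nonint e -> d + e = 2 * c ->
  (Re c < 1)%R ->
  Clim (csum (watson_term d e c k)) (watson_value d e (Csin (PI * (d - c)) / Csin (PI * c)) k).
Proof.
induction k as [|k IH]; intros d e c Hc Hd He Hs Hr; [now apply watson_0|].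
simpl watson_value; apply watson_step; trivial.
replace (- (Csin (PI * (d - c)) / Csin (PI * c))) with (Csin (PI * (e - c)) / Csin (PI * c)).
- apply IH; trivial; now rewrite Cplus_comm.
- replace (PI * (e - c)) with (- (PI * (d - c))).
  + rewrite Csin_opp; unfold Cdiv; ring.
  + replace (e - c) with (2 * c - d - c); [ring|]. rewrite <- Hs; ring.
Qed.

(** In the product the recurrences of the two factors cancel up to the simple poles. *)
Lemma whipple_watson_value k : forall d e V, nonint d -> nonint e ->
  (-1) ^ k * whipple_value d e k * watson_value d e V k
  = (1 + (-1) ^ k * V) / ((INR k + e) * (INR k + 1 - e)).
Proof.
induction k as [|k IH]; intros d e V Hd He.
- simpl; assert (X := nonint_neq0 e He); assert (Y := nonint_1sub e He).
  field; repeat split; trivial.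
- assert (H := IH e d (- V) He Hd).
  simpl whipple_value; simpl watson_value; simpl Cpow.
  assert (X := nonint_nat' d k Hd); assert (X1 := nonint_sub_1 d k Hd).
  assert (Y := nonint_nat_1 e k He); assert (Y1 := nonint_sub_2 e k He).
  rewrite RtoC_INR_S.
  transitivity ((INR k + 1 - d) * (INR k + d) / ((INR k + 1 + e) * (INR k + 2 - e))
    * ((-1) ^ k * whipple_value e d k * watson_value e d (- V) k)); [field; repeat split; trivial|].
  rewrite H; field; repeat split; trivial.
  now replace (INR k + 1 + 1 - e) with (INR k + 2 - e) by ring.
Qed.

(** Each statement is the induction hypothesis of the other, because the recurrence
    exchanges the two parameters. *)
Lemma whipple_value_shift k d e : nonint d -> nonint e ->
  whipple_value (d + 1) e k
  = d * (1 - d) / ((INR k + d) * (INR k + 1 - d)) * whipple_value (d - 1) e k /\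
  whipple_value e (d + 1) k
  = d * (1 - d) / ((INR k + 1 + d) * (INR k - d)) * whipple_value e (d - 1) k.
Proof.
intros Hd He; induction k as [|k [IH1 IH2]].
- simpl; assert (X := nonint_neq0 d Hd); assert (Y := nonint_1sub d Hd).
  assert (Z := nonint_neq0 e He).
  assert (X1 := nonint_nat_1 d 0 Hd); simpl in X1.
  assert (Y' : d - 1 <> 0).
  { intros E; apply Y; replace (1 - d) with (- (d - 1)) by ring; rewrite E; ring. }
  split; field; repeat split; trivial.
  now replace (1 + d) with (0 + 1 + d) by ring.
- simpl whipple_value; rewrite IH1, IH2, RtoC_INR_S.
  assert (X0 := nonint_nat' d k Hd); assert (X1 := nonint_nat_1 d k Hd).
  assert (X2 := nonint_nat_1 d (S k) Hd); rewrite RtoC_INR_S in X2.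
  assert (Y0 := nonint_sub_0 d k Hd); assert (Y1 := nonint_sub_1 d k Hd).
  assert (Y2 := nonint_sub_2 d k Hd).
  assert (Z := nonint_nat_1 e k He).
  split; field; repeat split; trivial;
    try (now replace (INR k + 1 + 1 - d) with (INR k + 2 - d) by ring);
    try (now replace (INR k + 1 + (d - 1)) with (INR k + d) by ring);
    try (now replace (INR k + 1 + (d + 1)) with (INR k + 1 + 1 + d) by ring).
Qed.

(** * Partial fractions and absolute convergence of the double sum *)

Definition tri_sum (f : nat -> nat -> C) (M : nat) : C :=
  csum (fun m => csum (fun n => f n m) (S m)) M.

Definition tri_rsum (f : nat -> nat -> R) (M : nat) : R :=
  rsum (fun m => rsum (fun n => f n m) (S m)) M.

Fixpoint triangle (M : nat) : list (nat * nat) :=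
  match M with
  | O => []
  | S m => map (fun n => (n, m)) (seq 0 (S m)) ++ triangle m
  end.

Definition list_rsum (g : nat * nat -> R) (F : list (nat * nat)) : R :=
  fold_right (fun p s => (g p + s)%R) 0%R F.

Lemma in_triangle n m M : In (n, m) (triangle M) <-> (n <= m < M)%nat.
Proof.
induction M as [|M IH]; [simpl; lia|].
change (triangle (S M)) with (map (fun n => (n, M)) (seq 0 (S M)) ++ triangle M).
rewrite in_app_iff, IH, in_map_iff; split.
- intros [[x [E Hx]]|H]; [|lia].
  injection E; intros; subst; apply in_seq in Hx; lia.
- intros H; destruct (Nat.eq_dec m M) as [->|Hne]; [left|right; lia].
  exists n; split; trivial; apply in_seq; lia.
Qed.

Lemma NoDup_triangle M : NoDup (triangle M).
Proof.
induction M as [|M IH]; [constructor|].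
change (triangle (S M)) with (map (fun n => (n, M)) (seq 0 (S M)) ++ triangle M).
apply NoDup_app; trivial.
- apply NoDup_map_NoDup_ForallPairs; [|apply seq_NoDup].
  intros x y _ _ E; now injection E.
- intros [n m] H1 H2; apply in_triangle in H2; apply in_map_iff in H1.
  destruct H1 as [x [E _]]; injection E; intros; lia.
Qed.

Lemma finite_sum_app f F G : finite_sum f (F ++ G) = finite_sum f F + finite_sum f G.
Proof. induction F as [|p F IH]; simpl; [ring | rewrite IH; ring]. Qed.

Lemma list_rsum_app f F G : list_rsum f (F ++ G) = (list_rsum f F + list_rsum f G)%R.
Proof. induction F as [|p F IH]; simpl; [ring | rewrite IH; ring]. Qed.

Lemma finite_sum_perm f F G : Permutation F G -> finite_sum f F = finite_sum f G.
Proof.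
induction 1 as [|x F G _ IH|x y F|F G H _ IH1 _ IH2]; simpl; trivial.
- now rewrite IH.
- ring.
- now rewrite IH1.
Qed.

Lemma list_rsum_perm f F G : Permutation F G -> list_rsum f F = list_rsum f G.
Proof.
induction 1 as [|x F G _ IH|x y F|F G H _ IH1 _ IH2]; simpl; trivial.
- now rewrite IH.
- ring.
- now rewrite IH1.
Qed.

Lemma incl_complement (F : list (nat * nat)) : forall G, NoDup F -> incl F G ->
  exists H, Permutation G (F ++ H).
Proof.
induction F as [|x F IH]; intros G HF HG; [now exists G|].
inversion HF as [|x' F' Hx HF']; subst.
destruct (in_split x G) as [G1 [G2 ->]]; [apply HG; now left|].
destruct (IH (G1 ++ G2)) as [H HP]; trivial.
- intros y Hy; assert (Hy' : In y (G1 ++ x :: G2)) by (apply HG; now right).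
  apply in_app_iff in Hy'; apply in_app_iff; destruct Hy' as [|[->|]]; tauto.
- exists H; simpl; rewrite <- HP; symmetry; apply Permutation_middle.
Qed.

Lemma finite_sum_map f m l :
  finite_sum (fun p => f (fst p) (snd p)) (map (fun n => (n, m)) l)
  = fold_right (fun n s => f n m + s) (RtoC 0) l.
Proof. induction l as [|n l IH]; simpl; trivial; now rewrite IH. Qed.

Lemma fold_seq_csum (g : nat -> C) n :
  fold_right (fun i s => g i + s) (RtoC 0) (seq 0 n) = csum g n.
Proof.
assert (H : forall k, fold_right (fun i s => g i + s) (RtoC 0) (seq k n)
  = csum (fun i => g (k + i)%nat) n).
{ induction n as [|n IH]; intros k; trivial.
  rewrite csum_shift; simpl; rewrite IH, Nat.add_0_r; f_equal.
  apply csum_ext; intros i _; f_equal; lia. }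
apply (H O).
Qed.

Lemma fold_seq_rsum (g : nat -> R) n :
  fold_right (fun i s => (g i + s)%R) 0%R (seq 0 n) = rsum g n.
Proof.
induction n as [|n IH]; trivial.
rewrite seq_S, fold_right_app; simpl; rewrite <- IH.
generalize (seq 0 n) as l; induction l as [|x l IHl]; simpl; [ring|].
rewrite IHl; ring.
Qed.

Lemma finite_sum_triangle f M :
  finite_sum (fun p => f (fst p) (snd p)) (triangle M) = tri_sum f M.
Proof.
induction M as [|M IH]; trivial.
change (triangle (S M)) with (map (fun n => (n, M)) (seq 0 (S M)) ++ triangle M).
rewrite finite_sum_app, IH, finite_sum_map.
rewrite (fold_seq_csum (fun n => f n M)); unfold tri_sum.
change (csum (fun n => f n M) (S M) + csum (fun m => csum (fun n => f n m) (S m)) M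
 = csum (fun m => csum (fun n => f n m) (S m)) M + csum (fun n => f n M) (S M)); ring.
Qed.

Lemma list_rsum_triangle f M :
  list_rsum (fun p => f (fst p) (snd p)) (triangle M) = tri_rsum f M.
Proof.
induction M as [|M IH]; trivial.
change (triangle (S M)) with (map (fun n => (n, M)) (seq 0 (S M)) ++ triangle M).
rewrite list_rsum_app, IH.
replace (list_rsum (fun p => f (fst p) (snd p)) (map (fun n => (n, M)) (seq 0 (S M))))
  with (rsum (fun n => f n M) (S M)).
{ unfold tri_rsum; change (rsum (fun m => rsum (fun n => f n m) (S m)) (S M))
    with (rsum (fun m => rsum (fun n => f n m) (S m)) M + rsum (fun n => f n M) (S M))%R.
  ring. }
rewrite <- fold_seq_rsum; generalize (seq 0 (S M)) as l.
induction l as [|x l IHl]; simpl; trivial; now rewrite IHl.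
Qed.

Lemma list_rsum_ge0 g H : (forall p, (0 <= g p)%R) -> (0 <= list_rsum g H)%R.
Proof.
intros Hg; induction H as [|p H IH]; simpl; [lra|]; specialize (Hg p); lra.
Qed.

Lemma Cmod_finite_sum f H :
  (Cmod (finite_sum f H) <= list_rsum (fun p => Cmod (f p)) H)%R.
Proof.
induction H as [|p H IH]; simpl; [rewrite Cmod_0; lra|].
eapply Rle_trans; [apply Cmod_triangle|]; lra.
Qed.

Lemma list_in_triangle (F : list (nat * nat)) :
  (forall p, In p F -> (fst p <= snd p)%nat) -> exists M, incl F (triangle M).
Proof.
induction F as [|[n m] F IH]; intros HF; [exists O; intros p []|].
destruct IH as [M HM]; [intros p Hp; apply HF; now right|].
exists (max M (S m)); intros [n' m'] [E|Hp].
- injection E; intros; subst; apply in_triangle.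
  specialize (HF (n', m') (or_introl eq_refl)); simpl in HF; lia.
- specialize (HM _ Hp); apply in_triangle in HM; apply in_triangle; lia.
Qed.

(** Absolute summability over n <= m: triangular partial sums converge, and those of the
    absolute values stay bounded.  This form is stable under linear combinations. *)
Definition tri_summable (f : nat -> nat -> C) (S : C) : Prop :=
  Clim (tri_sum f) S /\
  exists B, forall M, (tri_rsum (fun n m => Cmod (f n m)) M <= B)%R.

Lemma tri_summable_linear x y f g h S T :
  (forall n m, (n <= m)%nat -> h n m = x * f n m + y * g n m) ->
  tri_summable f S -> tri_summable g T -> tri_summable h (x * S + y * T).
Proof.
intros E [HS [B HB]] [HT [B' HB']]; split.
- apply Clim_ext with (fun M => x * tri_sum f M + y * tri_sum g M).
  + intros M; unfold tri_sum; rewrite <- !csum_scal, <- csum_plus.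
    apply csum_ext; intros m _; rewrite <- !csum_scal, <- csum_plus.
    apply csum_ext; intros n Hn; rewrite E; trivial; lia.
  + apply Clim_plus; now apply Clim_scal.
- exists (Cmod x * B + Cmod y * B')%R; intros M.
  apply Rle_trans with (Cmod x * tri_rsum (fun n m => Cmod (f n m)) M
    + Cmod y * tri_rsum (fun n m => Cmod (g n m)) M)%R.
  + unfold tri_rsum; rewrite <- !rsum_scal, <- rsum_plus.
    apply rsum_le; intros m _; rewrite <- !rsum_scal, <- rsum_plus.
    apply rsum_le; intros n Hn; rewrite E, <- !Cmod_mult by lia; apply Cmod_triangle.
  + apply Rplus_le_compat; apply Rmult_le_compat_l; auto using Cmod_ge_0.
Qed.

(** A finite set containing a large triangle differs from a still larger triangle by a set
    on which the absolute values have a small sum. *)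
Lemma tri_summable_is_sum f S : tri_summable f S -> is_sum_0_le_n_le_m f S.
Proof.
intros [HS [B HB]].
unfold is_sum_0_le_n_le_m, is_sum_over; apply filterlim_locally; intros [eps He]; simpl.
set (g := fun p : nat * nat => Cmod (f (fst p) (snd p))).
assert (Hg : forall p, (0 <= g p)%R) by (intros; apply Cmod_ge_0).
destruct (Clim_csum_tail (fun m => rsum (fun n => Cmod (f n m)) (Datatypes.S m)) B 0
  (eps / 2)) as [N1 [_ HN1]]; [| exact HB | lra |].
{ intros m; apply rsum_ge0; intros; apply Cmod_ge_0. }
change (forall n, (N1 <= n)%nat -> (tri_rsum (fun n m => Cmod (f n m)) n
  - tri_rsum (fun n m => Cmod (f n m)) N1 < eps / 2)%R) in HN1.
destruct (proj1 (Clim_eps _ _) HS (eps / 2)%R ltac:(lra)) as [N2 HN2].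
exists (triangle N1); split.
{ split; [apply NoDup_triangle|]; intros [n m] H; apply in_triangle in H; simpl; lia. }
intros F [HF HD] Hincl.
destruct (list_in_triangle F HD) as [M0 HM0].
set (M := max M0 (max N1 N2)).
assert (HFM : incl F (triangle M)).
{ intros [n m] Hp; specialize (HM0 _ Hp); apply in_triangle in HM0; apply in_triangle.
  unfold M; lia. }
destruct (incl_complement F (triangle M) HF HFM) as [H HP].
destruct (incl_complement (triangle N1) F (NoDup_triangle N1) Hincl) as [H' HP'].
assert (E1 := finite_sum_perm (fun p => f (fst p) (snd p)) _ _ HP).
rewrite finite_sum_app, finite_sum_triangle in E1.
assert (Etri : forall N, tri_rsum (fun n m => Cmod (f n m)) N = list_rsum g (triangle N)).
{ intros N; symmetry; apply (list_rsum_triangle (fun n m => Cmod (f n m))). }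
assert (E2 := Etri M); rewrite (list_rsum_perm g _ _ HP), list_rsum_app in E2.
assert (E3 := list_rsum_perm g _ _ HP'); rewrite list_rsum_app, <- Etri in E3.
assert (B1 := Cmod_finite_sum (fun p => f (fst p) (snd p)) H).
change (Cmod (finite_sum (fun p => f (fst p) (snd p)) H) <= list_rsum g H)%R in B1.
assert (B2 := list_rsum_ge0 g H' Hg).
specialize (HN1 M ltac:(unfold M; lia)); specialize (HN2 M ltac:(unfold M; lia)).
apply C_NormedModule_mixin_compat1.
change (Cmod (finite_sum (fun p => f (fst p) (snd p)) F - S) < eps)%R.
rewrite E1 in HN2.
replace (finite_sum (fun p => f (fst p) (snd p)) F - S) with
  ((finite_sum (fun p => f (fst p) (snd p)) F
    + finite_sum (fun p => f (fst p) (snd p)) H - S)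
   + - finite_sum (fun p => f (fst p) (snd p)) H) by ring.
eapply Rle_lt_trans; [apply Cmod_triangle|]; rewrite Cmod_opp; lra.
Qed.


(** The residue of (a,b)_n / (a,b)_(m+1) at ab = -k(k+1): the product of
    1 / (j(j+1) - k(k+1)) = 1 / ((j-k)(j+k+1)) over n <= j <= m, j <> k. *)
Definition pf_coef (n m k : nat) : C :=
  (2 * INR k + 1) * ((-1) ^ k * (-1) ^ n) * cfact (n + k) * inv_fact_sub k n * inv_fact_sub m k
    / cfact (S (m + k)).

Lemma m1_pow_sqr n : (-1) ^ n * (-1) ^ n = RtoC 1.
Proof.
induction n as [|n IH]; simpl; [ring|].
transitivity ((-1) ^ n * (-1) ^ n); [ring | exact IH].
Qed.

(** The expansion is O((ab)^(-2)) at infinity as soon as it has at least two poles.  The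
    direct proof telescopes. *)
Lemma pf_coef_sum_0 n m : (n < m)%nat -> csum (pf_coef n m) (S m) = 0.
Proof.
intros Hn.
assert (Hd : INR m - INR n <> 0).
{ rewrite <- RtoC_minus; apply RtoC_neq; apply lt_INR in Hn; lra. }
set (G := fun k => - / (INR m - INR n) * ((-1) ^ k * (-1) ^ n * cfact (n + k)
  * ((INR k - INR n) * inv_fact_sub k n) * inv_fact_sub m k / cfact (m + k))).
rewrite csum_telescope with (G := G).
- unfold G; rewrite (inv_fact_sub_0 m (S m)) by lia.
  destruct n as [|n]; [simpl INR | rewrite (inv_fact_sub_0 0 (S n)) by lia];
    unfold Cdiv; ring.
- intros k _; unfold G, pf_coef.
  rewrite (RtoC_INR_S k), (inv_fact_sub_Sl k n), <- (inv_fact_sub_Sr m k).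
  replace (n + S k)%nat with (S (n + k)) by lia.
  replace (m + S k)%nat with (S (m + k)) by lia.
  rewrite !cfact_S, !plus_INR, !RtoC_plus; simpl Cpow.
  assert (X := cfact_neq0 (m + k)); assert (Y := INR_1_neq0 (m + k)).
  rewrite plus_INR, RtoC_plus in Y; field; repeat split; trivial.
Qed.

(** Induction on m: multiplication by (m+1+a)(m+1+b) = (k+a)(k+b) + (m+1-k)(m+k+2)
    produces the expansion for m plus the sum of the residues. *)
Lemma partial_fractions a b n m : a + b = 1 -> nonint a -> nonint b -> (n <= m)%nat ->
  csum (fun k => pf_coef n m k / ((INR k + a) * (INR k + b))) (S m)
  = poch a n * poch b n / (poch a (S m) * poch b (S m)).
Proof.
intros Hab Ha Hb Hn; induction Hn as [|m Hn IH].
- simpl csum; rewrite csum_0.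
  2: { intros k Hk; unfold pf_coef; rewrite (inv_fact_sub_0 k n) by lia; unfold Cdiv; ring. }
  unfold pf_coef; rewrite inv_fact_sub_diag, cfact_S, !poch_S, plus_INR, RtoC_plus.
  rewrite m1_pow_sqr.
  assert (P1 := poch_nonint a n Ha); assert (P2 := poch_nonint b n Hb).
  assert (Q1 := nonint_nat a n Ha); assert (Q2 := nonint_nat b n Hb).
  assert (X := cfact_neq0 (n + n)); assert (Y := INR_1_neq0 (n + n)).
  rewrite plus_INR, RtoC_plus in Y.
  field; repeat split; trivial; now rewrite Cplus_comm.
- assert (Q1 := nonint_nat a (S m) Ha); assert (Q2 := nonint_nat b (S m) Hb).
  assert (P1 := poch_nonint a (S m) Ha); assert (P2 := poch_nonint b (S m) Hb).
  rewrite (poch_S a (S m)), (poch_S b (S m)).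
  apply Cmult_reg_l with ((a + INR (S m)) * (b + INR (S m))); [now apply Cmult_neq_0|].
  transitivity (poch a n * poch b n / (poch a (S m) * poch b (S m)));
    [|field; repeat split; trivial].
  rewrite <- IH, <- csum_scal.
  rewrite (csum_ext _ (fun k => pf_coef n (S m) k + pf_coef n m k / ((INR k + a) * (INR k + b)))).
  + rewrite csum_plus, pf_coef_sum_0 by lia; rewrite Cplus_0_l.
    apply csum_stable; [lia|].
    intros k Hk; unfold pf_coef; rewrite (inv_fact_sub_0 m k) by lia; unfold Cdiv; ring.
  + intros k _; unfold pf_coef; rewrite <- (inv_fact_sub_Sl m k).
    change (S m + k)%nat with (S (m + k)).
    rewrite (cfact_S (S (m + k))), ?RtoC_INR_S, plus_INR, RtoC_plus.
    assert (R1 := nonint_nat' a k Ha); assert (R2 := nonint_nat' b k Hb).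
    assert (X := cfact_neq0 (S (m + k))); assert (Y := INR_1_neq0 (S (m + k))).
    rewrite RtoC_INR_S, plus_INR, RtoC_plus in Y.
    assert (Eb : b = 1 - a) by (rewrite <- Hab; ring); rewrite Eb in *.
    field; repeat split; trivial.
Qed.


Definition weight (a b : C) (k : nat) : C :=
  (2 * INR k + 1) * (-1) ^ k / ((INR k + a) * (INR k + b)).

Definition pair_term (a b : C) (al be : nat -> C) (n m : nat) : C :=
  poch a n * poch b n * al n * (be m / (poch a (S m) * poch b (S m))).

Lemma csum_scal_r a f n : csum (fun i => f i * a) n = csum f n * a.
Proof. rewrite Cmult_comm, <- csum_scal; apply csum_ext; intros; ring. Qed.

(** The triangular sum up to M involves only the poles k < M, so the exchange of the
    summations is finite. *)
Lemma tri_sum_spectral a b al be M : a + b = 1 -> nonint a -> nonint b ->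
  tri_sum (pair_term a b al be) M
  = csum (fun k => weight a b k * csum (left_term al k) (S k) * csum (right_term be k) M) M.
Proof.
intros Hab Ha Hb; unfold tri_sum.
transitivity (csum (fun m => csum (fun n => csum (fun k =>
  weight a b k * left_term al k n * right_term be k m) M) M) M).
- apply csum_ext; intros m Hm.
  rewrite (csum_stable (fun n => csum (fun k => weight a b k * left_term al k n * right_term be k m) M)
    (S m) M); [| lia |].
  2: { intros n Hn; apply csum_0; intros k _; unfold left_term, right_term.
       destruct (Nat.le_gt_cases n k) as [H|H].
       - rewrite (inv_fact_sub_0 m k) by lia; unfold Cdiv; ring.
       - rewrite (inv_fact_sub_0 k n) by lia; unfold Cdiv; ring. }
  apply csum_ext; intros n Hn; unfold pair_term.
  transitivity (al n * be m * (poch a n * poch b n / (poch a (S m) * poch b (S m))));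
    [unfold Cdiv; ring|].
  rewrite <- partial_fractions by (trivial; lia).
  rewrite (csum_stable (fun k => weight a b k * left_term al k n * right_term be k m) (S m) M);
    [| lia | intros k Hk; unfold right_term; rewrite (inv_fact_sub_0 m k) by lia; unfold Cdiv; ring].
  rewrite <- csum_scal; apply csum_ext; intros k _.
  unfold weight, left_term, right_term, pf_coef, Cdiv; ring.
- rewrite (csum_ext _ (fun m => csum (fun k => csum (fun n =>
    weight a b k * left_term al k n * right_term be k m) M) M)) by (intros; apply csum_swap).
  rewrite csum_swap; apply csum_ext; intros k Hk.
  rewrite <- csum_scal; apply csum_ext; intros m _.
  rewrite csum_scal_r, csum_scal; f_equal; f_equal.
  apply csum_stable; [lia|].
  intros n Hn; unfold left_term; rewrite inv_fact_sub_0 by lia; ring.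
Qed.


Lemma alpha_S d e c n : nonint d -> nonint e ->
  alpha d e c (S n) * ((INR n + 1) * (INR n + d) * (INR n + (1 + e)))
  = alpha d e c n * (INR n + c).
Proof.
intros Hd He; unfold alpha; rewrite cfact_S, !poch_S, RtoC_INR_S.
assert (P1 := poch_nonint d n Hd); assert (P2 := poch_nonint e n He).
assert (Q1 := nonint_nat d n Hd); assert (Q2 := nonint_nat e n He).
assert (Q3 := nonint_nat e (S n) He); rewrite RtoC_INR_S in Q3.
assert (X := cfact_neq0 n); assert (Y := INR_1_neq0 n).
field; repeat split; trivial.
Qed.

Lemma beta_S d e c m : nonint c ->
  beta d e c (S m) * (INR m + (1 + c))
  = beta d e c m * ((INR m + 1) * (INR m + (1 + d)) * (INR m + e)).
Proof.
intros Hc; unfold beta; rewrite cfact_S, !poch_S, RtoC_INR_S.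
assert (P1 := poch_nonint c m Hc); assert (Q1 := nonint_nat c m Hc).
assert (Q3 := nonint_nat c (S m) Hc); rewrite RtoC_INR_S in Q3.
field; repeat split; trivial.
Qed.

(** The factor depending on n has order n^(-Re c - 1) and the one depending on m has order
    m^(Re c' - 2).  Writing Re c' = 1 - theta, an increasing factor of order zeta moved
    from n to m makes both exponents less than -1: one needs
    eta < Re c + zeta and eta + zeta < theta, which zeta = theta - 2 eta with a small eta
    satisfies. *)
Lemma pair_term_abs a b d e c d' e' c' : a + b = 1 -> nonint a -> nonint b ->
  nonint d -> nonint e -> nonint c' ->
  d + e = 2 * c -> d' + e' = 2 * c' -> (Re c' <= Re c)%R -> (Re c' < 1)%R ->
  exists B, forall M,
    (tri_rsum (fun n m => Cmod (pair_term a b (alpha d e c) (beta d' e' c') n m)) M <= B)%R.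
Proof.
intros Hab Ha Hb Hd He Hc' Hs Hs' Hle Hlt.
assert (HR : (Re d + Re e = 2 * Re c)%R).
{ apply (f_equal Re) in Hs; unfold Re in *; simpl in Hs; lra. }
assert (HR' : (Re d' + Re e' = 2 * Re c')%R).
{ apply (f_equal Re) in Hs'; unfold Re in *; simpl in Hs'; lra. }
assert (HRa : (Re a + Re b = 1)%R).
{ apply (f_equal Re) in Hab; unfold Re in *; simpl in Hab; lra. }
(* theta > 0; eta <= theta/4 and eta <= 1/4 give room in all inequalities below *)
set (theta := (1 - Re c')%R); set (eta := (Rmin theta 1 / 4)%R).
set (zeta := (theta - 2 * eta)%R).
assert (Ht : (0 < theta)%R) by (unfold theta; lra).
assert (He1 : (0 < eta)%R) by (unfold eta; assert (X := Rmin_glb_lt theta 1 0 Ht Rlt_0_1); lra).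
assert (He2 : (4 * eta <= theta)%R) by (unfold eta; assert (X := Rmin_l theta 1); lra).
assert (He3 : (4 * eta <= 1)%R) by (unfold eta; assert (X := Rmin_r theta 1); lra).
assert (Hz : (0 <= zeta)%R) by (unfold zeta; lra).
assert (Hy : forall n, (0 < rise_gap eta n)%R) by (intros; now apply rise_gap_pos).
assert (Hzp : forall n, (0 < rise zeta n)%R) by (intros; now apply rise_pos).
destruct (lin_dominated (fun n => poch a n * poch b n * alpha d e c n)
  (fun n => (rise_gap eta n * rise zeta n)%R)
  [a; b; c] [RtoC 1; d; 1 + e] [RtoC 1; RtoC (1 + zeta)] [RtoC (2 + eta); RtoC 1] O)
  as [K1 [HK1 B1]].
{ intros n; now apply Rmult_lt_0_compat. }
{ intros n _; simpl lin; rewrite !poch_S.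
  transitivity (poch a n * (a + INR n) * (poch b n * (b + INR n)) *
    (alpha d e c (S n) * ((INR n + 1) * (INR n + d) * (INR n + (1 + e))))); [ring|].
  rewrite alpha_S by trivial; ring. }
{ intros n _; rewrite !RtoC_mult.
  assert (E1 := rise_gap_ratio eta n He1); assert (E2 := rise_ratio zeta n); simpl lin in *.
  rewrite Cmult_1_r in E1, E2.
  transitivity ((rise_gap eta (S n) * (INR n + RtoC (2 + eta))) * (rise zeta (S n) * (INR n + 1)));
    [ring|].
  rewrite Cmult_1_r in E1, E2.
  rewrite E1, E2; ring. }
{ reflexivity. }
{ unfold zeta, theta in *; simpl; unfold Re in *; simpl; lra. }
destruct (lin_dominated (fun m => beta d' e' c' m / (poch a (S m) * poch b (S m)))
  (fun n => (rise_gap eta n * / rise zeta n)%R)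
  [RtoC 1; 1 + d'; e'] [1 + c'; 1 + a; 1 + b]
  [RtoC 1; RtoC 1] [RtoC (2 + eta); RtoC (1 + zeta)] O)
  as [K2 [HK2 B2]].
{ intros n; apply Rmult_lt_0_compat; trivial; now apply Rinv_0_lt_compat. }
{ intros n _; simpl lin; rewrite (poch_S a (S n)), (poch_S b (S n)), RtoC_INR_S.
  assert (P1 := poch_nonint a (S n) Ha); assert (P2 := poch_nonint b (S n) Hb).
  assert (Q1 := nonint_nat a (S n) Ha); assert (Q2 := nonint_nat b (S n) Hb).
  rewrite RtoC_INR_S in Q1, Q2.
  transitivity (beta d' e' c' (S n) * (INR n + (1 + c')) / (poch a (S n) * poch b (S n)));
    [field; repeat split; trivial|].
  rewrite beta_S by trivial; field; split; trivial. }
{ intros n _; rewrite !RtoC_mult, !RtoC_inv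
    by (assert (X := Hzp n); assert (Y := Hzp (S n)); lra).
  assert (Z1 : RtoC (rise zeta n) <> 0) by (apply RtoC_neq; assert (X := Hzp n); lra).
  assert (Z2 : RtoC (rise zeta (S n)) <> 0) by (apply RtoC_neq; assert (X := Hzp (S n)); lra).
  assert (E1 := rise_gap_ratio eta n He1); assert (E2 := rise_ratio zeta n); simpl lin in *.
  rewrite !Cmult_1_r in E1, E2.
  apply Cmult_reg_l with (rise zeta n * rise zeta (S n)); [now apply Cmult_neq_0|].
  transitivity ((rise_gap eta (S n) * (INR n + RtoC (2 + eta)))
    * (rise zeta n * (INR n + RtoC (1 + zeta))));
    [field; trivial|].
  rewrite E1.
  transitivity (rise_gap eta n * (INR n + 1) * (rise zeta n * (INR n + RtoC (1 + zeta)))); [ring|].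
  rewrite <- E2; field; trivial. }
{ reflexivity. }
{ unfold zeta, theta in *; simpl; unfold Re in *; simpl; lra. }
exists (K1 * K2)%R; intros M; unfold tri_rsum.
apply Rle_trans with (rsum (fun m => (K1 * K2 * rise_gap eta m)%R) M).
- apply rsum_le; intros m _.
  apply Rle_trans with (rsum (fun n => (K1 * K2 * rise_gap eta m * rise_gap eta n)%R) (S m)).
  + apply rsum_le; intros n Hn; unfold pair_term; rewrite Cmod_mult.
    assert (Hm : (rise zeta n <= rise zeta m)%R) by (apply rise_le; trivial; lia).
    eapply Rle_trans; [apply Rmult_le_compat; [apply Cmod_ge_0 | apply Cmod_ge_0
      | apply B1 | apply B2]|].
    replace (K1 * (rise_gap eta n * rise zeta n) * (K2 * (rise_gap eta m * / rise zeta m)))%R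
      with (K1 * K2 * rise_gap eta m * rise_gap eta n * (rise zeta n / rise zeta m))%R
      by (field; assert (X := Hzp m); lra).
    rewrite <- (Rmult_1_r (K1 * K2 * rise_gap eta m * rise_gap eta n)) at 2.
    apply Rmult_le_compat_l.
    * assert (X := Hy n); assert (Y := Hy m).
      repeat (apply Rmult_le_pos; [|lra]); lra.
    * apply Rmult_le_reg_r with (rise zeta m); trivial.
      unfold Rdiv; rewrite Rmult_assoc, Rinv_l; [lra|]; assert (X := Hzp m); lra.
  + rewrite rsum_scal; assert (X := rise_gap_sum eta (S m) He1); assert (Y := Hy m).
    rewrite <- (Rmult_1_r (K1 * K2 * rise_gap eta m)) at 2.
    apply Rmult_le_compat_l; trivial.
    repeat (apply Rmult_le_pos; [|lra]); lra.
- rewrite rsum_scal; assert (X := rise_gap_sum eta M He1).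
  rewrite <- (Rmult_1_r (K1 * K2)) at 2.
  apply Rmult_le_compat_l; trivial; apply Rmult_le_pos; lra.
Qed.


(** (s + K) (s + K + 1) ... (s + m - 1), started at K so that all factors are positive
    even when s is negative. *)
Fixpoint delayed_rise (K : nat) (s : R) (m : nat) : R :=
  match m with
  | O => 1%R
  | S j => if (K <=? j)%nat then (delayed_rise K s j * (INR j + s))%R else delayed_rise K s j
  end.

Lemma delayed_rise_S K s m : (K <= m)%nat -> 
  delayed_rise K s (S m) = (delayed_rise K s m * (INR m + s))%R.
Proof. intros H; simpl; apply Nat.leb_le in H; now rewrite H. Qed.

Lemma delayed_rise_pos K s m : (0 < INR K + s)%R -> (0 < delayed_rise K s m)%R.
Proof.
intros Hs; induction m as [|m IH]; [simpl; lra|].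
destruct (Nat.le_gt_cases K m) as [H|H].
- rewrite delayed_rise_S by trivial; apply Rmult_lt_0_compat; trivial.
  apply le_INR in H; lra.
- simpl; apply Nat.leb_gt in H; now rewrite H.
Qed.

(** The Watson summand with [beta] m replaced by m! (s)_m up to a constant: positive, and
    such that the sum over m still satisfies a first-order recurrence in k. *)
Definition watson_majorant (K : nat) (s : R) (k m : nat) : R :=
  (INR (fact m) * delayed_rise K s m * Cmod (inv_fact_sub m k) / INR (fact (S (m + k))))%R.

Lemma Cmod_inv_fact_sub_0 m k : (m < k)%nat -> Cmod (inv_fact_sub m k) = 0%R.
Proof. intros H; rewrite inv_fact_sub_0 by trivial; apply Cmod_0. Qed.

Lemma Cmod_inv_fact_sub_Sl m k :
  ((INR m + 1 - INR k) * Cmod (inv_fact_sub (S m) k))%R = Cmod (inv_fact_sub m k).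
Proof.
destruct (Nat.le_gt_cases k (S m)) as [H|H].
- rewrite <- (inv_fact_sub_Sl m k), Cmod_mult; f_equal.
  rewrite <- RtoC_plus, <- RtoC_minus, Cmod_R, Rabs_pos_eq; trivial.
  apply le_INR in H; rewrite S_INR in H; lra.
- rewrite !Cmod_inv_fact_sub_0 by lia; ring.
Qed.

Lemma Cmod_inv_fact_sub_Sr m k :
  ((INR m - INR k) * Cmod (inv_fact_sub m k))%R = Cmod (inv_fact_sub m (S k)).
Proof.
destruct (Nat.le_gt_cases k m) as [H|H].
- rewrite <- (inv_fact_sub_Sr m k), Cmod_mult; f_equal.
  rewrite <- RtoC_minus, Cmod_R, Rabs_pos_eq; trivial.
  apply le_INR in H; lra.
- rewrite !Cmod_inv_fact_sub_0 by lia; ring.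
Qed.

Lemma INR_fact_S n : INR (fact (S n)) = ((INR n + 1) * INR (fact n))%R.
Proof. rewrite fact_simpl, mult_INR, S_INR; ring. Qed.

Lemma watson_majorant_telescopes K s k M : (K <= k)%nat ->
  ((INR k + 2 - s) * rsum (watson_majorant K s (S k)) M
    - (INR k + s) * rsum (watson_majorant K s k) M
  = -2 * (INR (fact M) * delayed_rise K s M * ((INR M - INR k) * Cmod (inv_fact_sub M k))
      / INR (fact (S (M + k)))))%R.
Proof.
intros HK; induction M as [|M IH].
- simpl rsum; rewrite Cmod_inv_fact_sub_Sr, Cmod_inv_fact_sub_0 by lia; unfold Rdiv; ring.
- simpl rsum.
  match goal with |- (_ * (?x + ?y) - _ * (?z + ?t) = _)%R =>
    transitivity ((INR k + 2 - s) * x - (INR k + s) * z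
      + ((INR k + 2 - s) * y - (INR k + s) * t))%R; [ring|] end.
  rewrite IH; unfold watson_majorant.
  replace (M + S k)%nat with (S (M + k)) by lia.
  change (S M + k)%nat with (S (M + k)).
  rewrite (S_INR M), Cmod_inv_fact_sub_Sl, <- (Cmod_inv_fact_sub_Sr M k).
  rewrite !INR_fact_S, ?S_INR, plus_INR.
  assert (X := INR_fact_lt_0 (M + k)); assert (Y := pos_INR M); assert (Z := pos_INR k).
  destruct (Nat.le_gt_cases k M) as [H|H].
  + rewrite delayed_rise_S by lia; field; repeat split; lra.
  + rewrite (Cmod_inv_fact_sub_0 M k) by trivial; field; repeat split; lra.
Qed.

Lemma watson_majorant_pos K s k m : (0 < INR K + s)%R -> (0 <= watson_majorant K s k m)%R.
Proof.
intros Hs; unfold watson_majorant; apply Rmult_le_pos.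
- apply Rmult_le_pos; [|apply Cmod_ge_0].
  apply Rmult_le_pos; [apply pos_INR | left; now apply delayed_rise_pos].
- left; apply Rinv_0_lt_compat, INR_fact_lt_0.
Qed.

(** The boundary term has a definite sign, so it can be dropped: the inequality holds for
    every truncation M with the same factor. *)
Lemma watson_majorant_step K s k M : (K <= k)%nat -> (0 < INR K + s)%R -> (0 < INR k + 2 - s)%R ->
  ((INR k + 2 - s) * rsum (watson_majorant K s (S k)) M
    <= (INR k + s) * rsum (watson_majorant K s k) M)%R.
Proof.
intros HK Hs H2; assert (H := watson_majorant_telescopes K s k M HK).
rewrite Cmod_inv_fact_sub_Sr in H.
assert (0 <= INR (fact M) * delayed_rise K s M
  * Cmod (inv_fact_sub M (S k)) / INR (fact (S (M + k))))%R; [|lra].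
apply Rmult_le_pos.
- apply Rmult_le_pos; [|apply Cmod_ge_0].
  apply Rmult_le_pos; [apply pos_INR | left; now apply delayed_rise_pos].
- left; apply Rinv_0_lt_compat, INR_fact_lt_0.
Qed.

Lemma watson_majorant_summable K s k : (0 < INR K + s)%R -> (s < 1)%R ->
  exists B, (0 < B)%R /\ forall M, (rsum (watson_majorant K s k) M <= B)%R.
Proof.
intros Hs H1.
destruct (lin_summable (fun m => RtoC (watson_majorant K s k m)) [RtoC 1; RtoC s]
  [RtoC (1 - INR k); RtoC (INR k + 2)] K) as [B [HB0 HB]].
- intros m Hm; simpl lin; rewrite !Cmult_1_r, <- !RtoC_plus, <- !RtoC_mult; f_equal.
  unfold watson_majorant; rewrite delayed_rise_S by trivial.
  change (S m + k)%nat with (S (m + k)).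
  rewrite !INR_fact_S, ?S_INR, plus_INR, <- (Cmod_inv_fact_sub_Sl m k).
  assert (X := INR_fact_lt_0 (m + k)); assert (Y := pos_INR m); assert (Z := pos_INR k).
  field; repeat split; lra.
- reflexivity.
- simpl; lra.
- exists B; split; trivial; intros M.
  eapply Rle_trans; [|apply (HB M)]; right; apply rsum_ext; intros i _.
  rewrite Cmod_R, Rabs_pos_eq; trivial; now apply watson_majorant_pos.
Qed.

(** [beta] m / m! has the order of m! m^(Re c - 1) and (s)_m that of m! m^(s - 1), so
    s > Re c leaves room for [lin_eventually_le]. *)
Lemma watson_majorised d e c s : nonint c ->
  (Re d + Re e = 2 * Re c)%R -> (Re c < s)%R ->
  exists K B, (0 < INR K + s)%R /\ (0 < B)%R /\
    forall k M, (Cmod (csum (right_term (beta d e c) k) M) <= B * rsum (watson_majorant K s k) M)%R.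
Proof.
intros Hc HR Hs.
destruct (lin_eventually_le [1 + d; e] [1 + c; RtoC s]) as [K1 HK1].
{ reflexivity. }
{ simpl; unfold Re in *; simpl; lra. }
destruct (INR_eventually (- s)) as [K2 HK2].
set (K := max K1 K2); assert (HKs : (0 < INR K + s)%R).
{ specialize (HK2 K ltac:(lia)); lra. }
assert (Hf : forall m, (Cmod (beta d e c m / cfact m) = Cmod (beta d e c m) / INR (fact m))%R).
{ intros m; rewrite Cmod_div by apply cfact_neq0; unfold cfact; rewrite Cmod_R, Rabs_pos_eq
    by apply pos_INR; trivial. }
destruct (ratio_dominated (fun m => beta d e c m / cfact m) (delayed_rise K s) K) as [B [HB0 HB]].
{ intros; now apply delayed_rise_pos. }
{ intros m Hm; rewrite delayed_rise_S by trivial.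
  specialize (HK1 m ltac:(lia)); simpl lin in HK1.
  rewrite !Cmult_1_r, !Cmod_mult, <- RtoC_plus, (Cmod_R (INR m + s)) in HK1.
  assert (Hms : (0 < INR m + s)%R) by (apply le_INR in Hm; lra).
  rewrite (Rabs_pos_eq (INR m + s)) in HK1 by lra.
  assert (Hc1 : (0 < Cmod (INR m + (1 + c)))%R).
  { apply -> Cmod_gt_0; replace (INR m + (1 + c)) with (INR m + 1 + c) by ring.
    now apply nonint_nat_1. }
  assert (E : beta d e c (S m) / cfact (S m) * (INR m + (1 + c))
    = beta d e c m / cfact m * ((INR m + (1 + d)) * (INR m + e))).
  { assert (X := cfact_neq0 m); assert (Y := INR_1_neq0 m).
    transitivity (beta d e c (S m) * (INR m + (1 + c)) / cfact (S m)); [unfold Cdiv; ring|].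
    rewrite beta_S, cfact_S by trivial; field; split; trivial. }
  apply (f_equal Cmod) in E; rewrite !Cmod_mult in E.
  set (x := Cmod (beta d e c (S m) / cfact (S m))) in *.
  set (y := Cmod (beta d e c m / cfact m)) in *.
  assert (Hy : (0 <= y)%R) by apply Cmod_ge_0.
  assert (Hu := delayed_rise_pos K s m HKs).
  apply Rmult_le_reg_r with (Cmod (INR m + (1 + c))); trivial.
  replace (x * delayed_rise K s m * Cmod (INR m + (1 + c)))%R
    with (delayed_rise K s m * (x * Cmod (INR m + (1 + c))))%R by ring.
  rewrite E.
  replace (y * (delayed_rise K s m * (INR m + s)) * Cmod (INR m + (1 + c)))%R
    with (delayed_rise K s m * (y * (Cmod (INR m + (1 + c)) * (INR m + s))))%R by ring.
  apply Rmult_le_compat_l; [lra|]; now apply Rmult_le_compat_l. }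
exists K, B; repeat split; trivial.
intros k M; eapply Rle_trans; [apply Cmod_csum|]; rewrite <- rsum_scal.
apply rsum_le; intros m _; unfold right_term, watson_majorant.
specialize (HB m); rewrite Hf in HB.
assert (X := INR_fact_lt_0 m); assert (Y := INR_fact_lt_0 (S (m + k))).
rewrite Cmod_div by apply cfact_neq0; rewrite Cmod_mult.
unfold cfact at 1; rewrite Cmod_R, Rabs_pos_eq by lra.
assert (HB' : (Cmod (beta d e c m) <= B * INR (fact m) * delayed_rise K s m)%R).
{ apply Rmult_le_reg_r with (/ INR (fact m))%R; [now apply Rinv_0_lt_compat|].
  replace (B * INR (fact m) * delayed_rise K s m * / INR (fact m))%R with (B * delayed_rise K s m)%R
    by (field; lra); exact HB. }
replace (B * (INR (fact m) * delayed_rise K s m * Cmod (inv_fact_sub m k) / INR (fact (S (m + k)))))%R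
  with (B * INR (fact m) * delayed_rise K s m * Cmod (inv_fact_sub m k) * / INR (fact (S (m + k))))%R
  by (unfold Rdiv; ring).
unfold Rdiv; apply Rmult_le_compat_r; [left; now apply Rinv_0_lt_compat|].
apply Rmult_le_compat_r; [apply Cmod_ge_0 | trivial].
Qed.

(** [whipple_value] has order k^(-2 sigma) and the majorant k^(2s-2), uniformly in M, hence
    the product has order below k^(-1) if s < sigma + 1/2.  The recurrence exchanges d and
    e, so both orders are bounded together. *)
Lemma whipple_watson_bound d e K s (sigma : R) : nonint d -> nonint e ->
  (Re d + Re e = 2 * sigma)%R -> (0 < INR K + s)%R -> (s < 1)%R -> (s < sigma + / 2)%R ->
  exists K1 B, (0 < B)%R /\ forall k M, (K1 <= k)%nat ->
    (Cmod (whipple_value d e k) * rsum (watson_majorant K s k) M * (INR k + 1) <= B)%R.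
Proof.
intros Hd He HR Hs H1 H2.
assert (Hstep : forall d e, nonint d -> nonint e -> (Re d + Re e = 2 * sigma)%R ->
  exists K1, forall k M, (K1 <= k)%nat ->
   (Cmod (whipple_value d e (S k)) * rsum (watson_majorant K s (S k)) M * (INR (S k) + 1)
    <= Cmod (whipple_value e d k) * rsum (watson_majorant K s k) M * (INR k + 1))%R).
{ clear d e Hd He HR; intros d e Hd He HR.
  destruct (lin_eventually_le [1 - d; RtoC s; RtoC 2] [1 + e; RtoC (2 - s); RtoC 1])
    as [K1 HK1]; [reflexivity | simpl; unfold Re in *; simpl; lra|].
  exists (max K K1); intros k M Hk.
  specialize (HK1 k ltac:(lia)); simpl lin in HK1.
  assert (Hk' : (INR K <= INR k)%R) by (apply le_INR; lia).
  assert (Hk0 := pos_INR k).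
  assert (Hr := watson_majorant_step K s k M ltac:(lia) Hs ltac:(lra)).
  rewrite !Cmult_1_r, !Cmod_mult, <- !RtoC_plus, !Cmod_R, !Rabs_pos_eq in HK1 by lra.
  simpl whipple_value; rewrite S_INR.
  assert (Hne : INR k + 1 + e <> 0) by now apply nonint_nat_1.
  rewrite Cmod_mult, Cmod_div, Cmod_opp by trivial.
  replace (INR k + (1 - d)) with (INR k + 1 - d) in HK1 by ring.
  replace (INR k + (1 + e)) with (INR k + 1 + e) in HK1 by ring.
  assert (Hep : (0 < Cmod (INR k + 1 + e))%R) by (apply -> Cmod_gt_0; trivial).
  set (p := Cmod (INR k + 1 - d)) in *; set (q := Cmod (INR k + 1 + e)) in *.
  assert (Hp : (0 <= p)%R) by apply Cmod_ge_0.
  set (h := Cmod (whipple_value e d k)); assert (Hh : (0 <= h)%R) by apply Cmod_ge_0.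
  set (R1 := rsum (watson_majorant K s (S k)) M) in *;
  set (R0 := rsum (watson_majorant K s k) M) in *.
  assert (HR0 : (0 <= R0)%R) by (apply rsum_ge0; intros; now apply watson_majorant_pos).
  clearbody p q h R1 R0.
  apply Rmult_le_reg_r with (q * (INR k + 2 - s))%R; [apply Rmult_lt_0_compat; lra|].
  replace (p / q * h * R1 * (INR k + 1 + 1) * (q * (INR k + 2 - s)))%R
    with (p * h * (INR k + 2) * ((INR k + 2 - s) * R1))%R by (field; lra).
  apply Rle_trans with (p * h * (INR k + 2) * ((INR k + s) * R0))%R.
  { apply Rmult_le_compat_l; trivial; repeat (apply Rmult_le_pos; [|lra]); lra. }
  replace (p * h * (INR k + 2) * ((INR k + s) * R0))%R
    with (h * R0 * (p * ((INR k + s) * (INR k + 2))))%R by ring.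
  replace (h * R0 * (INR k + 1) * (q * (INR k + 2 - s)))%R
    with (h * R0 * (q * ((INR k + (2 - s)) * (INR k + 1))))%R by ring.
  apply Rmult_le_compat_l; trivial; now apply Rmult_le_pos. }
destruct (Hstep d e Hd He HR) as [K1 HK1].
destruct (Hstep e d He Hd ltac:(lra)) as [K2 HK2].
set (K3 := max K1 K2).
destruct (watson_majorant_summable K s K3 Hs H1) as [B0 [HB0 HB]].
set (X := (Cmod (whipple_value d e K3) + Cmod (whipple_value e d K3))%R).
assert (HX1 := Cmod_ge_0 (whipple_value d e K3)); assert (HX2 := Cmod_ge_0 (whipple_value e d K3)).
assert (H3 := pos_INR K3).
exists K3, (X * B0 * (INR K3 + 1) + 1)%R; split.
{ assert (0 <= X * B0 * (INR K3 + 1))%R; [|lra].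
  unfold X; repeat (apply Rmult_le_pos; [|lra]); lra. }
intros k M Hk.
assert (Hboth : (Cmod (whipple_value d e k) * rsum (watson_majorant K s k) M * (INR k + 1)
    <= X * B0 * (INR K3 + 1))%R
  /\ (Cmod (whipple_value e d k) * rsum (watson_majorant K s k) M * (INR k + 1) <= X * B0 * (INR K3 + 1))%R).
{ induction Hk as [|k Hk [I1 I2]].
  - specialize (HB M).
    assert (0 <= rsum (watson_majorant K s K3) M)%R
      by (apply rsum_ge0; intros; now apply watson_majorant_pos).
    split; apply Rmult_le_compat_r; try lra; apply Rmult_le_compat; unfold X; lra.
  - specialize (HK1 k M ltac:(unfold K3 in *; lia)).
    specialize (HK2 k M ltac:(unfold K3 in *; lia)).
    split; lra. }
lra.
Qed.

(** |weight| has order 1/k, compared with k times a sequence of order k^(-3/2). *)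
Lemma weight_bound a b : a + b = 1 -> nonint a -> nonint b ->
  exists B, (0 < B)%R /\ forall k,
    (Cmod (weight a b k) <= B * rise_gap (/ 2) k * (INR k + 1))%R.
Proof.
intros Hab Ha Hb.
destruct (lin_dominated
  (fun k => (INR k + 1 / 2) / ((INR k + a) * (INR k + b) * (INR k + 1))) (rise_gap (/ 2))
  [1 + 1 / 2; a; b; RtoC 1] [1 + a; 1 + b; RtoC 2; 1 / 2]
  [RtoC 1] [RtoC (2 + / 2)] O) as [B [HB0 HB]].
- intros; apply rise_gap_pos; lra.
- intros k _; simpl lin; rewrite RtoC_INR_S.
  assert (Q1 := nonint_nat' a k Ha); assert (Q2 := nonint_nat' b k Hb).
  assert (Q3 := nonint_nat_1 a k Ha); assert (Q4 := nonint_nat_1 b k Hb).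
  assert (X := INR_1_neq0 k); assert (Y := INR_1_neq0 (S k)); rewrite RtoC_INR_S in Y.
  field; repeat split; trivial.
- intros k _; apply rise_gap_ratio; lra.
- reflexivity.
- simpl; unfold Re in *; simpl; lra.
- exists (2 * B)%R; split; [lra|]; intros k; specialize (HB k); cbv beta in HB.
  assert (Q1 := nonint_nat' a k Ha); assert (Q2 := nonint_nat' b k Hb).
  assert (X := INR_1_neq0 k); assert (Hk := pos_INR k).
  replace (weight a b k) with (2 * (-1) ^ k *
    ((INR k + 1 / 2) / ((INR k + a) * (INR k + b) * (INR k + 1))) * (INR k + 1))
    by (unfold weight; field; repeat split; trivial).
  set (q := (INR k + 1 / 2) / _) in *; clearbody q.
  rewrite !Cmod_mult, Cmod_pow, !Cmod_R, <- RtoC_plus, Cmod_R, (Rabs_pos_eq (INR k + 1)) by lra.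
  replace (Rabs (-1)) with 1%R by (rewrite Rabs_left; lra).
  rewrite pow1, (Rabs_pos_eq 2) by lra.
  apply Rmult_le_compat_r; lra.
Qed.

(** The two parameter triples are independent so that the lemma covers both identities.
    The proof chooses s with Re c' < s < min(1, Re c' + 1/2) to have room both for
    [watson_majorised] and for [whipple_watson_bound]. *)
Theorem double_sum a b d e c d' e' c' : a + b = 1 -> nonint a -> nonint b ->
  nonint d -> nonint e -> nonint d' -> nonint e' -> nonint c' ->
  d + e = 2 * c -> d' + e' = 2 * c' -> (Re c' <= Re c)%R -> (Re c' < 1)%R ->
  let V := Csin (PI * (d' - c')) / Csin (PI * c') in
  exists S, Clim (csum (fun k => weight a b k * whipple_value d e k * watson_value d' e' V k)) S /\
    tri_summable (pair_term a b (alpha d e c) (beta d' e' c')) S.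
Proof.
intros Hab Ha Hb Hd He Hd' He' Hc' Hs Hs' Hle Hlt V.
assert (HR : (Re d + Re e = 2 * Re c)%R).
{ apply (f_equal Re) in Hs; unfold Re in *; simpl in Hs; lra. }
assert (HR' : (Re d' + Re e' = 2 * Re c')%R).
{ apply (f_equal Re) in Hs'; unfold Re in *; simpl in Hs'; lra. }
set (s := ((Re c' + Rmin 1 (Re c' + / 2)) / 2)%R).
assert (Hs1 : (Re c' < s)%R).
{ unfold s; assert (Re c' < Rmin 1 (Re c' + / 2))%R by (apply Rmin_glb_lt; lra); lra. }
assert (Hs2 : (s < 1)%R) by (unfold s in *; assert (X := Rmin_l 1 (Re c' + / 2)); lra).
assert (Hs3 : (s < Re c + / 2)%R)
  by (unfold s in *; assert (X := Rmin_r 1 (Re c' + / 2)); lra).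
destruct (watson_majorised d' e' c' s Hc' HR' Hs1) as [K [B1 [HK [HB1 HW]]]].
destruct (whipple_watson_bound d e K s (Re c) Hd He HR HK Hs2 Hs3) as [K1 [B2 [HB2 Hwh]]].
destruct (weight_bound a b Hab Ha Hb) as [B3 [HB3 Hw]].
destruct (tannery (fun M k => weight a b k * whipple_value d e k * csum (watson_term d' e' c' k) M)
  (fun k => weight a b k * whipple_value d e k * watson_value d' e' V k)
  (fun k => (B1 * B2 * B3 * rise_gap (/ 2) k)%R) (B1 * B2 * B3)%R K1)
  as [S [HS1 HS2]].
- intros k; apply Clim_scal; now apply watson.
- intros M k Hk; rewrite !Cmod_mult.
  specialize (HW k M); specialize (Hwh k M Hk); specialize (Hw k).
  change (csum (watson_term d' e' c' k) M) with (csum (right_term (beta d' e' c') k) M).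
  set (x := Cmod (weight a b k)) in *; set (y := Cmod (whipple_value d e k)) in *.
  set (z := Cmod (csum (right_term (beta d' e' c') k) M)) in *.
  set (r := rsum (watson_majorant K s k) M) in *; set (D := rise_gap (/ 2) k) in *.
  assert (Hx : (0 <= x)%R) by apply Cmod_ge_0.
  assert (Hy : (0 <= y)%R) by apply Cmod_ge_0.
  assert (HD : (0 < D)%R) by (apply rise_gap_pos; lra).
  assert (Hr : (0 <= r)%R) by (apply rsum_ge0; intros; now apply watson_majorant_pos).
  assert (Hk0 := pos_INR k).
  apply Rle_trans with (B3 * D * (INR k + 1) * y * (B1 * r))%R.
  + apply Rmult_le_compat; trivial; [now apply Rmult_le_pos | apply Cmod_ge_0 |].
    now apply Rmult_le_compat_r.
  + replace (B3 * D * (INR k + 1) * y * (B1 * r))%R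
      with (B1 * B3 * D * (y * r * (INR k + 1)))%R by ring.
    replace (B1 * B2 * B3 * D)%R with (B1 * B3 * D * B2)%R by ring.
    apply Rmult_le_compat_l; trivial; repeat (apply Rmult_le_pos; [|lra]); lra.
- intros k; assert (X := rise_gap_pos (/ 2) k ltac:(lra)); repeat (apply Rmult_le_pos; [|lra]); lra.
- intros n; rewrite rsum_scal; assert (X := rise_gap_sum (/ 2) n ltac:(lra)).
  rewrite <- (Rmult_1_r (B1 * B2 * B3)) at 2.
  apply Rmult_le_compat_l; trivial; repeat (apply Rmult_le_pos; [|lra]); lra.
- exists S; split; trivial.
  split; [|now apply pair_term_abs].
  apply Clim_ext with (2 := HS2); intros M.
  rewrite tri_sum_spectral by trivial; apply csum_ext; intros k _.
  change (left_term (alpha d e c) k) with (whipple_term d e c k).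
  now rewrite (whipple k d e c Hd He Hs).
Qed.

(** * The two identities *)

Lemma Cexp_plus z w : Cexp (z + w) = Cexp z * Cexp w.
Proof.
destruct z as [x y]; destruct w as [x' y']; unfold Cexp; simpl Re; simpl Im.
rewrite exp_plus, cos_plus, sin_plus; apply injective_projections; simpl; ring.
Qed.

Lemma Ccos_mult z w : Ccos z * Ccos w = (Ccos (z + w) + Ccos (z - w)) / 2.
Proof.
unfold Ccos.
replace (Ci * (z + w)) with (Ci * z + Ci * w) by ring.
replace (Ci * (z - w)) with (Ci * z + - (Ci * w)) by ring.
replace (- (Ci * z + Ci * w)) with (- (Ci * z) + - (Ci * w)) by ring.
replace (- (Ci * z + - (Ci * w))) with (- (Ci * z) + Ci * w) by ring.
rewrite !Cexp_plus; field; apply two_neq0.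
Qed.

Lemma Csin_minus_pi z : Csin (PI * (z - 1)) = - Csin (PI * z).
Proof.
unfold Csin.
replace (Ci * (PI * (z - 1))) with (Ci * (PI * z) + - (Ci * PI)) by ring.
replace (- (Ci * (PI * z) + - (Ci * PI))) with (- (Ci * (PI * z)) + Ci * PI) by ring.
rewrite !Cexp_plus.
assert (E1 : Cexp (Ci * PI) = - (1)).
{ unfold Cexp; simpl Re; simpl Im.
  replace (0 * PI - 1 * 0)%R with 0%R by ring; replace (0 * 0 + 1 * PI)%R with PI by ring.
  rewrite exp_0, cos_PI, sin_PI; apply injective_projections; simpl; ring. }
assert (E2 : Cexp (- (Ci * PI)) = - (1)).
{ unfold Cexp; simpl Re; simpl Im.
  replace (- (0 * PI - 1 * 0))%R with 0%R by ring.
  replace (- (0 * 0 + 1 * PI))%R with (- PI)%R by ring.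
  rewrite exp_0, cos_neg, sin_neg, cos_PI, sin_PI; apply injective_projections; simpl; ring. }
rewrite E1, E2; unfold Cdiv; ring.
Qed.

Lemma Csin_minus_nat_pi z n : Csin (PI * (z - INR n)) = (-1) ^ n * Csin (PI * z).
Proof.
induction n as [|n IH].
- simpl; rewrite Cmult_1_l; do 2 f_equal; ring.
- rewrite RtoC_INR_S; replace (z - (INR n + 1)) with (z - INR n - 1) by ring.
  rewrite Csin_minus_pi, IH; simpl; ring.
Qed.

(** The product formula turns the two cosines into a term of fixed sign and a term
    alternating with n, as in [whipple_watson_value]. *)
Lemma cos_cos_term c d e n : d + e = 2 * c + 1 ->
  (-1) ^ n * (Ccos (PI * (d - INR n) / 2) * Ccos (PI * (e - INR n) / 2))
  = (- Csin (PI * c) + (-1) ^ n * Ccos (PI * ((d - e) / 2))) / 2.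
Proof.
intros Hs; assert (T := two_neq0).
rewrite Ccos_mult.
replace (PI * (d - INR n) / 2 + PI * (e - INR n) / 2)
  with (PI * ((c + 1 - INR n) - 1 / 2)).
2: { replace (PI * (d - INR n) / 2 + PI * (e - INR n) / 2)
       with (PI * (d + e - 2 * INR n) / 2) by (field; trivial).
     rewrite Hs; field; trivial. }
replace (PI * (d - INR n) / 2 - PI * (e - INR n) / 2) with (PI * ((d - e) / 2))
  by (field; trivial).
rewrite Ccos_minus_half, Csin_minus_nat_pi.
assert (E := Csin_minus_pi (c + 1)); replace (c + 1 - 1) with c in E by ring.
rewrite E.
transitivity ((((-1) ^ n * (-1) ^ n) * Csin (PI * (c + 1))
  + (-1) ^ n * Ccos (PI * ((d - e) / 2))) / 2); [unfold Cdiv; ring|].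
rewrite m1_pow_sqr; unfold Cdiv; ring.
Qed.

Definition base_term (a b e : C) (k : nat) : C :=
  (2 * INR k + 1) / ((INR k + a) * (INR k + b) * ((INR k + e) * (INR k + 1 - e))).

(** The condition |z| = 1 covers the plain and the alternating series. *)
Lemma base_term_summable a b e (z : C) : a + b = 1 -> nonint a -> nonint b -> nonint e ->
  Cmod z = 1%R -> exists L, Clim (csum (fun k => z ^ k * base_term a b e k)) L.
Proof.
intros Hab Ha Hb He Hz; assert (T := two_neq0).
assert (HRa : (Re a + Re b = 1)%R).
{ apply (f_equal Re) in Hab; unfold Re in *; simpl in Hab; lra. }
destruct (lin_summable (base_term a b e) [1 + 1 / 2; a; b; e; 1 - e]
  [1 / 2; 1 + a; 1 + b; 1 + e; 2 - e] O) as [K [_ HK]].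
- intros k _; simpl lin; unfold base_term; rewrite RtoC_INR_S.
  assert (Q1 := nonint_nat' a k Ha); assert (Q2 := nonint_nat' b k Hb).
  assert (Q3 := nonint_nat_1 a k Ha); assert (Q4 := nonint_nat_1 b k Hb).
  assert (Q5 := nonint_nat' e k He); assert (Q6 := nonint_nat_1 e k He).
  assert (Q7 := nonint_sub_1 e k He); assert (Q8 := nonint_sub_2 e k He).
  replace (INR k + 2 - e) with (INR k + 1 + 1 - e) in Q8 by ring.
  field; repeat split; trivial.
- reflexivity.
- simpl; unfold Re in *; simpl; lra.
- apply Clim_csum_abs with K; intros n.
  eapply Rle_trans; [|apply (HK n)]; right; apply rsum_ext; intros k _.
  rewrite Cmod_mult, Cmod_pow, Hz, pow1; ring.
Qed.

Lemma spectral_term a b d e V k : nonint a -> nonint b -> nonint d -> nonint e ->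
  weight a b k * whipple_value d e k * watson_value d e V k
  = base_term a b e k + V * ((-1) ^ k * base_term a b e k).
Proof.
intros Ha Hb Hd He; assert (H := whipple_watson_value k d e V Hd He).
assert (Q1 := nonint_nat' a k Ha); assert (Q2 := nonint_nat' b k Hb).
assert (Q5 := nonint_nat' e k He); assert (Q7 := nonint_sub_1 e k He).
unfold weight, base_term.
transitivity ((2 * INR k + 1) / ((INR k + a) * (INR k + b))
  * ((-1) ^ k * whipple_value d e k * watson_value d e V k)); [field; split; trivial|].
rewrite H; field; repeat split; trivial.
Qed.

Lemma Clim_csum_ext (f : nat -> C) S g : Clim (csum f) S -> (forall n, f n = g n) -> Clim (csum g) S.
Proof.
intros H E; apply Clim_ext with (2 := H); intros n; apply csum_ext; auto.
Qed.

Lemma Cmod_RtoC_1 : Cmod 1 = 1%R /\ Cmod (-1) = 1%R.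
Proof. rewrite !Cmod_R; split; [apply Rabs_R1 | rewrite Rabs_left; lra]. Qed.

Lemma nonint_complement a b : a + b = 1 -> nonint a -> nonint b.
Proof.
intros H Ha; replace b with (- a + IZR 1) by (rewrite <- H; ring).
apply nonint_shift, nonint_opp; trivial.
Qed.

(** One of the two double sums whose difference is the left side of (ii). *)
Lemma half_double_sum a b c d e : a + b = 1 -> nonint a -> nonint c -> nonint d ->
  nonint e -> d + e = 2 * c -> (Re c < 1)%R ->
  exists L L', Clim (csum (base_term a b e)) L /\
    Clim (csum (fun k => (-1) ^ k * base_term a b e k)) L' /\
    tri_summable (pair_term a b (alpha d e c) (beta d e c))
      (L + Csin (PI * (d - c)) / Csin (PI * c) * L').
Proof.
intros Hab Ha Hc Hd He Hs Hr.
assert (Hb := nonint_complement a b Hab Ha).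
destruct (double_sum a b d e c d e c) as [S [HS HT]]; trivial; [lra|].
destruct (base_term_summable a b e 1 Hab Ha Hb He (proj1 Cmod_RtoC_1)) as [L HL].
destruct (base_term_summable a b e (-1) Hab Ha Hb He (proj2 Cmod_RtoC_1)) as [L' HL'].
exists L, L'; split; [|split]; trivial.
- apply Clim_csum_ext with (1 := HL); intros n; rewrite Cpow_1_l; ring.
- replace (L + Csin (PI * (d - c)) / Csin (PI * c) * L') with S; trivial.
  eapply Clim_unique; [exact HS|].
  apply Clim_ext with (fun M => csum (fun k => 1 ^ k * base_term a b e k) M
    + Csin (PI * (d - c)) / Csin (PI * c) * csum (fun k => (-1) ^ k * base_term a b e k) M).
  + intros M; rewrite <- csum_scal, <- csum_plus; apply csum_ext; intros k _.
    rewrite spectral_term, Cpow_1_l by trivial; ring.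
  + apply Clim_plus; trivial; now apply Clim_scal.
Qed.

Theorem theorem1p2 (a b c d e : C)
  (hc : (Re c < 1)%R)
  (ha : ~ is_integer a) (hcZ : ~ is_integer c)
  (hd : ~ is_integer d) (he : ~ is_integer e) :
  (a + b = 1 -> d + e = 2 * c + 1 ->
   exists T : C,
     is_Cseries (fun n =>
       ((-1) ^ n * (2 * INR n + 1)
          * Ccos (PI * (d - INR n) / 2) * Ccos (PI * (e - INR n) / 2))
       / ((INR n + a) * (INR n + b) * (INR n + d) * (INR n + 1 - d)
          * (INR n + e) * (INR n + 1 - e))) T /\
     is_sum_0_le_n_le_m (fun n m =>
       (pochs [a; b] n * poch c (n + 1)) / (cfact n * pochs [d; e] (n + 1))
       * ((cfact m * pochs [d; e] m) / pochs [a; b; c] (m + 1)))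
       (2 * c / Csin (PI * c) * T))
  /\
  (a + b = 1 -> d + e = 2 * c -> d <> e ->
   exists T1 T2 : C,
     is_Cseries (fun n =>
       (2 * INR n + 1) / ((INR n + a) * (INR n + b))
       * (1 / ((INR n + e) * (INR n + 1 - e))
          - 1 / ((INR n + d) * (INR n + 1 - d)))) T1 /\
     is_Cseries (fun n =>
       ((-1) ^ n * (2 * INR n + 1)) / ((INR n + a) * (INR n + b))
       * (1 / ((INR n + e) * (INR n + 1 - e))
          + 1 / ((INR n + d) * (INR n + 1 - d)))) T2 /\
     is_sum_0_le_n_le_m (fun n m =>
       ((INR n + INR m + 2 * c) * pochs [a; b; c] n)
         / (cfact n * pochs [d; e] (n + 1))
       * ((cfact m * pochs [d; e] m) / pochs [a; b; c] (m + 1)))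
       (1 / (d - e) * T1
        + Csin (PI * (d - e) / 2) / ((d - e) * Csin (PI * c)) * T2)).
Proof.
apply nonint_of in ha; apply nonint_of in hcZ; apply nonint_of in hd; apply nonint_of in he.
assert (T2 := two_neq0); assert (Sc := sin_pi_neq0 c hcZ).
split.
- intros Hab Hs.
  assert (hb := nonint_complement a b Hab ha).
  assert (hd1 : nonint (d + 1)) by (now apply (nonint_shift d 1)).
  assert (hdm : nonint (d - 1)).
  { replace (d - 1) with (d + IZR (-1)) by ring.
    now apply nonint_shift. }
  destruct (double_sum a b (d + 1) e (c + 1) (d - 1) e c) as [L [HL HT]]; trivial.
  { replace (d + 1 + e) with (d + e + 1) by ring; rewrite Hs; ring. }
  { replace (d - 1 + e) with (d + e - 1) by ring; rewrite Hs; ring. }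
  { unfold Re; simpl; lra. }
  assert (Hd0 := nonint_neq0 d hd); assert (Hd1 := nonint_neq0 _ hdm).
  assert (Hc0 := nonint_neq0 c hcZ).
  exists (Csin (PI * c) / (2 * c) * (c / (d * (d - 1)) * L)); split.
  + apply is_Cseries_csum.
    apply (Clim_scal (Csin (PI * c) / (2 * c) * (c / (d * (d - 1))))) in HL.
    rewrite <- Cmult_assoc in HL.
    apply Clim_ext with (2 := HL); intros M; rewrite <- csum_scal.
    apply csum_ext; intros k _.
    assert (EV : Csin (PI * (d - 1 - c)) = - Ccos (PI * ((d - e) / 2))).
    { assert (X := Ccos_minus_half ((d - e) / 2 + 1 / 2)).
      replace ((d - e) / 2 + 1 / 2 - 1 / 2) with ((d - e) / 2) in X by ring.
      rewrite X, <- Csin_minus_pi; do 2 f_equal.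
      replace (d - 1 - c) with (d - 1 / 2 - (2 * c + 1) / 2) by (field; trivial).
      rewrite <- Hs; field; trivial. }
    rewrite EV.
    assert (Hwa := whipple_watson_value k (d - 1) e (- Ccos (PI * ((d - e) / 2)) / Csin (PI * c)) hdm he).
    destruct (whipple_value_shift k d e hd he) as [Hsh _]; rewrite Hsh; unfold weight.
    assert (Q1 := nonint_nat' a k ha); assert (Q2 := nonint_nat' b k hb).
    assert (Q3 := nonint_nat' d k hd); assert (Q4 := nonint_sub_1 d k hd).
    assert (Q5 := nonint_nat' e k he); assert (Q6 := nonint_sub_1 e k he).
    transitivity (Csin (PI * c) / (2 * c) * (c / (d * (d - 1)))
      * ((2 * INR k + 1) * (d * (1 - d)) / ((INR k + a) * (INR k + b)
          * ((INR k + d) * (INR k + 1 - d))))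
      * ((-1) ^ k * whipple_value (d - 1) e k
         * watson_value (d - 1) e (- Ccos (PI * ((d - e) / 2)) / Csin (PI * c)) k));
      [field; repeat split; trivial|].
    rewrite Hwa.
    assert (HC := cos_cos_term c d e k Hs).
    symmetry.
    transitivity ((2 * INR k + 1) * ((-1) ^ k * (Ccos (PI * (d - INR k) / 2)
       * Ccos (PI * (e - INR k) / 2))) / ((INR k + a) * (INR k + b) * (INR k + d)
       * (INR k + 1 - d) * (INR k + e) * (INR k + 1 - e)));
      [unfold Cdiv; ring|].
    rewrite HC; field; repeat split; trivial.
  + apply tri_summable_is_sum.
    replace (2 * c / Csin (PI * c) * (Csin (PI * c) / (2 * c) * (c / (d * (d - 1)) * L)))
      with (c / (d * (d - 1)) * L + 0 * L) by (field; repeat split; trivial).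
    apply tri_summable_linear with (2 := HT) (3 := HT).
    intros n m _; rewrite !Nat.add_1_r; cbn [pochs fold_right].
    unfold pair_term, alpha, beta.
    rewrite (poch_shift c n), (poch_shift d n), (poch_shift (d - 1) m).
    replace (d - 1 + 1) with d by ring.
    assert (P1 := poch_nonint a (S m) ha).
    assert (P2 := poch_nonint b (S m) hb).
    assert (P3 := poch_nonint c (S m) hcZ).
    assert (P4 := poch_nonint (d + 1) n hd1).
    assert (P5 := poch_nonint e (S n) he).
    assert (X := cfact_neq0 n).
    field; repeat split; trivial.
- intros Hab Hs Hne.
  assert (hb := nonint_complement a b Hab ha).
  assert (Hde : d - e <> 0) by now apply Cminus_eq_contra.
  destruct (half_double_sum a b c d e) as [Le [Le' [H1 [H1' HT1]]]]; trivial.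
  destruct (half_double_sum a b c e d) as [Ld [Ld' [H2 [H2' HT2]]]]; trivial.
  { now rewrite Cplus_comm. }
  exists (Le - Ld), (Le' + Ld'); repeat split.
  + apply is_Cseries_csum.
    apply Clim_ext with (fun M => csum (base_term a b e) M + (-1) * csum (base_term a b d) M).
    2: { apply Clim_eq with (Le + (-1) * Ld); [|ring].
         apply Clim_plus; trivial; now apply Clim_scal. }
    intros M; rewrite <- csum_scal, <- csum_plus; apply csum_ext; intros k _; unfold base_term.
    assert (Q1 := nonint_nat' a k ha); assert (Q2 := nonint_nat' b k hb).
    assert (Q3 := nonint_nat' d k hd); assert (Q4 := nonint_sub_1 d k hd).
    assert (Q5 := nonint_nat' e k he); assert (Q6 := nonint_sub_1 e k he).
    field; repeat split; trivial.
  + apply is_Cseries_csum.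
    apply Clim_ext with (fun M => csum (fun k => (-1) ^ k * base_term a b e k) M
      + csum (fun k => (-1) ^ k * base_term a b d k) M).
    2: { now apply Clim_plus. }
    intros M; rewrite <- csum_plus; apply csum_ext; intros k _; unfold base_term.
    assert (Q1 := nonint_nat' a k ha); assert (Q2 := nonint_nat' b k hb).
    assert (Q3 := nonint_nat' d k hd); assert (Q4 := nonint_sub_1 d k hd).
    assert (Q5 := nonint_nat' e k he); assert (Q6 := nonint_sub_1 e k he).
    field; repeat split; trivial.
  + apply tri_summable_is_sum.
    assert (Ed : PI * (d - c) = PI * (d - e) / 2).
    { replace (PI * (d - c)) with (PI * (2 * d - 2 * c) / 2) by (field; trivial).
      rewrite <- Hs; field; trivial. }
    assert (Ee : PI * (e - c) = - (PI * (d - e) / 2)).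
    { replace (PI * (e - c)) with (PI * (2 * e - 2 * c) / 2) by (field; trivial).
      rewrite <- Hs; field; trivial. }
    rewrite Ed in HT1; rewrite Ee, Csin_opp in HT2.
    replace (1 / (d - e) * (Le - Ld)
        + Csin (PI * (d - e) / 2) / ((d - e) * Csin (PI * c)) * (Le' + Ld'))
      with (1 / (d - e) * (Le + Csin (PI * (d - e) / 2) / Csin (PI * c) * Le')
        + - (1 / (d - e)) * (Ld + - Csin (PI * (d - e) / 2) / Csin (PI * c) * Ld'))
      by (field; split; trivial).
    apply tri_summable_linear with (2 := HT1) (3 := HT2).
    intros n m _; rewrite !Nat.add_1_r; cbn [pochs fold_right].
    unfold pair_term, alpha, beta; rewrite <- Hs, !(poch_S d), !(poch_S e).
    assert (P1 := poch_nonint a (S m) ha); assert (P2 := poch_nonint b (S m) hb).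
    assert (P3 := poch_nonint c (S m) hcZ).
    assert (P4 := poch_nonint d n hd); assert (P5 := poch_nonint e n he).
    assert (P6 := nonint_nat d n hd); assert (P7 := nonint_nat e n he).
    assert (X := cfact_neq0 n).
    field; repeat split; trivial.
Qed.
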